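(* Let $u\in H^1_+(\mathbb{R})$ and let $L_u=D-T_uT_{\bar u}$, a self-adjoint operator on $L^2_+(\mathbb{R})$ with domain $H^1_+(\mathbb{R})$. If $L_u\psi=\lambda\psi$ (with $\psi\in H^1_+(\mathbb{R})$, $\lambda\in\mathbb{R}$), then $$|\langle u,\psi\rangle|^2=2\pi\|\psi\|_{L^2}^2 .$$ In particular, every eigenvalue of $L_u$ is simple, and the number $N$ of eigenvalues of $L_u$ is finite with $$N\le\frac{\|u\|_{L^2}^2}{2\pi}.$$ In particular, $L_u$ has no point spectrum if $\|u\|_{L^2}^2<2\pi$.
   Context: $D=-i\partial_x$; $\langle f,g\rangle=\int_{\mathbb{R}}f\bar g\,dx$. $L^2_+(\mathbb{R})=\{f\in L^2(\mathbb{R}):\operatorname{supp}\hat f\subset[0,\infty)\}$ is the Hardy space, $H^1_+(\mathbb{R})=H^1(\mathbb{R})\cap L^2_+(\mathbb{R})$, and $\Pi_+:L^2(\mathbb{R})\to L^2_+(\mathbb{R})$ is the orthogonal projection. $T_b f=\Pi_+(bf)$ is the Toeplitz operator on $L^2_+(\mathbb{R})$ with symbol $b$; for $u\in H^1_+(\mathbb R)\subset L^\infty(\mathbb R)$, $T_u$ and $T_{\bar u}$ are bounded. Eigenvalues may be embedded in the essential spectrum. *)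

(* Defs.v *)
From HB Require Import structures.
From mathcomp Require Import all_boot all_order all_algebra.
From mathcomp Require Import complex.
From mathcomp Require Import all_classical all_reals all_analysis.

Set Implicit Arguments.
Unset Strict Implicit.
Unset Printing Implicit Defensive.

Import Order.TTheory GRing.Theory Num.Theory.
Import numFieldNormedType.Exports.

Local Open Scope classical_set_scope.
Local Open Scope ring_scope.
Local Open Scope complex_scope.

(* An element of L^2(R; C) is represented by a function R -> R[i]; functions
   are compared up to equality almost everywhere.  Operators on L^2 are
   represented by their graphs: [op f g] reads "f is in the domain of op, and
   g represents op f". *)

Section HardyCalogero.
Context {R : realType}.
Local Notation C := R[i].
Local Notation mu := (@lebesgue_measure R).
Local Notation normc := (@ComplexField.Normc.normc R).
Implicit Types (f g h psi u b : R -> C) (phi : R -> R) (lam : C).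

Definition cintegral f : C :=
  (\int[mu]_x complex.Re (f x)) +i* (\int[mu]_x complex.Im (f x)).

Definition L2 f : Prop :=
  [/\ measurable_fun setT (fun x => complex.Re (f x)),
      measurable_fun setT (fun x => complex.Im (f x)) &
      ('N[mu]_(2%:E)[EFin \o (normc \o f)] < +oo)%E].

Definition L2norm f : R :=
  fine ('N[mu]_(2%:E)[EFin \o (normc \o f)])%E.

Definition inner f g : C := cintegral (fun x => f x * (g x)^*%C).

(* C_c^oo(A).  Distributions are C-linear, so testing against real-valued
   functions is the same as testing against complex-valued ones. *)
Definition test_function (A : set R) phi : Prop :=
  [/\ forall n x, derivable (phi^`(n))%classic x 1,
      compact (closure [set x | phi x != 0]) &
      closure [set x | phi x != 0] `<=` A].

(* \int phi(x) e^{- i x xi} dx *)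
Definition fourier phi (xi : R) : C :=
  cintegral (fun x => (phi x)%:C * (cos (x * xi) -i* sin (x * xi))).

(* The Fourier transform of f in L^2 as a tempered distribution. *)
Definition fourier_pairing f phi : C :=
  cintegral (fun x => f x * fourier phi x).

(* For closed K: the distribution f^ vanishes on the complement of K. *)
Definition fourier_supp_in (K : set R) f : Prop :=
  forall phi, test_function (~` K) phi -> fourier_pairing f phi = 0.

Definition L2p f : Prop := L2 f /\ fourier_supp_in `[0, +oo[ f.

Definition weak_derivative f g : Prop :=
  forall phi, test_function setT phi ->
    cintegral (fun x => f x * ((phi^`())%classic x)%:C) =
    - cintegral (fun x => g x * (phi x)%:C).

Definition H1 f : Prop := L2 f /\ exists2 g, L2 g & weak_derivative f g.

Definition H1p f : Prop := H1 f /\ L2p f.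

(* The orthogonal projection of L^2 onto L^2_+. *)
Definition hardy_proj f g : Prop :=
  [/\ L2 f, L2p g & forall h, L2p h -> inner (fun x => f x - g x) h = 0].

Definition toeplitz b f g : Prop :=
  L2p f /\ hardy_proj (fun x => b x * f x) g.

(* D = - i d/dx with domain H^1_+. *)
Definition momentum f g : Prop :=
  H1p f /\ exists df, [/\ L2 df, weak_derivative f df &
                          g = (fun x => - 'i%C * df x) %[ae mu]].

(* L_u = D - T_u T_{\bar u} *)
Definition lax u f g : Prop :=
  exists Df Tf TTf, [/\ momentum f Df,
    toeplitz (fun x => (u x)^*%C) f Tf,
    toeplitz u Tf TTf &
    g = (fun x => Df x - TTf x) %[ae mu]].

Definition lax_eigenspace u lam : set (R -> C) :=
  [set psi | lax u psi (fun x => lam * psi x)].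

Definition lax_eigenvector u lam psi : Prop :=
  lax_eigenspace u lam psi /\ ~ (psi = (fun=> 0) %[ae mu]).

Definition point_spectrum u : set C :=
  [set lam | exists psi, lax_eigenvector u lam psi].

(* The eigenspace has dimension one, modulo equality almost everywhere. *)
Definition simple_eigenvalue u lam : Prop :=
  exists2 psi, lax_eigenvector u lam psi &
    forall f, lax_eigenspace u lam f ->
      exists c : C, f = (fun x => c * psi x) %[ae mu].

End HardyCalogero.

(* Main.v *)
(* Membership in the Hardy space is equivalent to [\int f / (s - i x) = 0] for
   all s > 0, so everything can be done with Cauchy kernels instead of Fourier
   transforms.  In particular U w is in the Hardy space when U is bounded,
   hence an eigenfunction F solves F' = i (lam F + U w), where w is the
   projection of (conj U) F.  For y > 0 put k (x) = (- y - i x)^-1 and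
   phi = (F - F (i y)) k, which is again in the Hardy space.  Integrating the
   derivative of phi (conj F) over the line, all terms containing lam cancel,
   most others vanish by orthogonality, and there remains
     2 pi \int |F|^2 k^2 = (\int U (conj F) k) (\int (conj U) F k).
   After multiplication by y^2, the limit y -> oo is the norm identity.
   It makes an eigenfunction orthogonal to U vanish, which gives simplicity,
   and since L_u is symmetric, Bessel's inequality for U against the
   eigenfunctions bounds their number. *)

Require Import Defs.
From HB Require Import structures.
From mathcomp Require Import all_boot all_order all_algebra.
From mathcomp Require Import complex.
From mathcomp Require Import all_classical all_reals all_analysis.
From mathcomp Require Import measurable_realfun ring lra.

Set Implicit Arguments.
Unset Strict Implicit.
Unset Printing Implicit Defensive.

Import Order.TTheory GRing.Theory Num.Theory.
Import numFieldNormedType.Exports.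

Local Open Scope classical_set_scope.
Local Open Scope ring_scope.
Local Open Scope complex_scope.

Import ComplexField.Normc.

(** The function [phi] is, up to sign, a resolvent. For the adjoint shifts
    [f -> Pi_+ (e^{-i eta x} f)], integration against [e^{-y eta}] over [eta >= 0] yields [Pi_+ (f /
    (y + i x)) = (f - f(iy)) / (y + i x)]. The resolvent of their generator is bounded on the Hardy
    space, whereas the generator itself, a multiplication by [x] up to a correction, would ask for
    decay that an eigenfunction need not have. The [2 pi] is the constant of Cauchy's formula, which
    expresses [w(iy)] through the integral of [w k].

    Kernels and Fourier support determine each other: [1/(s - i x)] is the Laplace transform of the
    characters of nonnegative frequency, and each such character is a limit of powers of kernels.

    Two points take most of the work. Functions are given up to null sets with weak derivatives, so
    absolutely continuous representatives have to be constructed, together with a product rule and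
    the vanishing of boundary terms at infinity. And [U w] must be shown to be in the Hardy space
    without holomorphic extensions, from integrals on the real line alone. *)

(** * Real part, imaginary part and modulus of a complex number *)

Section ComplexParts.
Context {R : realType}.
Local Notation C := R[i].
Local Notation Re := (@complex.Re R).
Local Notation Im := (@complex.Im R).
Implicit Types (x y z : C) (r : R).

Lemma cReM x y : Re (x * y) = Re x * Re y - Im x * Im y.
Proof. by case: x y => [a b] [c d]. Qed.

Lemma cImM x y : Im (x * y) = Re x * Im y + Im x * Re y.
Proof. by case: x y => [a b] [c d]. Qed.

Lemma cReD x y : Re (x + y) = Re x + Re y.
Proof. by case: x y => [a b] [c d]. Qed.

Lemma cImD x y : Im (x + y) = Im x + Im y.
Proof. by case: x y => [a b] [c d]. Qed.

Lemma cReN x : Re (- x) = - Re x.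
Proof. by case: x. Qed.

Lemma cImN x : Im (- x) = - Im x.
Proof. by case: x. Qed.

Lemma cReJ x : Re x^* = Re x.
Proof. by case: x. Qed.

Lemma cImJ x : Im x^* = - Im x.
Proof. by case: x. Qed.

Definition cReImE := (cReM, cImM, cReD, cImD, cReN, cImN, cReJ, cImJ).

Lemma complex_eq x y : Re x = Re y -> Im x = Im y -> x = y.
Proof. by case: x y => [a b] [c d] /= -> ->. Qed.

Lemma normc_ge0 x : 0 <= normc x.
Proof. by case: x => a b; exact: sqrtr_ge0. Qed.

Lemma normc_sqr x : normc x ^+ 2 = Re x ^+ 2 + Im x ^+ 2.
Proof. by case: x => a b /=; rewrite sqr_sqrtr// addr_ge0// sqr_ge0. Qed.

Lemma normc_eq0 x : (normc x == 0) = (x == 0).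
Proof. by apply/eqP/eqP => [/eq0_normc //|->]; rewrite normc0. Qed.

Lemma normcN x : normc (- x) = normc x.
Proof. by case: x => a b /=; rewrite !sqrrN. Qed.

Lemma normcJ x : normc x^* = normc x.
Proof. by case: x => a b /=; rewrite sqrrN. Qed.

Lemma ler_normcD x y : normc (x + y) <= normc x + normc y.
Proof. exact: (@le_normcD R). Qed.

Lemma ler_normcB x y : normc (x - y) <= normc x + normc y.
Proof. by rewrite -(normcN y) ler_normcD. Qed.

Lemma normc_real r : normc r%:C = `|r|.
Proof. by rewrite /= expr0n addr0 sqrtr_sqr. Qed.

Lemma normcX x n : normc (x ^+ n) = normc x ^+ n.
Proof.
by elim: n => [|n IHn]; rewrite ?expr0 ?normc1// !exprS normcM IHn.
Qed.

Lemma normr_Re_le x : `|Re x| <= normc x.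
Proof.
rewrite -(@ler_pXn2r _ 2%N)// ?nnegrE ?normc_ge0// normc_sqr real_normK ?num_real//.
by rewrite lerDl sqr_ge0.
Qed.

Lemma normr_Im_le x : `|Im x| <= normc x.
Proof.
rewrite -(@ler_pXn2r _ 2%N)// ?nnegrE ?normc_ge0// normc_sqr real_normK ?num_real//.
by rewrite lerDr sqr_ge0.
Qed.

Lemma normc_le_ReIm x : normc x <= `|Re x| + `|Im x|.
Proof.
rewrite -(@ler_pXn2r _ 2%N)// ?nnegrE ?normc_ge0 ?addr_ge0// normc_sqr.
rewrite sqrrD !real_normK ?num_real// lerD2r lerDl mulrn_wge0// mulr_ge0//.
Qed.

Lemma mulcJ_normc x : x * x^* = (normc x ^+ 2)%:C.
Proof.
apply: complex_eq; rewrite !cReImE normc_sqr /=; ring.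
Qed.

Lemma normcE_norm x : `|x| = (normc x)%:C.
Proof. by case: x. Qed.

End ComplexParts.

(** * Measurable complex-valued functions *)

Section ComplexMeasurable.
Context d (T : measurableType d) (R : realType).
Local Notation C := R[i].
Local Notation Re := (@complex.Re R).
Local Notation Im := (@complex.Im R).
Implicit Types (f g : T -> C).

Definition cmeas f :=
  measurable_fun setT (Re \o f) /\ measurable_fun setT (Im \o f).

Lemma cmeas_cst (c : C) : cmeas (fun=> c).
Proof. by split; exact: measurable_cst. Qed.

Lemma cmeas_real (r : T -> R) : measurable_fun setT r -> cmeas (fun x => (r x)%:C).
Proof. by move=> mr; split => //; exact: measurable_cst. Qed.

Lemma cmeasD f g : cmeas f -> cmeas g -> cmeas (fun x => f x + g x).
Proof.
move=> [rf jf] [rg jg]; split.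
  rewrite (_ : _ \o _ = (Re \o f) \+ (Re \o g)).
    exact: measurable_funD.
  by apply/funext => x /=; rewrite cReD.
rewrite (_ : _ \o _ = (Im \o f) \+ (Im \o g)).
  exact: measurable_funD.
by apply/funext => x /=; rewrite cImD.
Qed.

Lemma cmeasM f g : cmeas f -> cmeas g -> cmeas (fun x => f x * g x).
Proof.
move=> [rf jf] [rg jg]; split.
  rewrite (_ : _ \o _ = (fun x => (Re \o f) x * (Re \o g) x - (Im \o f) x * (Im \o g) x)).
    by apply: measurable_funB; exact: measurable_funM.
  by apply/funext => x /=; rewrite cReM.
rewrite (_ : _ \o _ = (fun x => (Re \o f) x * (Im \o g) x + (Im \o f) x * (Re \o g) x)).
  by apply: measurable_funD; exact: measurable_funM.
by apply/funext => x /=; rewrite cImM.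
Qed.

Lemma cmeasN f : cmeas f -> cmeas (fun x => - f x).
Proof.
move=> mf; rewrite (_ : (fun _ => _) = (fun x => (-1) * f x)).
  by apply: cmeasM => //; exact: cmeas_cst.
by apply/funext => x; rewrite mulN1r.
Qed.

Lemma cmeasB f g : cmeas f -> cmeas g -> cmeas (fun x => f x - g x).
Proof. by move=> mf mg; apply: cmeasD => //; exact: cmeasN. Qed.

Lemma cmeasZ (c : C) f : cmeas f -> cmeas (fun x => c * f x).
Proof. by move=> mf; apply: cmeasM => //; exact: cmeas_cst. Qed.

Lemma cmeasJ f : cmeas f -> cmeas (fun x => (f x)^*).
Proof.
move=> [rf jf]; split.
  by rewrite (_ : _ \o _ = Re \o f)//; apply/funext => x /=; rewrite cReJ.
rewrite (_ : _ \o _ = (fun x => - (Im \o f) x)); first exact: measurable_funN.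
by apply/funext => x /=; rewrite cImJ.
Qed.

Lemma cmeasX f n : cmeas f -> cmeas (fun x => f x ^+ n).
Proof.
move=> mf; elim: n => [|n IHn]; first exact: cmeas_cst.
rewrite (_ : (fun _ => _) = (fun x => f x * f x ^+ n)).
  exact: cmeasM.
by apply/funext => x; rewrite exprS.
Qed.

Lemma cmeas_normc f : cmeas f -> measurable_fun setT (fun x => normc (f x)).
Proof.
move=> [rf jf].
rewrite (_ : (fun _ => _) =
  (fun x => Num.sqrt ((Re \o f) x ^+ 2 + (Im \o f) x ^+ 2))).
  apply: (measurableT_comp (continuous_measurable_fun (@sqrt_continuous R))).
  by apply: measurable_funD; exact: measurable_funX.
by apply/funext => x /=; case: (f x).
Qed.

End ComplexMeasurable.

Lemma cmeas_comp d d' (T : measurableType d) (U : measurableType d') (R : realType)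
  (f : U -> R[i]) (g : T -> U) : cmeas f -> measurable_fun setT g ->
  cmeas (fun x => f (g x)).
Proof.
move=> [rf jf] mg; split.
  exact: (measurableT_comp rf mg).
exact: (measurableT_comp jf mg).
Qed.

(** * Limits of complex sequences *)

Lemma cvg_dist_squeeze {R : realType} (r e : nat -> R) (l : R) :
  (forall n, `|r n - l| <= e n) -> e @ \oo --> 0 -> r @ \oo --> l.
Proof.
move=> re e0; apply/cvgrPdist_le => eps eps0.
move/cvgrPdist_le : e0 => /(_ _ eps0); apply: filterS => n.
rewrite sub0r normrN => /(le_trans (ler_norm _)); apply: le_trans.
by rewrite distrC.
Qed.

Section ComplexLimit.
Context {R : realType}.
Local Notation C := R[i].
Local Notation Re := (@complex.Re R).
Local Notation Im := (@complex.Im R).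
Implicit Types (s t : nat -> C) (a b c : C).

Definition ccvg s a := ((fun n => Re (s n)) @ \oo --> Re a) /\
                       ((fun n => Im (s n)) @ \oo --> Im a).

Lemma ccvg_cst c : ccvg (fun=> c) c.
Proof. by split; exact: cvg_cst. Qed.

Lemma ccvg_unique s a b : ccvg s a -> ccvg s b -> a = b.
Proof.
move=> [ra ia] [rb ib]; apply: complex_eq.
- exact: (cvg_unique _ ra rb).
- exact: (cvg_unique _ ia ib).
Qed.

Lemma ccvgD s t a b : ccvg s a -> ccvg t b -> ccvg (fun n => s n + t n) (a + b).
Proof.
move=> [ra ia] [rb ib]; split.
  by under eq_fun do rewrite cReD; rewrite cReD; exact: cvgD.
by under eq_fun do rewrite cImD; rewrite cImD; exact: cvgD.
Qed.

Lemma ccvgM s t a b : ccvg s a -> ccvg t b -> ccvg (fun n => s n * t n) (a * b).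
Proof.
move=> [ra ia] [rb ib]; split.
  by under eq_fun do rewrite cReM; rewrite cReM; apply: cvgB; exact: cvgM.
by under eq_fun do rewrite cImM; rewrite cImM; apply: cvgD; exact: cvgM.
Qed.

Lemma ccvgN s a : ccvg s a -> ccvg (fun n => - s n) (- a).
Proof.
move=> sa; rewrite -mulN1r; under eq_fun do rewrite -mulN1r.
by apply: ccvgM => //; exact: ccvg_cst.
Qed.

Lemma ccvg_real (r : nat -> R) (l : R) : r @ \oo --> l ->
  ccvg (fun n => (r n)%:C) l%:C.
Proof. by move=> rl; split => //; exact: cvg_cst. Qed.

Lemma ccvg_normcP s a : ccvg s a <-> (fun n => normc (s n - a)) @ \oo --> (0:R).
Proof.
split=> [[sr si]|sa].
  apply: (@squeeze_cvgr _ _ _ _ (fun=> 0) (fun n => `|Re (s n) - Re a| + `|Im (s n) - Im a|)).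
  - apply: nearW => n; rewrite normc_ge0/=.
    by have := normc_le_ReIm (s n - a); rewrite !cReImE.
  - exact: cvg_cst.
  - rewrite -[X in _ --> X]addr0; apply: cvgD.
    + by rewrite -(normr0 R); apply: cvg_norm; rewrite -(subrr (Re a)); apply: cvgB => //; exact: cvg_cst.
    + by rewrite -(normr0 R); apply: cvg_norm; rewrite -(subrr (Im a)); apply: cvgB => //; exact: cvg_cst.
split; apply: (cvg_dist_squeeze _ sa) => n.
- by have := normr_Re_le (s n - a); rewrite !cReImE.
- by have := normr_Im_le (s n - a); rewrite !cReImE.
Qed.

End ComplexLimit.

(** * The complex Lebesgue integral: linearity, dominated convergence, changes of variable,
    Fubini *)

Section ComplexIntegral.
Context {R : realType}.
Local Notation C := R[i].
Local Notation Re := (@complex.Re R).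
Local Notation Im := (@complex.Im R).
Local Notation mu := (@lebesgue_measure R).
Implicit Types (f g h : R -> C) (c : C) (r : R -> R).

Lemma ae_imp (P Q : R -> Prop) : (forall x, P x -> Q x) ->
  {ae mu, forall x, P x} -> {ae mu, forall x, Q x}.
Proof.
by move=> PQ; apply: filterS => //; exact: (ae_filter_ringOfSetsType mu).
Qed.

Lemma ae_imp2 (P Q S : R -> Prop) : (forall x, P x -> Q x -> S x) ->
  {ae mu, forall x, P x} -> {ae mu, forall x, Q x} -> {ae mu, forall x, S x}.
Proof.
by move=> PQS; apply: filterS2 => //; exact: (ae_filter_ringOfSetsType mu).
Qed.

Definition rint r := mu.-integrable setT (EFin \o r).

Definition cint f := rint (Re \o f) /\ rint (Im \o f).

Lemma measurable_EFin_comp r : measurable_fun setT r ->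
  @measurable_fun _ _ (measurableTypeR R) _ setT (EFin \o r).
Proof. by move=> mr; exact/measurable_EFinP. Qed.

Lemma rint_measurable r : rint r -> measurable_fun setT r.
Proof. by move=> /measurable_int /measurable_EFinP. Qed.

Lemma rint_le r1 r2 : measurable_fun setT r1 -> rint r2 ->
  (forall x, `|r1 x| <= r2 x) -> rint r1.
Proof.
move=> m1 i2 le12; apply: le_integrable i2 => //; first exact: measurable_EFin_comp.
by move=> x _ /=; rewrite lee_fin (le_trans (le12 x))// ler_norm.
Qed.

Lemma rintD r1 r2 : rint r1 -> rint r2 -> rint (fun x => r1 x + r2 x).
Proof. by move=> i1 i2; have := integrableD measurableT i1 i2. Qed.

Lemma rintZ (k : R) r : rint r -> rint (fun x => k * r x).
Proof. by move=> i1; have := integrableZl measurableT k i1. Qed.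

Lemma rintN r : rint r -> rint (fun x => - r x).
Proof.
move=> ir; rewrite (_ : (fun _ => _) = (fun x => (-1) * r x)); first exact: rintZ.
by apply/funext => x; rewrite mulN1r.
Qed.

Lemma rint0 : rint (fun=> 0).
Proof. exact: integrable0. Qed.

Lemma rint_norm r : rint r -> rint (fun x => `|r x|).
Proof. by move=> ir; have := integrable_norm ir. Qed.

Lemma rint_ae r1 r2 : rint r1 -> measurable_fun setT r2 ->
  {ae mu, forall x, r1 x = r2 x} -> rint r2.
Proof.
move=> i1 m2 r12; apply/integrableP; split; first exact: measurable_EFin_comp.
have /integrableP[_] := i1; apply: le_lt_trans; rewrite le_eqVlt; apply/orP; left.
apply/eqP.
apply: (@ae_eq_integral _ _ _ mu setT
  (EFin \o (fun x => `|r1 x|)) (EFin \o (fun x => `|r2 x|))) => //.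
- apply: measurable_EFin_comp; exact: measurableT_comp.
- apply: measurable_EFin_comp; apply: measurableT_comp => //.
  exact: rint_measurable.
- by apply: (ae_imp _ r12) => x /= ->.
Qed.

Lemma cint_cmeas f : cint f -> cmeas f.
Proof. by move=> [rf jf]; split; exact: rint_measurable. Qed.

Lemma cint_le f r : cmeas f -> rint r -> (forall x, normc (f x) <= r x) -> cint f.
Proof.
move=> [rf jf] ir fr; split.
  by apply: (rint_le rf ir) => x; exact: le_trans (normr_Re_le _) (fr x).
by apply: (rint_le jf ir) => x; exact: le_trans (normr_Im_le _) (fr x).
Qed.

Lemma cint_normc f : cint f -> rint (fun x => normc (f x)).
Proof.
move=> cf; have [rf jf] := cf.
apply: (@rint_le _ (fun x => `|Re (f x)| + `|Im (f x)|)).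
- exact/cmeas_normc/cint_cmeas.
- by apply: rintD; exact: (@rint_norm (_ \o _)).
- by move=> x; rewrite ger0_norm ?normc_ge0// normc_le_ReIm.
Qed.

Lemma cint_real r : rint r -> cint (fun x => (r x)%:C).
Proof. by move=> ir; split => //; exact: rint0. Qed.

Lemma cint_bounded f g (M : R) : cint f -> cmeas g -> (forall x, normc (g x) <= M) ->
  cint (fun x => f x * g x).
Proof.
move=> cf mg gM; apply: (@cint_le _ (fun x => M * normc (f x))).
- by apply: cmeasM => //; exact: cint_cmeas.
- by apply: rintZ; exact: cint_normc.
- by move=> x; rewrite normcM mulrC ler_wpM2r// normc_ge0.
Qed.

Lemma cintZ c f : cint f -> cint (fun x => c * f x).
Proof.
move=> cf; under [X in cint X]eq_fun do rewrite mulrC.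
apply: (@cint_bounded _ _ (normc c)) => //; exact: cmeas_cst.
Qed.

Lemma cintD f g : cint f -> cint g -> cint (fun x => f x + g x).
Proof.
move=> cf cg; apply: (@cint_le _ (fun x => normc (f x) + normc (g x))).
- by apply: cmeasD; exact: cint_cmeas.
- by apply: rintD; exact: cint_normc.
- by move=> x; exact: ler_normcD.
Qed.

Lemma cintN f : cint f -> cint (fun x => - f x).
Proof.
move=> cf; under [X in cint X]eq_fun do rewrite -mulN1r.
exact: cintZ.
Qed.

Lemma cintB f g : cint f -> cint g -> cint (fun x => f x - g x).
Proof. by move=> cf cg; apply: cintD => //; exact: cintN. Qed.

Lemma cintJ f : cint f -> cint (fun x => (f x)^*).
Proof.
move=> cf; apply: (@cint_le _ (fun x => normc (f x))).
- exact/cmeasJ/cint_cmeas.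
- exact: cint_normc.
- by move=> x; rewrite normcJ.
Qed.

Lemma cint0 : cint (fun=> 0).
Proof. by split; exact: rint0. Qed.

Lemma cintegral_ae f g : cmeas f -> cmeas g -> f = g %[ae mu] ->
  cintegral f = cintegral g.
Proof.
move=> [rf jf] [rg jg] fg; rewrite /cintegral /Rintegral; congr (fine _ +i* fine _).
- by apply: ae_eq_integral => //; try exact: measurable_EFin_comp; apply: (ae_imp _ fg) => x /(_ I) /= ->.
- by apply: ae_eq_integral => //; try exact: measurable_EFin_comp; apply: (ae_imp _ fg) => x /(_ I) /= ->.
Qed.

Lemma eq_cintegral f g : f =1 g -> cintegral f = cintegral g.
Proof. by move=> /funext ->. Qed.

Lemma Rintegral0 : \int[mu]_x (0 : R) = 0.
Proof. by rewrite /Rintegral integral0. Qed.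

Lemma cintegral0 : cintegral (fun=> 0 : C) = 0.
Proof. by rewrite /cintegral /= Rintegral0. Qed.

Lemma cintegralD f g : cint f -> cint g ->
  cintegral (fun x => f x + g x) = cintegral f + cintegral g.
Proof.
move=> [rf jf] [rg jg]; apply: complex_eq; rewrite !cReImE /=.
  by under eq_Rintegral do rewrite cReD; exact: RintegralD.
by under eq_Rintegral do rewrite cImD; exact: RintegralD.
Qed.

Lemma cintegralZ c f : cint f ->
  cintegral (fun x => c * f x) = c * cintegral f.
Proof.
move=> [rf jf]; apply: complex_eq; rewrite !cReImE /=.
  under eq_Rintegral do rewrite cReM.
  rewrite RintegralB//; [|exact: rintZ|exact: rintZ].
  by rewrite !RintegralZl.
under eq_Rintegral do rewrite cImM.
rewrite RintegralD//; [|exact: rintZ|exact: rintZ].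
by rewrite !RintegralZl.
Qed.

Lemma cintegralN f : cint f -> cintegral (fun x => - f x) = - cintegral f.
Proof.
move=> cf; rewrite -mulN1r -cintegralZ//.
by apply: eq_cintegral => x; rewrite mulN1r.
Qed.

Lemma cintegralB f g : cint f -> cint g ->
  cintegral (fun x => f x - g x) = cintegral f - cintegral g.
Proof.
by move=> cf cg; rewrite cintegralD//; [rewrite cintegralN|exact: cintN].
Qed.

Lemma cintegralJ f : cint f -> cintegral (fun x => (f x)^*) = (cintegral f)^*.
Proof.
move=> [rf jf]; apply: complex_eq; rewrite !cReImE /=.
  by apply: eq_Rintegral => x _; rewrite cReJ.
under eq_Rintegral do rewrite cImJ -mulN1r.
by rewrite RintegralZl// mulN1r.
Qed.

Lemma cintegral_real r : cintegral (fun x => (r x)%:C) = (\int[mu]_x r x)%:C.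
Proof. by rewrite /cintegral /= Rintegral0. Qed.

(** The two parts are bounded separately, which costs the factor 2. The estimate only serves to
    produce uniform bounds. *)
Lemma normc_cintegral_le f : cint f ->
  normc (cintegral f) <= 2 * \int[mu]_x normc (f x).
Proof.
move=> cf; have [rf jf] := cf; apply: (le_trans (normc_le_ReIm _)); rewrite mulr_natl mulr2n.
apply: lerD.
- rewrite /cintegral/=; apply: (le_trans (le_normr_Rintegral _ _)) => //.
  apply: le_Rintegral => //; [exact: (@rint_norm (_ \o _))|exact: cint_normc|].
  by move=> x _; exact: normr_Re_le.
- rewrite /cintegral/=; apply: (le_trans (le_normr_Rintegral _ _)) => //.
  apply: le_Rintegral => //; [exact: (@rint_norm (_ \o _))|exact: cint_normc|].
  by move=> x _; exact: normr_Im_le.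
Qed.

Lemma rDCT (f : nat -> R -> R) (l r : R -> R) :
  (forall n, measurable_fun setT (f n)) -> measurable_fun setT l ->
  {ae mu, forall x, f ^~ x @ \oo --> l x} -> rint r ->
  (forall n x, `|f n x| <= r x) ->
  (fun n => \int[mu]_x f n x) @ \oo --> \int[mu]_x l x.
Proof.
move=> mf ml fl ir fr.
have [] := @dominated_convergence _ _ _ mu setT measurableT
  (fun n => EFin \o f n) (EFin \o l) (EFin \o r).
- by move=> n; apply: measurable_EFin_comp; exact: mf.
- exact: measurable_EFin_comp.
- apply: (ae_imp _ fl) => x {}fl _; apply: cvg_EFin; first exact: nearW.
  exact: fl.
- exact: ir.
- by apply: aeW => x n _ /=; rewrite lee_fin.
move=> il _ lim; apply: fine_cvg.
rewrite fineK; first exact: lim.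
exact: integrable_fin_num.
Qed.

Lemma cDCT (f : nat -> R -> C) l r :
  (forall n, cmeas (f n)) -> cmeas l ->
  {ae mu, forall x, ccvg (f ^~ x) (l x)} -> rint r ->
  (forall n x, normc (f n x) <= r x) ->
  ccvg (fun n => cintegral (f n)) (cintegral l).
Proof.
move=> mf [rl jl] fl ir fr; split.
- apply: (rDCT _ _ _ ir) => //.
  + by move=> n; case: (mf n).
  + by apply: (ae_imp _ fl) => x [].
  + by move=> n x; exact: le_trans (normr_Re_le _) (fr n x).
- apply: (rDCT _ _ _ ir) => //.
  + by move=> n; case: (mf n).
  + by apply: (ae_imp _ fl) => x [].
  + by move=> n x; exact: le_trans (normr_Im_le _) (fr n x).
Qed.

(** The hypothesis on preimages says that [phi] pushes Lebesgue measure forward to [k] times itself.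
    Affine maps and the reflection [x -> - x] are both instances. *)
Lemma ge0_integral_scaling (phi : R -> R) (k : R) (f : R -> \bar R) : 0 < k ->
  measurable_fun setT phi ->
  (forall A : set (measurableTypeR R), measurable A ->
    mu (phi @^-1` A) = (k%:E * mu A)%E) ->
  measurable_fun setT f -> (forall x, (0 <= f x)%E) ->
  (\int[mu]_x f (phi x) = k%:E * \int[mu]_x f x)%E.
Proof.
move=> k0 mphi phimu mf f0.
have -> : (\int[mu]_x f (phi x))%E =
    (\int[pushforward mu (phi : R -> measurableTypeR R)]_x f x)%E.
  by rewrite ge0_integral_pushforward//= preimage_setT.
transitivity (\int[mscale (NngNum (ltW k0)) mu]_x f x)%E; last first.
  by rewrite ge0_integral_mscale.
by apply: eq_measure_integral => A mA _; rewrite /pushforward /mscale/=; exact: phimu.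
Qed.

Lemma rint_scaling (phi : R -> R) (k : R) r : 0 < k ->
  measurable_fun setT phi ->
  (forall A : set (measurableTypeR R), measurable A ->
    mu (phi @^-1` A) = (k%:E * mu A)%E) ->
  rint r -> rint (r \o phi) /\ \int[mu]_x r (phi x) = k * \int[mu]_x r x.
Proof.
move=> k0 mphi phimu ir.
have mr := measurable_EFin_comp (rint_measurable ir).
have irphi : rint (r \o phi).
  apply/integrableP; split.
    by apply: measurable_EFin_comp; apply: measurableT_comp => //; exact: rint_measurable.
  have := @ge0_integral_scaling phi k (fun x => `|(r x)%:E|%E) k0 mphi phimu.
  move=> -> //; last exact: measurableT_comp.
  have /integrableP[_ ir'] := ir.
  by rewrite lte_mul_pinfty// lee_fin ltW.
split => //; rewrite /Rintegral.
have -> : (\int[mu]_x (r (phi x))%:E = k%:E * \int[mu]_x (r x)%:E)%E.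
  rewrite integralE [in RHS]integralE muleBr//; last first.
    have := integrable_add_def measurableT ir.
    by [].
  rewrite -!(ge0_integral_scaling k0 mphi phimu)//.
  - rewrite (funepos_comp (fun x => (r x)%:E) phi) (funeneg_comp (fun x => (r x)%:E) phi).
    by [].
  - exact: (measurable_funeneg mr).
  - exact: (measurable_funepos mr).
by rewrite fineM// integrable_fin_num.
Qed.

Lemma cint_scaling (phi : R -> R) (k : R) f : 0 < k ->
  measurable_fun setT phi ->
  (forall A : set (measurableTypeR R), measurable A ->
    mu (phi @^-1` A) = (k%:E * mu A)%E) ->
  cint f -> cint (fun x => f (phi x)) /\
    cintegral (fun x => f (phi x)) = k%:C * cintegral f.
Proof.
move=> k0 mphi phimu [rf jf].
have [r1 r2] := rint_scaling k0 mphi phimu rf.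
have [j1 j2] := rint_scaling k0 mphi phimu jf.
split => //; apply: complex_eq; rewrite !cReImE /= ?mul0r ?subr0 ?addr0.
- exact: r2.
- exact: j2.
Qed.

(** By uniqueness of Lebesgue measure: [s] times the pushforward gives every half-open interval its
    length. *)
Lemma lebesgue_measure_affine (s a : R) (A : set (measurableTypeR R)) : 0 < s -> measurable A ->
  mu ((fun x => s * x + a) @^-1` A) = (s^-1%:E * mu A)%E.
Proof.
move=> s0 mA.
pose phi : R -> measurableTypeR R := fun x => s * x + a.
have mphi : measurable_fun setT phi.
  by apply: measurable_funD => //; exact: measurable_funM.
have si0 : 0 <= s by exact: ltW.
suff : mu A = mscale (NngNum si0) (pushforward mu phi) A.
  move=> /(_ mphi); rewrite /mscale/= /pushforward/= => ->; rewrite muleA -EFinM mulVf ?gt_eqF//.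
  by rewrite mul1e.
move=> m.
apply: (@lebesgue_measure_unique R (mscale (NngNum si0) (pushforward mu phi))) => //=.
move=> _ [[c d]] _ <-.
rewrite /mscale/= /pushforward/=.
have -> : phi @^-1` `]c, d] = `](c - a) / s, (d - a) / s]%classic.
  apply/seteqP; split => x /=; rewrite !in_itv/= /phi ltr_pdivrMr// ler_pdivlMr//;
    by rewrite ltrBlDr lerBrDr (mulrC s).
rewrite !lebesgue_measure_itv/= !lte_fin ltr_pM2r ?invr_gt0// ltrD2r.
case: ifP => _; last by rewrite mule0.
rewrite -!EFinB -EFinM; congr (_%:E).
by rewrite -mulrBl mulrCA divff ?gt_eqF// mulr1; ring.
Qed.

Lemma cint_affine (s a : R) f : 0 < s -> cint f ->
  cint (fun x => f (s * x + a)) /\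
  cintegral (fun x => f (s * x + a)) = s^-1%:C * cintegral f.
Proof.
move=> s0 cf; apply: (@cint_scaling (fun x => s * x + a)) => //.
- by rewrite invr_gt0.
- by apply: measurable_funD => //; exact: measurable_funM.
- by move=> A mA; exact: lebesgue_measure_affine.
Qed.

Lemma cint_shift (a : R) f : cint f ->
  cint (fun x => f (x + a)) /\ cintegral (fun x => f (x + a)) = cintegral f.
Proof.
move=> cf; have [] := @cint_affine 1 a f ltr01 cf.
under [X in cint X]eq_fun do rewrite mul1r.
by under [X in cintegral X]eq_fun do rewrite mul1r; rewrite invr1 mul1r.
Qed.

Lemma cint_opp f : cint f ->
  cint (fun x => f (- x)) /\ cintegral (fun x => f (- x)) = cintegral f.
Proof.
move=> cf; have := @cint_scaling (fun x => - x) 1 f ltr01.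
rewrite mul1r; apply => //; first exact: oppr_measurable.
by move=> A mA; rewrite mul1e; exact: lebesgue_measureN.
Qed.

(** Every section is asked to be integrable, so that the real integral, a finite part, agrees with
    the extended one at each point. *)
Lemma rFubini (r : R * R -> R) :
  (mu \x mu)%E.-integrable setT (EFin \o r) ->
  (forall x, rint (fun y => r (x, y))) -> (forall y, rint (fun x => r (x, y))) ->
  \int[mu]_x (\int[mu]_y r (x, y)) = \int[mu]_y (\int[mu]_x r (x, y)).
Proof.
move=> ir r1 r2.
transitivity (fine (\int[mu]_x \int[mu]_y (r (x, y))%:E)%E).
  congr fine; apply: eq_integral => x _.
  by rewrite /Rintegral fineK//; exact: (integrable_fin_num measurableT (r1 x)).
rewrite (Fubini ir); congr fine; apply: eq_integral => y _.
by rewrite /Rintegral fineK//; exact: (integrable_fin_num measurableT (r2 y)).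
Qed.

(** This shape covers every exchange of integrals below: [K] is a character, a translated kernel or
    the indicator of a half-plane, and [M |a(x)| |b(y)|] dominates. *)
Lemma cFubini (a b : R -> C) (K : R * R -> C) (M : R) : cint a -> cint b ->
  cmeas K -> (forall z, normc (K z) <= M) ->
  cintegral (fun x => a x * cintegral (fun y => b y * K (x, y))) =
  cintegral (fun y => b y * cintegral (fun x => a x * K (x, y))).
Proof.
move=> ia ib mK KM.
have M0 : 0 <= M by exact: le_trans (normc_ge0 _) (KM (0, 0)).
pose F (z : R * R) : C := a z.1 * b z.2 * K z.
have mF : cmeas F.
  apply: cmeasM => //; apply: cmeasM.
    by apply: (cmeas_comp (cint_cmeas ia)).
  by apply: (cmeas_comp (cint_cmeas ib)).
have inn1 x : cint (fun y => F (x, y)).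
  apply: (@cint_bounded (fun y => a x * b y) (fun y => K (x, y)) M) => //.
    exact: cintZ.
  by apply: (cmeas_comp mK).
have inn2 y : cint (fun x => F (x, y)).
  apply: (@cint_bounded (fun x => a x * b y) (fun x => K (x, y)) M) => //.
    by under [X in cint X]eq_fun do rewrite mulrC; exact: cintZ.
  by apply: (cmeas_comp mK).
have FE1 x : a x * cintegral (fun y => b y * K (x, y)) = cintegral (fun y => F (x, y)).
  rewrite -cintegralZ; last first.
    apply: (@cint_bounded b (fun y => K (x, y)) M) => //.
    by apply: (cmeas_comp mK).
  by apply: eq_cintegral => y; rewrite /F mulrA.
have FE2 y : b y * cintegral (fun x => a x * K (x, y)) = cintegral (fun x => F (x, y)).
  rewrite -cintegralZ; last first.
    apply: (@cint_bounded a (fun x => K (x, y)) M) => //.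
    by apply: (cmeas_comp mK).
  by apply: eq_cintegral => x; rewrite /F mulrA (mulrC (a x)).
under eq_cintegral do rewrite FE1.
under [RHS]eq_cintegral do rewrite FE2.
pose B := \int[mu]_y normc (b y).
pose G (z : R * R) := M * (normc (a z.1) * normc (b z.2)).
have mG : measurable_fun setT G.
  apply: measurable_funM => //; apply: measurable_funM.
    by apply: (measurableT_comp (cmeas_normc (cint_cmeas ia))).
  by apply: (measurableT_comp (cmeas_normc (cint_cmeas ib))).
have GE x : (\int[mu]_y `|(EFin \o G) (x, y)|%E)%E = (M * B * normc (a x))%:E.
  transitivity (\int[mu]_y (M * normc (a x) * normc (b y))%:E)%E.
    apply: eq_integral => y _; rewrite /G/= ger0_norm ?mulrA//.
    by rewrite !mulr_ge0 ?normc_ge0.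
  have ii := rintZ (M * normc (a x)) (cint_normc ib).
  rewrite -(fineK (integrable_fin_num measurableT ii)); congr EFin.
  rewrite -[LHS]/(\int[mu]_y (M * normc (a x) * normc (b y))).
  by rewrite RintegralZl//; [rewrite mulrAC|exact: cint_normc].
have iG : (mu \x mu)%E.-integrable setT (EFin \o G).
  apply/integrable12ltyP; first exact/measurable_EFinP.
  under eq_integral do rewrite GE.
  by apply: integrable_lty => //; apply: rintZ; exact: cint_normc.
have key (r : R * R -> R) : measurable_fun setT r ->
    (forall z, `|r z| <= normc (F z)) ->
    (mu \x mu)%E.-integrable setT (EFin \o r).
  move=> mr rF; apply: (le_integrable measurableT _ _ iG).
    exact/measurable_EFinP.
  move=> z _ /=; rewrite lee_fin (le_trans (rF z))//.
  rewrite (le_trans _ (ler_norm _))// /F /G !normcM mulrC ler_wpM2r//.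
  by rewrite mulr_ge0// normc_ge0.
apply: complex_eq.
- apply: (@rFubini (fun z => Re (F z))).
  + by apply: key => [|z]; [case: mF|exact: normr_Re_le].
  + by move=> x; case: (inn1 x).
  + by move=> y; case: (inn2 y).
- apply: (@rFubini (fun z => Im (F z))).
  + by apply: key => [|z]; [case: mF|exact: normr_Im_le].
  + by move=> x; case: (inn1 x).
  + by move=> y; case: (inn2 y).
Qed.

End ComplexIntegral.

(** * Square-integrable functions and the inner product *)

Section SquareIntegrable.
Context {R : realType}.
Local Notation C := R[i].
Local Notation Re := (@complex.Re R).
Local Notation Im := (@complex.Im R).
Local Notation mu := (@lebesgue_measure R).
Implicit Types (f g h : R -> C) (c : C) (r : R -> R).

Lemma L2_normc_powR f :
  (\int[mu]_x (`|(EFin \o (@normc R \o f)) x| `^ 2) = \int[mu]_x (normc (f x) ^+ 2)%:E)%E.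
Proof.
apply: eq_integral => x _ /=; rewrite ?poweR_EFin powR_mulrn//.
by rewrite real_normK ?num_real.
Qed.

Lemma L2P f : L2 f <-> cmeas f /\ rint (fun x => normc (f x) ^+ 2).
Proof.
have two0 : 2%R != 0 :> R by rewrite pnatr_eq0.
split=> [[rf jf fN]|[[rf jf] fi]].
  split; first by split.
  apply/integrableP; split.
    apply: measurable_EFin_comp; apply: measurable_funX.
    by apply: cmeas_normc; split.
  move: fN => /(poweR_lty 2); rewrite poweR_Lnorm// L2_normc_powR.
  apply: le_lt_trans; rewrite le_eqVlt; apply/orP; left; apply/eqP.
  by apply: eq_integral => x _ /=; rewrite ger0_norm// sqr_ge0.
split => //; apply: (lty_poweRy two0); rewrite poweR_Lnorm// L2_normc_powR.
exact: (integrable_lty measurableT fi).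
Qed.

Lemma L2norm_sqr f : L2norm f ^+ 2 = \int[mu]_x normc (f x) ^+ 2.
Proof.
have two0 : 2%R != 0 :> R by rewrite pnatr_eq0.
rewrite /L2norm -powR_mulrn; last by apply: fine_ge0; exact: Lnorm_ge0.
by rewrite -fine_poweR poweR_Lnorm// L2_normc_powR.
Qed.

Lemma L2_cmeas f : L2 f -> cmeas f.
Proof. by case/L2P. Qed.

Lemma L2_mul f g : L2 f -> L2 g -> cint (fun x => f x * g x).
Proof.
move=> /L2P[mf jf] /L2P[mg jg].
apply: (@cint_le _ _ (fun x => normc (f x) ^+ 2 + normc (g x) ^+ 2)).
- exact: cmeasM.
- exact: rintD.
move=> x; rewrite normcM; have := normc_ge0 (f x); have := normc_ge0 (g x).
move: (normc (f x)) (normc (g x)) => a b b0 a0; nra.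
Qed.

Lemma L2_le f r : cmeas f -> rint (fun x => r x ^+ 2) ->
  (forall x, normc (f x) <= r x) -> L2 f.
Proof.
move=> mf ir fr; apply/L2P; split => //; apply: (rint_le _ ir) => [|x].
  by apply: measurable_funX; exact: cmeas_normc.
rewrite ger0_norm ?sqr_ge0// ler_sqr ?nnegrE ?normc_ge0//.
exact: le_trans (normc_ge0 _) (fr x).
Qed.

Lemma L2_bounded f g (M : R) : L2 f -> cmeas g -> (forall x, normc (g x) <= M) ->
  L2 (fun x => f x * g x).
Proof.
move=> /L2P[mf jf] mg gM; apply: (@L2_le _ (fun x => M * normc (f x))).
- exact: cmeasM.
- by under [X in rint X]eq_fun do rewrite exprMn; exact: rintZ.
- by move=> x; rewrite normcM mulrC ler_wpM2r// normc_ge0.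
Qed.

Lemma L2Z c f : L2 f -> L2 (fun x => c * f x).
Proof.
move=> lf; under [X in L2 X]eq_fun do rewrite mulrC.
by apply: (@L2_bounded _ _ (normc c)) => //; exact: cmeas_cst.
Qed.

Lemma L2D f g : L2 f -> L2 g -> L2 (fun x => f x + g x).
Proof.
move=> /L2P[mf jf] /L2P[mg jg]; apply/L2P; split; first exact: cmeasD.
apply: (@rint_le _ _ (fun x => 2 * (normc (f x) ^+ 2 + normc (g x) ^+ 2))).
- by apply: measurable_funX; apply: cmeas_normc; exact: cmeasD.
- by apply: rintZ; exact: rintD.
move=> x; rewrite ger0_norm ?sqr_ge0//.
have := ler_normcD (f x) (g x); have := normc_ge0 (f x + g x).
have := normc_ge0 (f x); have := normc_ge0 (g x).
move: (normc (f x + g x)) (normc (f x)) (normc (g x)) => d a b b0 a0 d0 dab.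
have : d ^+ 2 <= (a + b) ^+ 2 by rewrite ler_sqr ?nnegrE ?addr_ge0.
by have := sqr_ge0 (a - b); nra.
Qed.

Lemma L2N f : L2 f -> L2 (fun x => - f x).
Proof. by move=> lf; under [X in L2 X]eq_fun do rewrite -mulN1r; exact: L2Z. Qed.

Lemma L2B f g : L2 f -> L2 g -> L2 (fun x => f x - g x).
Proof. by move=> lf lg; apply: L2D => //; exact: L2N. Qed.

Lemma L2J f : L2 f -> L2 (fun x => (f x)^*).
Proof.
move=> /L2P[mf jf]; apply/L2P; split; first exact: cmeasJ.
by under [X in rint X]eq_fun do rewrite normcJ.
Qed.

Lemma L2_ae f g : L2 f -> cmeas g -> f = g %[ae mu] -> L2 g.
Proof.
move=> /L2P[mf jf] mg fg; apply/L2P; split => //; apply: (rint_ae jf).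
  by apply: measurable_funX; exact: cmeas_normc.
by apply: (ae_imp _ fg) => x /(_ I) /= ->.
Qed.

Lemma cint_inner f g : L2 f -> L2 g -> cint (fun x => f x * (g x)^*).
Proof. by move=> lf lg; apply: L2_mul => //; exact: L2J. Qed.

Lemma innerZl c f h : L2 f -> L2 h -> inner (fun x => c * f x) h = c * inner f h.
Proof.
move=> lf lh; rewrite /inner -cintegralZ; last exact: cint_inner.
by apply: eq_cintegral => x; rewrite mulrA.
Qed.

Lemma innerBl f g h : L2 f -> L2 g -> L2 h ->
  inner (fun x => f x - g x) h = inner f h - inner g h.
Proof.
move=> lf lg lh; rewrite /inner -cintegralB; try exact: cint_inner.
by apply: eq_cintegral => x; rewrite mulrBl.
Qed.

Lemma innerC f g : L2 f -> L2 g -> inner g f = (inner f g)^*.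
Proof.
move=> lf lg; rewrite /inner -cintegralJ; last exact: cint_inner.
by apply: eq_cintegral => x; rewrite rmorphM /= conjcK mulrC.
Qed.

Lemma innerZr c f h : L2 f -> L2 h -> inner f (fun x => c * h x) = c^* * inner f h.
Proof.
move=> lf lh; have lch := L2Z c lh.
by rewrite (innerC lch lf) (innerC lh lf) innerZl// rmorphM.
Qed.

Lemma innerBr f g h : L2 f -> L2 g -> L2 h ->
  inner f (fun x => g x - h x) = inner f g - inner f h.
Proof.
move=> lf lg lh; have lgh := L2B lg lh.
by rewrite (innerC lgh lf) (innerC lg lf) (innerC lh lf) innerBl// rmorphB.
Qed.

Lemma inner_ae f f' g g' : L2 f -> L2 f' -> L2 g -> L2 g' ->
  f = f' %[ae mu] -> g = g' %[ae mu] -> inner f g = inner f' g'.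
Proof.
move=> lf lf' lg lg' ff gg; apply: cintegral_ae.
- by apply: cint_cmeas; exact: cint_inner.
- by apply: cint_cmeas; exact: cint_inner.
- by apply: (ae_imp2 _ ff gg) => x /(_ I) ffx /(_ I) ggx _ /=; rewrite ffx ggx.
Qed.

Lemma inner_self f : inner f f = (L2norm f ^+ 2)%:C.
Proof.
rewrite L2norm_sqr -cintegral_real; apply: eq_cintegral => x.
by rewrite mulcJ_normc.
Qed.

Lemma L2norm_eq0 f : L2 f -> L2norm f ^+ 2 = 0 -> f = (fun=> 0) %[ae mu].
Proof.
move=> /L2P[mf jf]; rewrite L2norm_sqr => f0.
have : (\int[mu]_x `|(EFin \o (fun x => (normc (f x) ^+ 2)%R)) x| = 0)%E.
  transitivity (\int[mu]_x (normc (f x) ^+ 2)%:E)%E.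
    by apply: eq_integral => x _ /=; rewrite ger0_norm// sqr_ge0.
  rewrite -(fineK (integrable_fin_num measurableT jf)).
  by rewrite -[RHS]/((0:R)%:E) -[in RHS]f0.
move/ae_eq_integral_abs => /(_ measurableT) H.
have {}H := H (measurable_EFin_comp (rint_measurable jf)).
apply: (ae_imp _ H) => x /(_ I) /= /eqP.
by rewrite eqe expf_eq0 /= normc_eq0 => /eqP ->.
Qed.

End SquareIntegrable.

(** * The fundamental theorem of calculus on the line and on the half-line *)

Section RealCalculus.
Context {R : realType}.
Local Notation mu := (@lebesgue_measure R).
Implicit Types (f g F : R -> R).

Lemma cvg_seq_unique (s : nat -> R) (a b : R) :
  s @ \oo --> a -> s @ \oo --> b -> a = b.
Proof. by move=> sa sb; exact: (cvg_unique _ sa sb). Qed.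

Lemma is_derive_fctD f g (x a b : R) : is_derive x 1 f a -> is_derive x 1 g b ->
  is_derive x 1 (fun y => f y + g y) (a + b).
Proof. exact: is_deriveD. Qed.

Lemma is_derive_fctM f g (x a b : R) : is_derive x 1 f a -> is_derive x 1 g b ->
  is_derive x 1 (fun y => f y * g y) (f x * b + g x * a).
Proof. exact: is_deriveM. Qed.

Lemma is_derive_fctN f (x a : R) : is_derive x 1 f a ->
  is_derive x 1 (fun y => - f y) (- a).
Proof. exact: is_deriveN. Qed.

Lemma is_derive_fctZ f (k x a : R) : is_derive x 1 f a ->
  is_derive x 1 (fun y => k * f y) (k * a).
Proof. exact: is_deriveZ. Qed.

Lemma is_derive_fct_comp f g (x a b : R) : is_derive (g x) 1 f a ->
  is_derive x 1 g b -> is_derive x 1 (fun y => f (g y)) (a * b).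
Proof. by move=> df dg; exact: (@is_derive1_comp R f g x a b). Qed.

Lemma is_derive_continuous F f : (forall x : R, is_derive x 1 F (f x)) -> continuous F.
Proof.
by move=> dF x; apply/differentiable_continuous/derivable1_diffP.
Qed.

Lemma FTC2 F f (a b : R) : a <= b -> (forall x : R, is_derive x 1 F (f x)) ->
  continuous f -> \int[mu]_(x in `[a, b]) f x = F b - F a.
Proof.
rewrite le_eqVlt => /predU1P[->|ab] dF cf.
  by rewrite set_itv1 Rintegral_set1 subrr.
have cF := is_derive_continuous dF.
rewrite /Rintegral (@continuous_FTC2 _ f F)//.
- exact: continuous_subspaceT.
- split => //; first by apply: cvg_at_right_filter; exact: cF.
  by apply: cvg_at_left_filter; exact: cF.
- by move=> x _; rewrite derive1E derive_val.
Qed.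

Lemma Rintegral_patch (D : set R) f :
  \int[mu]_x (f \_ D) x = \int[mu]_(x in D) f x.
Proof. by rewrite [RHS]Rintegral_mkcond. Qed.

Lemma measurable_patch (D : set (measurableTypeR R)) f : measurable D ->
  measurable_fun setT f -> measurable_fun setT (f \_ D).
Proof.
by move=> mD mf; apply: (iffLR (measurable_restrictT f mD)); exact: measurable_funS mf.
Qed.

Lemma patch_in (D : set R) f x : D x -> (f \_ D) x = f x.
Proof. by move=> Dx; rewrite patchE mem_set. Qed.

Lemma patch_out (D : set R) f x : ~ D x -> (f \_ D) x = 0.
Proof. by move=> Dx; rewrite patchE memNset. Qed.

Lemma normr_patch_le (D : set R) f x : `|(f \_ D) x| <= `|f x|.
Proof. by rewrite patchE; case: ifP => //; rewrite normr0. Qed.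

(** The integral over the line is the limit of the integrals over [[-n, n]], so limits of [F] along
    the integers suffice. *)
Lemma FTC2_line F f (l l' : R) : (forall x : R, is_derive x 1 F (f x)) ->
  continuous f -> rint f -> F n%:R @[n --> \oo] --> l ->
  F (- n%:R) @[n --> \oo] --> l' -> \int[mu]_x f x = l - l'.
Proof.
move=> dF cf fi Fl Fl'.
have mf := continuous_measurable_fun cf.
have lim : (fun n => \int[mu]_x (f \_ `[- n%:R, n%:R]) x) @ \oo --> \int[mu]_x f x.
  apply: (rDCT _ mf _ (rint_norm fi)).
  - by move=> n; apply: measurable_patch.
  - apply: aeW => x /=; apply: cvg_near_cst; near=> n.
    rewrite patchE mem_set//= in_itv/= -ler_norml.
    by near: n; exact: nbhs_infty_ger.
  - by move=> n x; exact: normr_patch_le.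
have E n : \int[mu]_x (f \_ `[- n%:R, n%:R]) x = F n%:R - F (- n%:R).
  by rewrite Rintegral_patch (FTC2 _ dF)// (le_trans _ (ler0n _ n))// oppr_le0.
move: lim; under eq_fun do rewrite E.
by move=> lim; apply: (cvg_seq_unique lim); exact: cvgB.
Unshelve. all: by end_near. Qed.

Lemma FTC2_half F f (l : R) : (forall x : R, is_derive x 1 F (f x)) ->
  continuous f -> rint (f \_ `[0, +oo[) -> F n%:R @[n --> \oo] --> l ->
  \int[mu]_x (f \_ `[0, +oo[) x = l - F 0.
Proof.
move=> dF cf fi Fl.
have mf := continuous_measurable_fun cf.
have lim : (fun n => \int[mu]_x (f \_ `[0, n%:R]) x) @ \oo -->
    \int[mu]_x (f \_ `[0, +oo[) x.
  apply: (rDCT _ _ _ (rint_norm fi)).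
  - by move=> n; apply: measurable_patch.
  - exact: measurable_patch.
  - apply: aeW => x /=; apply: cvg_near_cst; near=> n.
    rewrite !patchE; congr (if _ then _ else _); apply: asbool_equiv_eq => /=.
    rewrite !in_itv/= andbT; split => [/andP[]//|->/=].
    by rewrite (le_trans (ler_norm x))//; near: n; exact: nbhs_infty_ger.
  - move=> n x; rewrite !patchE; case: ifPn => [|_]; last by rewrite normr0.
    rewrite inE/= in_itv/= => /andP[x0 _].
    by rewrite mem_set//= in_itv/= x0.
have E n : \int[mu]_x (f \_ `[0, n%:R]) x = F n%:R - F 0.
  by rewrite Rintegral_patch (FTC2 _ dF).
move: lim; under eq_fun do rewrite E.
by move=> lim; apply: (cvg_seq_unique lim); apply: cvgB => //; exact: cvg_cst.
Unshelve. all: by end_near. Qed.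

Lemma rint_ge0_half F f (l : R) : (forall x, 0 <= f x) -> continuous f ->
  (forall x : R, is_derive x 1 F (f x)) -> F x @[x --> +oo] --> l ->
  rint (f \_ `[0, +oo[).
Proof.
move=> f0 cf dF Fl.
have mf := continuous_measurable_fun cf.
apply/integrableP; split.
  by apply: measurable_EFin_comp; exact: measurable_patch.
rewrite (_ : (\int[mu]_x _)%E = (\int[mu]_(x in `[0%R, +oo[) (f x)%:E)%E); last first.
  rewrite [RHS]integral_mkcond; apply: eq_integral => x _ /=.
  rewrite !patchE; case: ifP => _; last by rewrite normr0.
  by rewrite ger0_norm.
rewrite (ge0_continuous_FTC2y (F := F) (l := l))//.
- by rewrite -EFinB ltry.
- exact: continuous_subspaceT.
- by apply: cvg_at_right_filter; exact: (is_derive_continuous dF).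
- by move=> x _; rewrite derive1E derive_val.
Qed.

Lemma cvg_natr (T : topologicalType) (F : R -> T) (l : set_system T) :
  F x @[x --> +oo] --> l -> F n%:R @[n --> \oo] --> l.
Proof.
by move=> Fl; apply: cvg_comp Fl; exact: cvgr_idn.
Qed.

Lemma oneDsqr_gt0 (x : R) : 0 < 1 + x ^+ 2.
Proof. by rewrite ltr_wpDr// sqr_ge0. Qed.

Lemma rint_oneDsqr : rint (fun x : R => (1 + x ^+ 2)^-1).
Proof.
pose f (x : R) := (1 + x ^+ 2)^-1.
have f0 x : 0 <= f x by rewrite invr_ge0 ltW// oneDsqr_gt0.
have fi : rint (f \_ `[0, +oo[).
  apply: (@rint_ge0_half atan _ (pi / 2)) => //.
  - exact: continuous_oneDsqrV.
  - exact: cvgy_atan.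
have [[fi' _] _] := cint_opp (cint_real fi).
have mf : measurable_fun setT f.
  by apply: continuous_measurable_fun; exact: continuous_oneDsqrV.
(* The even function is dominated by its half-line piece plus the reflection of that piece; the two
   overlap only at 0. *)
apply: (rint_le mf (rintD fi fi')) => x /=.
have fp y : 0 <= (f \_ `[0, +oo[) y.
  by rewrite patchE; case: ifP => // _; exact: f0.
rewrite ger0_norm//; have [x0|x0] := leP 0 x.
  by rewrite patch_in ?lerDl//= in_itv/= andbT.
rewrite [X in _ <= _ + X]patch_in; first by rewrite /f sqrrN lerDr.
by rewrite /= in_itv/= andbT oppr_ge0 ltW.
Qed.

Lemma cvgNy_atan : (@atan R) (- n%:R) @[n --> \oo] --> - (pi / 2).
Proof.
under eq_cvg do rewrite atanN; apply: cvgN.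
by apply: (@cvg_natr _ atan); exact: cvgy_atan.
Qed.

Lemma Rintegral_oneDsqr : \int[mu]_x (1 + x ^+ 2)^-1 = pi :> R.
Proof.
rewrite (@FTC2_line atan _ (pi / 2) (- (pi / 2))) ?opprK -?splitr//.
- exact: continuous_oneDsqrV.
- exact: rint_oneDsqr.
- by apply: (@cvg_natr _ atan); exact: cvgy_atan.
- exact: cvgNy_atan.
Qed.

End RealCalculus.

(** * Characters, Cauchy kernels and the Laplace transform that relates them *)

Section Kernel.
Context {R : realType}.
Local Notation C := R[i].
Local Notation Re := (@complex.Re R).
Local Notation Im := (@complex.Im R).
Local Notation mu := (@lebesgue_measure R).
Implicit Types (s t x y : R).

Definition cis t : C := cos t +i* sin t.

Lemma cisD x y : cis (x + y) = cis x * cis y.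
Proof. by apply: complex_eq; rewrite !cReImE /= ?cosD ?sinD //; ring. Qed.

Lemma cis0 : cis 0 = 1.
Proof. by rewrite /cis cos0 sin0. Qed.

Lemma normc_cis x : normc (cis x) = 1.
Proof. by rewrite /= cos2Dsin2 sqrtr1. Qed.

Lemma cisX x n : cis x ^+ n = cis (n%:R * x).
Proof.
elim: n => [|n IHn]; first by rewrite expr0 mul0r cis0.
by rewrite exprS IHn -cisD -natr1 mulrDl mul1r addrC.
Qed.

Lemma cmeas_cis : cmeas cis.
Proof.
split; apply: continuous_measurable_fun.
- exact: continuous_cos.
- exact: continuous_sin.
Qed.

(** This is [i / (x + i t)]. For [t > 0] the pole is in the lower half plane and the kernel is in
    the Hardy space; for [t < 0] it is minus the conjugate of such a kernel, with pole in the upper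
    half plane. *)
Definition ker t x : C := (t -i* x)^-1.

Arguments ker : simpl never.

Lemma kerE t x : ker t x = (t / (t ^+ 2 + x ^+ 2)) +i* (x / (t ^+ 2 + x ^+ 2)).
Proof. by rewrite /ker /GRing.inv /= sqrrN mulNr opprK. Qed.

Lemma ker_den_gt0 t x : t != 0 -> 0 < t ^+ 2 + x ^+ 2.
Proof. by move=> t0; rewrite ltr_wpDr ?sqr_ge0// exprn_even_gt0. Qed.

Lemma ker_neq0 t x : t != 0 -> (t -i* x : C) != 0.
Proof. by move=> t0; rewrite eq_complex /= negb_and t0. Qed.

Lemma Re_ker t x : Re (ker t x) = t / (t ^+ 2 + x ^+ 2).
Proof. by rewrite kerE. Qed.

Lemma Im_ker t x : Im (ker t x) = x / (t ^+ 2 + x ^+ 2).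
Proof. by rewrite kerE. Qed.

Lemma kerJ t x : (ker t x)^* = - ker (- t) x.
Proof. by apply: complex_eq; rewrite !cReImE ?Re_ker ?Im_ker sqrrN ?mulNr ?opprK. Qed.

Lemma normc_ker_sqr t x : t != 0 -> normc (ker t x) ^+ 2 = (t ^+ 2 + x ^+ 2)^-1.
Proof.
move=> t0; rewrite normc_sqr Re_ker Im_ker; have := ker_den_gt0 x t0.
by move/gt_eqF => d0; field; rewrite d0.
Qed.

Lemma normc_ker_le t x : t != 0 -> normc (ker t x) <= `|t|^-1.
Proof.
move=> t0; rewrite -ler_sqr ?nnegrE ?normc_ge0 ?invr_ge0// normc_ker_sqr//.
rewrite exprVn real_normK ?num_real// lef_pV2 ?posrE ?ker_den_gt0// ?exprn_even_gt0//.
by rewrite lerDl sqr_ge0.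
Qed.

Lemma ker_split s t x : s != 0 -> t != 0 ->
  (t - s)%:C * (ker s x * ker t x) = ker s x - ker t x.
Proof.
move=> s0 t0; rewrite /ker.
have hs := ker_neq0 x s0; have ht := ker_neq0 x t0.
have -> : (t - s)%:C = (t -i* x) - (s -i* x).
  by apply: complex_eq; rewrite !cReImE /=; ring.
move: (s -i* x) (t -i* x) hs ht => a b a0 b0; field.
by rewrite a0 b0.
Qed.

Lemma continuous_ker_den t : t != 0 -> continuous (fun x => (t ^+ 2 + x ^+ 2)^-1 : R).
Proof.
move=> t0 x; apply: cvgV; first by rewrite gt_eqF// ker_den_gt0.
by apply: cvgD; [exact: cvg_cst|exact: exprn_continuous].
Qed.

Lemma cmeas_ker t : t != 0 -> cmeas (ker t).
Proof.
move=> t0; have m := continuous_measurable_fun (continuous_ker_den t0).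
split.
- rewrite (_ : _ \o _ = (fun x => t * (t ^+ 2 + x ^+ 2)^-1)); last first.
    by apply/funext => x; exact: Re_ker.
  exact: measurable_funM.
- rewrite (_ : _ \o _ = (fun x => x * (t ^+ 2 + x ^+ 2)^-1)); last first.
    by apply/funext => x; exact: Im_ker.
  exact: measurable_funM.
Qed.

Lemma ker_den_scale t x : t != 0 ->
  (t ^+ 2 + x ^+ 2)^-1 = t ^- 2 * (1 + (x / t) ^+ 2)^-1.
Proof.
move=> t0; rewrite -invfM; congr (_^-1); rewrite mulrDr mulr1 -exprMn mulrCA divff//.
by rewrite mulr1.
Qed.

Lemma ker_den_rint t : 0 < t -> rint (fun x => (t ^+ 2 + x ^+ 2)^-1) /\
  \int[mu]_x (t ^+ 2 + x ^+ 2)^-1 = pi / t.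
Proof.
move=> t0; have t0' : t != 0 by rewrite gt_eqF.
have ti0 : 0 < t^-1 by rewrite invr_gt0.
have [i1 i2] := @cint_affine _ t^-1 0 _ ti0 (cint_real (@rint_oneDsqr R)).
have E : (fun x => (t ^+ 2 + x ^+ 2)^-1) =
    (fun x => t ^- 2 * (1 + (t^-1 * x + 0) ^+ 2)^-1).
  by apply/funext => x; rewrite ker_den_scale// addr0 (mulrC x).
rewrite E; split; first by apply: rintZ; case: i1.
rewrite RintegralZl//; last by case: i1.
move: i2; rewrite !cintegral_real -rmorphM/= invrK Rintegral_oneDsqr => -[->].
by field.
Qed.

Lemma L2_ker t : t != 0 -> L2 (ker t).
Proof.
move=> t0; apply/L2P; split; first exact: cmeas_ker.
under [X in rint X]eq_fun do rewrite normc_ker_sqr//.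
have [t1|t1] := ltP 0 t; first by case: (ker_den_rint t1).
have t2 : 0 < - t by rewrite oppr_gt0 lt_neqAle t0.
by have [] := ker_den_rint t2; rewrite sqrrN.
Qed.

Lemma Rintegral_Re_ker t : t != 0 -> rint (fun x => Re (ker t x)) /\
  \int[mu]_x Re (ker t x) = Num.sg t * pi.
Proof.
move=> t0; have E : (fun x => Re (ker t x)) = (fun x => t * (t ^+ 2 + x ^+ 2)^-1).
  by apply/funext => x; rewrite Re_ker.
rewrite E; have [t1|t1] := ltP 0 t.
  have [i1 i2] := ker_den_rint t1; split; first exact: rintZ.
  by rewrite RintegralZl// i2 gtr0_sg// mulrC divfK// mul1r.
have t2 : 0 < - t by rewrite oppr_gt0 lt_neqAle t0.
have [] := ker_den_rint t2; rewrite sqrrN => i1 i2; split; first exact: rintZ.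
by rewrite RintegralZl// i2 ltr0_sg -?oppr_gt0//; field.
Qed.

(** Partial fractions leave a difference of two kernels, neither of which is integrable alone. The
    real parts are, with integrals [pi] or [- pi] according to the side of the pole, and the
    imaginary part of the difference is odd. Keeping the factor [t - s] on the left includes the
    case [s = t]. *)
Lemma cintegral_kerM s t : s != 0 -> t != 0 ->
  (t - s)%:C * cintegral (fun x => ker s x * ker t x) =
  ((Num.sg s - Num.sg t) * pi)%:C.
Proof.
move=> s0 t0; have i1 := L2_mul (L2_ker s0) (L2_ker t0).
rewrite -cintegralZ//; under eq_cintegral do rewrite ker_split//.
have i2 : cint (fun x => ker s x - ker t x).
  by under [X in cint X]eq_fun do rewrite -ker_split//; exact: cintZ.
apply: complex_eq.
  rewrite -[LHS]/(\int[mu]_x Re (ker s x - ker t x)) -[RHS]/((Num.sg s - Num.sg t) * pi).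
  under eq_Rintegral do rewrite cReD cReN.
  have [a1 a2] := Rintegral_Re_ker s0; have [b1 b2] := Rintegral_Re_ker t0.
  by rewrite RintegralB// a2 b2 mulrBl.
have [_ e] := cint_opp i2.
have e2 : cintegral (fun x => ker s (- x) - ker t (- x)) =
    (cintegral (fun x => ker s x - ker t x))^*.
  rewrite -cintegralJ//; apply: eq_cintegral => x.
  apply: complex_eq; rewrite !cReImE ?Re_ker ?Im_ker sqrrN//.
  by rewrite !mulNr opprB opprK addrC.
move: e; rewrite e2; move: (cintegral _) => [a b] /= [] bb.
by lra.
Qed.

Definition half_exp s : R -> R := (fun y => expR (- (s * y))) \_ `[0, +oo[.

Lemma continuous_expRN s : continuous (fun y => expR (- (s * y))).
Proof.
move=> y; apply: (@continuous_comp _ _ _ (fun y => - (s * y)) expR).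
  by apply: cvgN; exact: mulrl_continuous.
exact: continuous_expR.
Qed.

Lemma is_derive_expRN s y :
  is_derive y 1 (fun y => expR (- (s * y))) (- s * expR (- (s * y))).
Proof.
by apply: is_derive_eq; rewrite /GRing.scale/=; ring.
Qed.

Lemma cvg_expRN s : 0 < s -> expR (- (s * x)) @[x --> +oo] --> (0 : R).
Proof.
move=> s0; apply: (@cvg_comp _ _ _ ( *%R s) (fun x => expR (- x))); last exact: cvgr_expR.
apply/cvgryPge => A; near=> x; rewrite -ler_pdivrMl//; near: x.
Unshelve. all: by end_near. Qed.

Lemma rint_half_exp s : 0 < s -> rint (half_exp s).
Proof.
move=> s0; apply: (@rint_ge0_half R (fun y => - s^-1 * expR (- (s * y))) _ (- s^-1 * 0)).
- by move=> x; exact: expR_ge0.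
- exact: continuous_expRN.
- move=> x; have := is_derive_fctZ (- s^-1) (is_derive_expRN s x).
  by rewrite mulrA mulrNN mulVf ?mul1r// gt_eqF.
- by apply: cvgMr; exact: cvg_expRN.
Qed.

Lemma half_exp_ge0 s y : 0 <= half_exp s y.
Proof. by rewrite /half_exp patchE; case: ifP => // _; exact: expR_ge0. Qed.

(** The coefficients make the integrand the derivative of [- e^{-s y} (p cos (y x) + q sin (y x))],
    which is [- p] at 0 and tends to 0 at infinity. *)
Lemma laplace_trig s x p q : 0 < s ->
  \int[mu]_y (half_exp s y * ((s * p - x * q) * cos (y * x) + (s * q + x * p) * sin (y * x))) = p.
Proof.
move=> s0.
pose F y := - (expR (- (s * y)) * (p * cos (y * x) + q * sin (y * x))).
pose f y := expR (- (s * y)) * ((s * p - x * q) * cos (y * x) + (s * q + x * p) * sin (y * x)).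
have dx (y : R) : is_derive y 1 (fun y => y * x) x.
  have := is_derive_fctM (is_derive_id y 1) (is_derive_cst x y 1).
  by rewrite mulr0 mulr1 add0r.
have dc (y : R) : is_derive y 1 (fun y => cos (y * x)) (- sin (y * x) * x).
  by apply: is_derive_fct_comp.
have ds (y : R) : is_derive y 1 (fun y => sin (y * x)) (cos (y * x) * x).
  by apply: is_derive_fct_comp.
have dF (y : R) : is_derive y 1 F (f y).
  have := is_derive_fctN (is_derive_fctM (is_derive_expRN s y)
    (is_derive_fctD (is_derive_fctZ p (dc y)) (is_derive_fctZ q (ds y)))).
  by rewrite /f; congr (is_derive _ _ _ _); ring.
have cf : continuous f.
  move=> y; apply: cvgM; first exact: continuous_expRN.
  apply: cvgD; apply: cvgMr.
    exact: (is_derive_continuous dc).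
  exact: (is_derive_continuous ds).
pose M (a b : R) : R := `|a| + `|b|.
have bd a b y : `|a * cos (y * x) + b * sin (y * x)| <= M a b.
  rewrite (le_trans (ler_normD _ _))// lerD// normrM ler_piMr//.
    by rewrite ler_norml cos_geN1 cos_le1.
  by rewrite ler_norml sin_geN1 sin_le1.
have E y : half_exp s y * ((s * p - x * q) * cos (y * x) + (s * q + x * p) * sin (y * x))
    = (f \_ `[0, +oo[) y.
  rewrite /half_exp /f; have [y0|y0] := leP 0 y.
    by rewrite !patch_in//= in_itv/= andbT.
  by rewrite !patch_out ?mul0r//= in_itv/= andbT leNgt y0.
under eq_Rintegral do rewrite E.
have fi : rint (f \_ `[0, +oo[).
  apply: (@rint_le _ _ (fun y => M (s * p - x * q) (s * q + x * p) * half_exp s y)).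
  - by apply: measurable_patch => //; exact: continuous_measurable_fun.
  - by apply: rintZ; exact: rint_half_exp.
  - by move=> y; rewrite -E normrM ger0_norm ?half_exp_ge0// mulrC ler_wpM2r ?half_exp_ge0.
rewrite (FTC2_half (l := 0) dF)//.
  by rewrite /F !mul0r cos0 sin0 mulr0 oppr0 expR0; ring.
apply: (@cvg_dist_squeeze _ _ (fun n => M p q * expR (- (s * n%:R)))).
  move=> n; rewrite subr0 /F normrN normrM ger0_norm ?expR_ge0// mulrC.
  by rewrite ler_wpM2r ?expR_ge0.
rewrite -(mulr0 (M p q)); apply: cvgMr.
by apply: (@cvg_natr _ _ (fun x => expR (- (s * x)))); exact: cvg_expRN.
Qed.

(** The bridge between kernels and Fourier support: for [s > 0] the kernel is a superposition of
    characters of nonnegative frequency. *)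
Lemma laplace_cis s x : 0 < s ->
  cintegral (fun y => (half_exp s y)%:C * cis (y * x)) = ker s x.
Proof.
move=> s0; have d0 : s ^+ 2 + x ^+ 2 != 0 by rewrite gt_eqF ?ker_den_gt0 ?gt_eqF.
apply: complex_eq; rewrite kerE.
- rewrite -[LHS]/(\int[mu]_y Re ((half_exp s y)%:C * cis (y * x))).
  rewrite -[RHS]/(s / (s ^+ 2 + x ^+ 2)).
  (* [p] and [q] solve [s p - x q = 1] and [s q + x p = 0], so that only the cosine remains. For the
     imaginary part the two right-hand sides are exchanged. *)
  rewrite -[RHS](laplace_trig x _ (- (x / (s ^+ 2 + x ^+ 2))) s0).
  apply: eq_Rintegral => y _; rewrite cReM /=; field.
  by rewrite d0.
- rewrite -[LHS]/(\int[mu]_y Im ((half_exp s y)%:C * cis (y * x))).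
  rewrite -[RHS]/(x / (s ^+ 2 + x ^+ 2)).
  rewrite -[RHS](laplace_trig x _ (s / (s ^+ 2 + x ^+ 2)) s0).
  apply: eq_Rintegral => y _; rewrite cImM /=; field.
  by rewrite d0.
Qed.

End Kernel.

(** * The Hardy space described by Cauchy kernels *)

Section Hardy.
Context {R : realType}.
Local Notation C := R[i].
Local Notation Re := (@complex.Re R).
Local Notation Im := (@complex.Im R).
Local Notation mu := (@lebesgue_measure R).
Implicit Types (f g h : R -> C) (s t x y : R).

(* Equivalent to [L2p f], by [hardy_L2p] and [L2p_hardy]. *)
Definition hardy f :=
  L2 f /\ forall s, 0 < s -> cintegral (fun x => f x * ker s x) = 0.

Lemma ker_mulV t x : t != 0 -> ker t x * (t -i* x) = 1.
Proof. by move=> t0; rewrite /ker mulVf// ker_neq0. Qed.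

Lemma cint_L2_ker f s : L2 f -> s != 0 -> cint (fun x => f x * ker s x).
Proof. by move=> lf s0; apply: L2_mul => //; exact: L2_ker. Qed.

Lemma L2_mul_ker f s : L2 f -> s != 0 -> L2 (fun x => f x * ker s x).
Proof.
move=> lf s0; apply: (@L2_bounded _ _ _ (`|s|^-1)) => //; first exact: cmeas_ker.
by move=> x; exact: normc_ker_le.
Qed.

Lemma normc_ker_mono s t x : 0 < s -> s <= t -> normc (ker t x) <= normc (ker s x).
Proof.
move=> s0 st; have t0 : 0 < t by exact: lt_le_trans st.
rewrite -ler_sqr ?nnegrE ?normc_ge0// !normc_ker_sqr ?gt_eqF//.
rewrite lef_pV2 ?posrE ?ker_den_gt0 ?gt_eqF// lerD2r.
by rewrite ler_sqr// nnegrE ltW.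
Qed.

Lemma cvg_addVn s : (fun n => s + n.+1%:R^-1) @ \oo --> s.
Proof.
rewrite -[X in _ --> X]addr0; apply: cvgD; first exact: cvg_cst.
exact: cvg_harmonic.
Qed.

Lemma ccvg_ker (u : nat -> R) s x : s != 0 -> u @ \oo --> s ->
  ccvg (fun n => ker (u n) x) (ker s x).
Proof.
move=> s0 us.
have d : (fun n => (u n ^+ 2 + x ^+ 2)^-1) @ \oo --> (s ^+ 2 + x ^+ 2)^-1.
  apply: cvgV; first by rewrite gt_eqF// ker_den_gt0.
  apply: cvgD; last exact: cvg_cst.
  by rewrite expr2; under eq_fun do rewrite expr2; exact: cvgM.
split.
  by rewrite Re_ker; under eq_fun do rewrite Re_ker; exact: cvgM.
by rewrite Im_ker; under eq_fun do rewrite Im_ker; apply: cvgM => //; exact: cvg_cst.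
Qed.

(* Continuity in the pole allows one exceptional value, where the partial
   fraction decomposition of a product of kernels degenerates. *)
Lemma hardy_except f s0 : L2 f ->
  (forall s, 0 < s -> s != s0 -> cintegral (fun x => f x * ker s x) = 0) -> hardy f.
Proof.
move=> lf fs; split=> // s s_gt0.
have [ss0|/fs ->//] := eqVneq s s0.
have s_neq0 : s != 0 by rewrite gt_eqF.
pose u n := s + n.+1%:R^-1.
have u_gt n : s < u n by rewrite ltrDl invr_gt0 ltr0n.
have u0 n : 0 < u n by exact: lt_trans (u_gt n).
have lim : ccvg (fun n => cintegral (fun x => f x * ker (u n) x))
                (cintegral (fun x => f x * ker s x)).
  apply: (cDCT _ _ _ (cint_normc (cint_L2_ker lf s_neq0))).
  - by move=> n; apply: cint_cmeas; apply: cint_L2_ker; rewrite ?gt_eqF.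
  - by apply: cint_cmeas; exact: cint_L2_ker.
  - apply: aeW => x; apply: ccvgM; first exact: ccvg_cst.
    by apply: ccvg_ker => //; exact: cvg_addVn.
  - move=> n x; rewrite !normcM ler_wpM2l ?normc_ge0//.
    by apply: normc_ker_mono => //; exact: ltW.
apply: (ccvg_unique lim).
rewrite (_ : (fun _ => _) = (fun=> 0)); first exact: ccvg_cst.
by apply/funext => n; rewrite fs// -ss0 gt_eqF.
Qed.

Lemma cintegral_ker_split f s t : L2 f -> s != 0 -> t != 0 ->
  (t - s)%:C * cintegral (fun x => f x * ker s x * ker t x) =
  cintegral (fun x => f x * ker s x) - cintegral (fun x => f x * ker t x).
Proof.
move=> lf s0 t0; rewrite -cintegralZ; last first.
  by apply: L2_mul; [exact: L2_mul_ker|exact: L2_ker].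
rewrite -cintegralB; try exact: cint_L2_ker.
by apply: eq_cintegral => x; rewrite -mulrBr -ker_split//; ring.
Qed.

(** Partial fractions reduce the pairing with [ker t] to two integrals that vanish. Only [t = s]
    escapes, which is the exceptional value of [hardy_except]. *)
Lemma hardy_ker_mul f s : 0 < s -> hardy f -> hardy (fun x => f x * ker s x).
Proof.
move=> s_gt0 [lf fs]; have s_neq0 : s != 0 by rewrite gt_eqF.
apply: (@hardy_except _ s); first exact: L2_mul_ker.
move=> t t0 ts; have t_neq0 : t != 0 by rewrite gt_eqF.
have := cintegral_ker_split lf s_neq0 t_neq0.
rewrite !fs// subrr => /eqP; rewrite mulf_eq0 => /orP[|/eqP//].
by rewrite eq_complex /= eqxx andbT subr_eq0 (negbTE ts).
Qed.

Lemma hardy_ker_exp f s n : 0 < s -> hardy f ->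
  hardy (fun x => f x * ker s x ^+ n).
Proof.
move=> s0 hf; elim: n => [|n IHn].
  by under [X in hardy X]eq_fun do rewrite expr0 mulr1.
by under [X in hardy X]eq_fun do rewrite exprSr mulrA; exact: hardy_ker_mul.
Qed.

Lemma hardyZ (c : C) f : hardy f -> hardy (fun x => c * f x).
Proof.
move=> [lf fs]; split; first exact: L2Z.
move=> s s0; under eq_cintegral do rewrite -mulrA.
by rewrite cintegralZ ?fs ?mulr0//; apply: cint_L2_ker => //; rewrite gt_eqF.
Qed.

Lemma hardyD f g : hardy f -> hardy g -> hardy (fun x => f x + g x).
Proof.
move=> [lf fs] [lg gs]; split; first exact: L2D.
move=> s s0; under eq_cintegral do rewrite mulrDl.
by rewrite cintegralD ?fs ?gs ?addr0//; apply: cint_L2_ker => //; rewrite gt_eqF.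
Qed.

Lemma hardy_ker s : 0 < s -> hardy (ker s).
Proof.
move=> s0; have s_neq0 : s != 0 by rewrite gt_eqF.
apply: (@hardy_except _ s); first exact: L2_ker.
move=> t t0 ts; have t_neq0 : t != 0 by rewrite gt_eqF.
have := cintegral_kerM s_neq0 t_neq0.
rewrite !gtr0_sg// subrr mul0r => /eqP; rewrite mulf_eq0 => /orP[|/eqP//].
by rewrite eq_complex /= eqxx andbT subr_eq0 (negbTE ts).
Qed.

(* For f holomorphic in the upper half plane this is f (i y). *)
Definition cauchy_value f y : C :=
  - ((2 * pi)^-1)%:C * cintegral (fun x => f x * ker (- y) x).

(* [(f(x) - f(iy)) / (x - iy)], up to a constant factor. *)
Lemma hardy_resolvent f y : 0 < y -> hardy f ->
  hardy (fun x => (f x - cauchy_value f y) * ker (- y) x).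
Proof.
move=> y0 [lf fs]; have Ny_neq0 : - y != 0 by rewrite oppr_eq0 gt_eqF.
have i1 : L2 (fun x => f x * ker (- y) x) by exact: L2_mul_ker.
have i2 : L2 (fun x => cauchy_value f y * ker (- y) x) by apply: L2Z; exact: L2_ker.
have E x : (f x - cauchy_value f y) * ker (- y) x =
    f x * ker (- y) x - cauchy_value f y * ker (- y) x by rewrite mulrBl.
split; first by under [X in L2 X]eq_fun do rewrite E; exact: L2B.
move=> s s0; have s_neq0 : s != 0 by rewrite gt_eqF.
under eq_cintegral do rewrite E mulrBl -[in X in _ - X]mulrA.
rewrite cintegralB; last 2 first.
- exact: cint_L2_ker.
- by apply: cintZ; apply: L2_mul; exact: L2_ker.
rewrite cintegralZ; last by apply: L2_mul; exact: L2_ker.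
have := cintegral_ker_split lf Ny_neq0 s_neq0.
(* The poles lie on opposite sides of the real line, so the right-hand side is [-2 pi]; this fixes
   the constant in [cauchy_value]. *)
have := cintegral_kerM Ny_neq0 s_neq0.
rewrite (fs s s0) subr0 opprK ltr0_sg ?oppr_lt0// gtr0_sg//.
set J := cintegral _; set I := cintegral _ => e1 e2.
have sy : (s + y)%:C != 0 :> C.
  by rewrite eq_complex /= eqxx andbT gt_eqF// addr_gt0.
apply: (mulfI sy); rewrite mulrBr e2 mulr0 mulrCA e1 /cauchy_value.
have p0 : (pi : R) != 0 by rewrite gt_eqF// pi_gt0.
have e : ((2 * pi)^-1)%:C * ((-1 - 1) * pi)%:C = -1 :> C.
  apply: complex_eq; rewrite !cReImE /=; last by ring.
  by move: p0 {e1}; move: (pi : R) => p p0; field.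
by rewrite mulNr mulNr opprK mulrAC e mulN1r subrr.
Qed.

Lemma MVT_sqr (F f : R -> R) (x : R) : (forall z : R, is_derive z 1 F (f z)) ->
  F 0 = 0 -> (forall z, `|f z| <= `|z|) -> `|F x| <= x ^+ 2.
Proof.
move=> dF F0 fz; have cF := is_derive_continuous dF.
have [x0|x0|->] := ltgtP x 0; last by rewrite F0 normr0 sqr_ge0.
  have [z] := @MVT _ F f x 0 x0 (fun z _ => dF z) (continuous_subspaceT cF).
  rewrite in_itv/= => /andP[xz z0]; rewrite F0 !sub0r => /(congr1 (fun y => `|y|)).
  rewrite normrN normrM normrN => ->; rewrite -real_normK ?num_real// expr2.
  rewrite ler_wpM2r//; apply: le_trans (fz z) _.
  by rewrite !ltr0_norm// lerN2 ltW.
have [z] := @MVT _ F f 0 x x0 (fun z _ => dF z) (continuous_subspaceT cF).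
rewrite in_itv/= => /andP[z0 zx]; rewrite F0 !subr0 => ->.
rewrite normrM -[leRHS]real_normK ?num_real// expr2 ler_wpM2r//.
by apply: le_trans (fz z) _; rewrite !gtr0_norm// ltW.
Qed.

(** The derivative of [e^{is} (1 - i s)] is [s e^{is}], so that the derivatives of both parts are at
    most [|s|] in absolute value; [MVT_sqr] then bounds each part by [s^2]. *)
Lemma normc_cis_expansion s : normc (1 - cis s * (1 -i* s)) <= 2 * s ^+ 2.
Proof.
apply: (le_trans (normc_le_ReIm _)); rewrite mulr_natl mulr2n.
have b1 z : `|cos z : R| <= 1 by rewrite ler_norml cos_geN1 cos_le1.
have b2 z : `|sin z : R| <= 1 by rewrite ler_norml sin_geN1 sin_le1.
apply: lerD.
  rewrite (_ : Re _ = - (cos s + s * sin s - 1)); last by rewrite !cReImE /=; ring.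
  rewrite normrN; apply: (@MVT_sqr (fun s => cos s + s * sin s - 1) (fun s => s * cos s)).
  - move=> z; apply: is_derive_eq; rewrite /GRing.scale/=; ring.
  - by rewrite cos0 mul0r addr0 subrr.
  - by move=> z; rewrite normrM ler_piMr.
rewrite (_ : Im _ = - (sin s - s * cos s)); last by rewrite !cReImE /=; ring.
rewrite normrN; apply: (@MVT_sqr (fun s => sin s - s * cos s) (fun s => s * sin s)).
- move=> z; apply: is_derive_eq; rewrite /GRing.scale/=; ring.
- by rewrite sin0 mul0r subrr.
- by move=> z; rewrite normrM ler_piMr.
Qed.

Lemma normc_exp_sub (a b : C) n : normc a <= 1 -> normc b <= 1 ->
  normc (a ^+ n - b ^+ n) <= n%:R * normc (a - b).
Proof.
move=> a1 b1; elim: n => [|n IHn]; first by rewrite !expr0 subrr normc0 mul0r.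
have -> : a ^+ n.+1 - b ^+ n.+1 = a * (a ^+ n - b ^+ n) + (a - b) * b ^+ n.
  by rewrite !exprS; ring.
rewrite (le_trans (ler_normcD _ _))// !normcM -natr1 mulrDl mul1r lerD//.
  by rewrite (le_trans _ IHn)// ler_piMl// normc_ge0.
by rewrite ler_piMr ?normc_ge0// normcX exprn_ile1// normc_ge0.
Qed.

(** Euler's limit. With [s = tau / (n+1)], one factor differs from [e^{is}] by at most [2 s^2], and
    the [n + 1] factors together by at most [2 tau^2 / (n+1)]. *)
Lemma ccvg_cis (tau : R) :
  ccvg (fun n => (1 -i* (tau / n.+1%:R))^-1 ^+ n.+1) (cis tau).
Proof.
apply/ccvg_normcP.
apply: (@cvg_dist_squeeze _ _ (fun n => 2 * tau ^+ 2 * n.+1%:R^-1)); last first.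
  by rewrite -(mulr0 (2 * tau ^+ 2)); apply: cvgMr; exact: cvg_harmonic.
move=> n; rewrite subr0 ger0_norm ?normc_ge0//.
have n0 : n.+1%:R != 0 :> R by rewrite pnatr_eq0.
set s := tau / n.+1%:R.
have -> : cis tau = cis s ^+ n.+1 by rewrite cisX /s mulrCA divff// mulr1.
have k1 : normc (ker 1 s) <= 1.
  by rewrite (le_trans (normc_ker_le _ _))// ?oner_eq0// normr1 invr1.
rewrite (le_trans (normc_exp_sub _ _ _))// ?normc_cis//.
have -> : (1 -i* s)^-1 - cis s = ker 1 s * (1 - cis s * (1 -i* s)).
  rewrite mulrBr mulr1 /ker; congr (_ - _); rewrite mulrCA mulVf ?mulr1//.
  exact: (@ker_neq0 R 1 s (oner_neq0 R)).
rewrite normcM.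
have := normc_cis_expansion s; have := normc_ge0 (1 - cis s * (1 -i* s)).
move: (normc _) k1 (normc_ge0 (ker 1 s)); move: (normc _) => q p p1 p0 q0 qs.
have pq : p * q <= 2 * s ^+ 2 by rewrite (le_trans _ qs)// ler_piMl.
rewrite (le_trans (ler_wpM2l _ pq)) ?ler0n// /s.
rewrite le_eqVlt; apply/orP; left; apply/eqP.
by move: n0; move: (n.+1%:R) => N N0; field.
Qed.

(** The character is the limit of powers of [1 / (1 - i y x / (n+1))], a multiple of a kernel of
    modulus at most 1. Multiplication by these powers preserves the Hardy space, and [|f ker t|]
    dominates the integrands. *)
Lemma hardy_cis f t y : 0 < t -> 0 <= y -> hardy f ->
  cintegral (fun x => f x * ker t x * cis (y * x)) = 0.
Proof.
move=> t0 y0 hf; have t_neq0 : t != 0 by rewrite gt_eqF.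
have [lf _] := hf; have ifk := cint_L2_ker lf t_neq0.
move: y0; rewrite le_eqVlt => /predU1P[<-|y0].
  rewrite -[RHS](hf.2 t t0); apply: eq_cintegral => x.
  by rewrite mul0r cis0 mulr1.
pose u n x : C := (1 -i* (y * x / n.+1%:R))^-1.
have uE n x : u n x = (n.+1%:R / y)%:C * ker (n.+1%:R / y) x.
  have n0 : n.+1%:R != 0 :> R by rewrite pnatr_eq0.
  have c0 : n.+1%:R / y != 0 by rewrite mulf_neq0// invr_neq0// gt_eqF.
  have -> : u n x = ker 1 (y * x / n.+1%:R) by [].
  have y0' : y != 0 by rewrite gt_eqF.
  apply: (mulIf (ker_neq0 x c0)); rewrite -[RHS]mulrA ker_mulV// mulr1.
  have -> : (n.+1%:R / y -i* x : C) = (n.+1%:R / y)%:C * (1 -i* (y * x / n.+1%:R)).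
    apply: complex_eq; rewrite !cReImE /=; first by ring.
    by move: n0; move: (n.+1%:R) => N N0; field; rewrite N0.
  by rewrite mulrCA ker_mulV ?mulr1// oner_neq0.
have u1 n x : normc (u n x) <= 1.
  rewrite (le_trans (normc_ker_le (t := 1) _ _))// ?oner_eq0// normr1 invr1//.
have mu_ n : cmeas (u n).
  rewrite (_ : u n = fun x => (n.+1%:R / y)%:C * ker (n.+1%:R / y) x).
    by apply: cmeasZ; apply: cmeas_ker; rewrite mulf_neq0 ?pnatr_eq0// invr_neq0 ?gt_eqF.
  by apply/funext => x; exact: uE.
have lim : ccvg (fun n => cintegral (fun x => f x * ker t x * u n x ^+ n.+1))
                (cintegral (fun x => f x * ker t x * cis (y * x))).
  apply: (cDCT _ _ _ (cint_normc ifk)).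
  - by move=> n; apply: cmeasM; [exact: cint_cmeas|exact: cmeasX].
  - apply: cmeasM; first exact: cint_cmeas.
    apply: (cmeas_comp (g := fun x => y * x) (@cmeas_cis R)); exact: mulrl_measurable.
  - apply: aeW => x; apply: ccvgM; first exact: ccvg_cst.
    exact: ccvg_cis.
  - move=> n x; rewrite normcM ler_piMr ?normc_ge0// normcX exprn_ile1 ?normc_ge0//.
apply: (ccvg_unique lim).
rewrite (_ : (fun _ => _) = (fun=> 0)); first exact: ccvg_cst.
apply/funext => n.
have c0 : 0 < n.+1%:R / y by rewrite divr_gt0// ltr0n.
have [_ /(_ t t0) h0] := hardyZ ((n.+1%:R / y)%:C ^+ n.+1) (hardy_ker_exp n.+1 c0 hf).
rewrite -[RHS]h0; apply: eq_cintegral => x.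
by rewrite uE exprMn; ring.
Qed.

End Hardy.

(** * Smooth functions and smooth bumps *)

Section Smooth.
Context {R : realType}.
Implicit Types (f g F : R -> R) (S : (R -> R) -> Prop).

Inductive alg S : (R -> R) -> Prop :=
| alg_gen f : S f -> alg S f
| alg_cst (c : R) : alg S (fun=> c)
| alg_add f g : alg S f -> alg S g -> alg S (fun x => f x + g x)
| alg_mul f g : alg S f -> alg S g -> alg S (fun x => f x * g x).

Definition deriv_closed S := forall f, S f ->
  exists2 g, alg S g & forall x : R, is_derive x 1 f (g x).

(* Membership in an algebra generated by a family whose derivatives stay in it,
   which makes smoothness provable without computing iterated derivatives. *)
Definition smooth f := exists2 S, deriv_closed S & alg S f.

Lemma deriv_closed_alg S f : deriv_closed S -> alg S f ->
  exists2 g, alg S g & forall x : R, is_derive x 1 f (g x).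
Proof.
move=> dS; elim=> {f} [f /dS//|c|f g af [f' af' df] ag [g' ag' dg]|
    f g af [f' af' df] ag [g' ag' dg]].
- by exists (fun=> 0); [exact: alg_cst|move=> x; exact: is_derive_cst].
- by exists (fun x => f' x + g' x); [exact: alg_add|move=> x; exact: is_derive_fctD].
- exists (fun x => f x * g' x + g x * f' x); last by move=> x; exact: is_derive_fctM.
  by apply: alg_add; exact: alg_mul.
Qed.

Lemma smooth_is_derive f : smooth f ->
  (forall x : R, is_derive x 1 f (f^`()%classic x)) /\ smooth f^`()%classic.
Proof.
move=> [S dS aS]; have [g ag dg] := deriv_closed_alg dS aS.
have -> : f^`()%classic = g.
  by apply/funext => x; rewrite derive1E; exact: derive_val.
by split => //; exists S.
Qed.

Lemma smooth_derivable f n (x : R) : smooth f -> derivable (f^`(n))%classic x 1.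
Proof.
move=> sf; have : smooth (f^`(n))%classic.
  elim: n => [//|n IHn]; rewrite derive1nS.
  by case: (smooth_is_derive IHn).
by move=> /smooth_is_derive[/(_ x) ? _]; exact: ex_derive.
Qed.

Lemma alg_mono S S' f : (forall g, S g -> S' g) -> alg S f -> alg S' f.
Proof.
move=> SS'; elim => {f} [f /SS' /alg_gen//|c|f g _ ? _ ?|f g _ ? _ ?].
- exact: alg_cst.
- exact: alg_add.
- exact: alg_mul.
Qed.

Lemma deriv_closedU S S' : deriv_closed S -> deriv_closed S' ->
  deriv_closed (fun f => S f \/ S' f).
Proof.
move=> dS dS' f [/dS|/dS'] [g ag dg]; exists g => //.
- by apply: alg_mono ag => ? ?; left.
- by apply: alg_mono ag => ? ?; right.
Qed.

Lemma smoothM f g : smooth f -> smooth g -> smooth (fun x => f x * g x).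
Proof.
move=> [S dS aS] [S' dS' aS']; exists (fun f => S f \/ S' f).
  exact: deriv_closedU.
apply: alg_mul.
- by apply: alg_mono aS => ? ?; left.
- by apply: alg_mono aS' => ? ?; right.
Qed.

Lemma smoothD f g : smooth f -> smooth g -> smooth (fun x => f x + g x).
Proof.
move=> [S dS aS] [S' dS' aS']; exists (fun f => S f \/ S' f).
  exact: deriv_closedU.
apply: alg_add.
- by apply: alg_mono aS => ? ?; left.
- by apply: alg_mono aS' => ? ?; right.
Qed.

Lemma smooth_cst (c : R) : smooth (fun=> c).
Proof. by exists (fun=> False) => //; exact: alg_cst. Qed.

Lemma smooth_affine f (a b : R) : smooth f -> smooth (fun x => f (a * x + b)).
Proof.
move=> [S dS aS].
pose S' g := exists2 h, alg S h & g = fun x => h (a * x + b).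
exists S'; last by apply: alg_gen; exists f.
move=> _ [h ah ->]; have [h' ah' dh'] := deriv_closed_alg dS ah.
exists (fun x => a * h' (a * x + b)).
  by apply: alg_mul; [exact: alg_cst|apply: alg_gen; exists h'].
move=> x; rewrite mulrC.
have da : is_derive x 1 (fun x => a * x + b) a.
  have := is_derive_fctD (is_derive_fctZ a (is_derive_id x 1)) (is_derive_cst b x 1).
  by rewrite mulr1 addr0.
exact: (is_derive_fct_comp (dh' _) da).
Qed.

(** Adjoining [F] to the generators keeps the family closed under differentiation. *)
Lemma smooth_primitive f F : smooth f -> (forall x : R, is_derive x 1 F (f x)) ->
  smooth F.
Proof.
move=> [S dS aS] dF; exists (fun g => S g \/ g = F); last by apply: alg_gen; right.
have mono g : alg S g -> alg (fun g => S g \/ g = F) g by apply: alg_mono; left.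
move=> g [/dS[g' ag' dg']|->]; first by exists g' => //; exact: mono.
by exists f => //; exact: mono.
Qed.

Lemma smooth_continuous f : smooth f -> continuous f.
Proof. by move=> /smooth_is_derive[d _]; exact: is_derive_continuous d. Qed.

(** All exponents are treated together because the derivative of [x^{-k} e^{-1/x}] is a combination
    of members with larger [k]. *)
Definition flat k (x : R) : R := if 0 < x then x^-1 ^+ k * expR (- x^-1) else 0.

Lemma flat_ge0 k x : 0 <= flat k x.
Proof.
rewrite /flat; case: ifP => // x0; rewrite mulr_ge0 ?expR_ge0// exprn_ge0//.
by rewrite invr_ge0 ltW.
Qed.

Lemma flat_le1 x : flat 0 x <= 1.
Proof.
rewrite /flat; case: ifP => // x0; rewrite expr0 mul1r -expR0 ler_expR.
by rewrite oppr_le0 invr_ge0 ltW.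
Qed.

(** One term of the exponential series at [1/x], of order [k + 2], beats [x^{-k}] by a factor [x^2].
    A quadratic bound is what gives derivative 0 at the origin. *)
Lemma flat_le k x : flat k x <= (k.+2)`!%:R * x ^+ 2.
Proof.
rewrite /flat; case: ifPn => [x0|_]; last by rewrite mulr_ge0 ?ler0n ?sqr_ge0.
have := @expR_ge1Dxn R x^-1 k.+1; rewrite invr_ge0 ltW// => /(_ isT) h.
have xi0 : 0 < x^-1 by rewrite invr_gt0.
have {}h : x^-1 ^+ k.+2 / (k.+2)`!%:R <= expR x^-1 by rewrite (le_trans _ h)// lerDr.
rewrite expRN ler_pdivrMr ?expR_gt0//.
have f0 : 0 < (k.+2)`!%:R :> R by rewrite ltr0n fact_gt0.
rewrite ler_pdivrMr// in h.
have -> : x^-1 ^+ k = x ^+ 2 * x^-1 ^+ k.+2.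
  by rewrite !exprS; field; rewrite gt_eqF.
have -> : (k.+2)`!%:R * x ^+ 2 * expR x^-1 = x ^+ 2 * (expR x^-1 * (k.+2)`!%:R) by ring.
by rewrite ler_wpM2l ?sqr_ge0.
Qed.

Lemma is_derive_sqr_small f (C : R) : (forall x, `|f x| <= C * x ^+ 2) ->
  is_derive (0 : R) 1 f 0.
Proof.
move=> fC; have f0 : f 0 = 0.
  by apply/eqP; rewrite -normr_le0 (le_trans (fC 0))// expr0n mulr0.
have C0 : 0 <= C by have := fC 1; rewrite expr1n mulr1; exact: le_trans.
have lim : h^-1 *: ((f \o shift 0) (h *: 1) - f 0) @[h --> (0:R)^'] --> (0:R).
  apply/cvgrPdist_le => e e0; near=> h.
  rewrite sub0r normrN /= addr0 f0 subr0 /GRing.scale/= mulr1 normrM normfV.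
  have h0 : h != 0 by near: h; exact: nbhs_dnbhs_neq.
  rewrite ler_pdivrMl ?normr_gt0// (le_trans (fC h))//.
  rewrite -real_normK ?num_real// expr2 mulrA mulrC ler_wpM2l//.
  have : `|h| <= e / (C + 1).
    near: h; apply: dnbhs0_le.
    by rewrite divr_gt0// ltr_wpDl.
  rewrite ler_pdivlMr; last by rewrite ltr_wpDl.
  by apply: le_trans; rewrite mulrC ler_wpM2l// lerDl.
by apply: DeriveDef; [apply/cvg_ex; exists 0|exact: cvg_lim].
Unshelve. all: by end_near. Qed.

Lemma is_derive_fctV (x : R) : x != 0 -> is_derive x 1 (fun y => y^-1) (- x^-1 ^+ 2).
Proof.
move=> x0; have dx := is_derive_id x (1:R).
apply: DeriveDef; first by apply: (@derivableV _ _ id).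
rewrite (@deriveV _ _ id)// derive_id /GRing.scale/= mulr1.
by rewrite -exprVn.
Qed.

Lemma flat_is_derive k (x : R) :
  is_derive x 1 (flat k) (flat k.+2 x - k%:R * flat k.+1 x).
Proof.
have [x0|x0|x0] := ltgtP 0 x; last first.
- rewrite -x0 [X in is_derive _ _ _ X](_ : _ = 0); last by rewrite /flat ltxx mulr0 subr0.
  apply: (@is_derive_sqr_small _ (k.+2)`!%:R) => z.
  by rewrite ger0_norm ?flat_ge0// flat_le.
- rewrite /flat ltNge (ltW x0)/= mulr0 subr0.
  apply: (near_eq_is_derive _ (is_derive_cst (0 : R) x 1)).
  by near=> y; rewrite ltNge ltW//; near: y; exact: lt_nbhsl.
- have dV := is_derive_fctV (lt0r_neq0 x0).
  have dX : is_derive x 1 (fun y => y^-1 ^+ k) (- (k%:R * x^-1 ^+ k.+1)).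
    have := @is_deriveX R R (fun y => y^-1) k x 1 _ dV.
    rewrite /GRing.scale/=; congr (is_derive _ _ _ _).
      by apply/funext => y; rewrite exprfctE.
    by case: (k) => [|m]; rewrite ?mul0r ?oppr0//= !exprS; ring.
  have dE := is_derive_fct_comp (is_derive_expR _) (is_derive_fctN dV).
  have dM := is_derive_fctM dX dE.
  have -> : flat k.+2 x - k%:R * flat k.+1 x =
    x^-1 ^+ k * (expR (- x^-1) * - - x^-1 ^+ 2) + expR (- x^-1) * - (k%:R * x^-1 ^+ k.+1).
    by rewrite /flat x0 opprK !exprS; ring.
  apply: (near_eq_is_derive _ dM).
  by near=> y; rewrite /flat ifT//; near: y; exact: lt_nbhsr.
Unshelve. all: by end_near. Qed.

Lemma smooth_flat k : smooth (flat k).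
Proof.
pose S f := exists k, f = flat k.
exists S; last by apply: alg_gen; exists k.
move=> _ [j ->]; exists (fun x => flat j.+2 x + (- j%:R) * flat j.+1 x).
  apply: alg_add; first by apply: alg_gen; exists j.+2.
  by apply: alg_mul; [exact: alg_cst|apply: alg_gen; exists j.+1].
by move=> x; rewrite mulNr; exact: flat_is_derive.
Qed.

(** The scaling by [n + 1] makes the bumps tend to the indicator of []a, b[] while staying below it,
    so that integrals over intervals are limits of integrals against test functions. *)
Definition bump (a b : R) n (x : R) : R :=
  flat 0 (n.+1%:R * x + - (n.+1%:R * a)) * flat 0 (- n.+1%:R * x + n.+1%:R * b).

Lemma smooth_bump a b n : smooth (bump a b n).
Proof. by apply: smoothM; apply: smooth_affine; exact: smooth_flat. Qed.

Lemma bump_ge0 a b n x : 0 <= bump a b n x.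
Proof. by rewrite mulr_ge0// flat_ge0. Qed.

Lemma bump_le1 a b n x : bump a b n x <= 1.
Proof. by rewrite mulr_ile1 ?flat_ge0 ?flat_le1. Qed.

Lemma bump_supp a b n x : bump a b n x != 0 -> a < x < b.
Proof.
rewrite mulf_eq0 negb_or /flat; case: ifPn => [h1|]; last by rewrite eqxx.
case: ifPn => [h2 _|]; last by rewrite eqxx andbF.
have n0 : 0 < n.+1%:R :> R by rewrite ltr0n.
rewrite -mulrBr pmulr_rgt0// subr_gt0 in h1.
by rewrite mulNr addrC -mulrBr pmulr_rgt0// subr_gt0 in h2; rewrite h1.
Qed.

Lemma cvg_flat0 (y : R) : 0 < y -> (fun n => flat 0 (n.+1%:R * y)) @ \oo --> (1 : R).
Proof.
move=> y0.
have E n : flat 0 (n.+1%:R * y) = expR (- (y^-1 * n.+1%:R^-1)).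
  by rewrite /flat mulr_gt0 ?ltr0n// expr0 mul1r invfM mulrC.
have lim : (fun n => expR (- (y^-1 * n.+1%:R^-1))) @ \oo --> expR (- (y^-1 * 0)).
  apply: (@cvg_comp _ _ _ _ expR); last exact: continuous_expR.
  by apply: cvgN; apply: cvgMr; exact: cvg_harmonic.
by under eq_cvg do rewrite E; move: lim; rewrite mulr0 oppr0 expR0.
Qed.

Lemma cvg_bump a b x : (fun n => bump a b n x) @ \oo --> (\1_`]a, b[ x : R).
Proof.
have [/andP[ax xb]|nab] := boolP (a < x < b).
  rewrite indicE mem_set/= ?in_itv/= ?ax//= -[X in _ --> X]mulr1 /bump.
  under eq_cvg do rewrite mulNr (addrC (- _)) -!mulrBr.
  by apply: cvgM; apply: cvg_flat0; rewrite subr_gt0.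
rewrite indicE memNset/= ?in_itv/=; last exact/negP.
rewrite (_ : (fun _ => _) = fun=> 0); first exact: cvg_cst.
by apply/funext => n; apply/eqP; apply: contraNT nab => /bump_supp.
Qed.

End Smooth.

(** * Test functions and their Fourier transforms *)

Section TestFunctions.
Context {R : realType}.
Local Notation C := R[i].
Local Notation Re := (@complex.Re R).
Local Notation Im := (@complex.Im R).
Local Notation mu := (@lebesgue_measure R).
Implicit Types (A : set R) (phi : R -> R).

Lemma smooth_test_function A phi (a b : R) : smooth phi ->
  (forall x, phi x != 0 -> a <= x <= b) -> `[a, b] `<=` A -> test_function A phi.
Proof.
move=> sphi supp abA.
have cl : closure [set x | phi x != 0] `<=` `[a, b].
  rewrite closureE; apply: smallest_sub; first exact: itv_closed.
  by move=> x /= /supp; rewrite in_itv.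
split.
- by move=> n x; exact: smooth_derivable.
- by apply: (subclosed_compact _ (@segment_compact _ a b)) => //; exact: closed_closure.
- exact: subset_trans cl abA.
Qed.

Lemma bump_test_function A (a b : R) n : `[a, b] `<=` A ->
  test_function A (bump a b n).
Proof.
move=> abA; apply: (@smooth_test_function _ _ a b) => //; first exact: smooth_bump.
by move=> x /bump_supp/andP[ax xb]; rewrite !ltW.
Qed.

Lemma test_function_facts A phi : test_function A phi ->
  exists M : R, [/\ 0 < M, forall x, M <= `|x| -> phi x = 0,
    forall x, M <= `|x| -> phi^`()%classic x = 0,
    forall x : R, is_derive x 1 phi (phi^`()%classic x) &
    continuous phi^`()%classic].
Proof.
move=> [dphi cphi _].
have [M0 [_ M0phi]] := compact_bounded cphi.
pose M1 := Num.max (M0 + 1) 1.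
have supp x : M1 < `|x| -> phi x = 0.
  move=> xM; apply/eqP; apply: contraTT xM => phix; rewrite -leNgt.
  apply: M0phi; first by rewrite lt_max ltrDl ltr01.
  exact: subset_closure.
(* The margin 1 makes [phi] vanish in a neighbourhood of each [x] with [|x| >= M1 + 1], hence its
   derivative vanishes there too. *)
exists (M1 + 1); split.
- by rewrite addr_gt0// lt_max ltr01 orbT.
- by move=> x Mx; apply: supp; rewrite (lt_le_trans _ Mx)// ltrDl.
- move=> x Mx; rewrite derive1E.
  rewrite (_ : 'D_1 phi x = 'D_1 (fun=> 0 : R) x); first exact: derive_val.
  have M1x : M1 < `|x| by rewrite (lt_le_trans _ Mx)// ltrDl.
  apply: near_eq_derive; near=> y; apply: supp.
  near: y; apply: (@cvgr_gt _ _ _ _ (fun y : R => `|y|) `|x|) => //.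
  exact: norm_continuous.
- by move=> x; have := dphi 0%N x; rewrite derive1n0 derive1E => /derivableP.
- move=> x; apply/differentiable_continuous/derivable1_diffP.
  by have := dphi 1%N x; rewrite derive1n1.
Unshelve. all: by end_near. Qed.

Lemma rint_continuous_compact (f : R -> R) (M : R) : continuous f ->
  (forall x, M <= `|x| -> f x = 0) -> rint f.
Proof.
move=> cf f0; have fE : f = f \_ `[- M, M].
  apply/funext => x; have [xM|xM] := boolP (- M <= x <= M).
    by rewrite patch_in//= in_itv.
  rewrite patch_out/= ?in_itv/=; last exact/negP.
  apply: f0; rewrite leNgt; apply: contra xM => xM.
  by rewrite -ler_norml ltW.
have i : mu.-integrable `[- M, M] (EFin \o f).
  apply: continuous_compact_integrable; first exact: segment_compact.
  exact: continuous_subspaceT.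
by move: i; rewrite integrable_mkcond// restrict_EFin -fE.
Qed.

Lemma test_function_rint A phi : test_function A phi ->
  rint phi /\ rint phi^`()%classic.
Proof.
move=> /test_function_facts[M [M0 s s' d c]]; split.
- by apply: rint_continuous_compact s; exact: is_derive_continuous d.
- exact: rint_continuous_compact s'.
Qed.

Lemma bounded_continuous_compact (f : R -> R) (M : R) : continuous f ->
  (forall x, M <= `|x| -> f x = 0) -> exists2 B, 0 <= B & forall x, `|f x| <= B.
Proof.
move=> cf f0.
have cc : compact (f @` `[- M, M]).
  apply: continuous_compact; last exact: segment_compact.
  exact: continuous_subspaceT.
have [B [_ HB]] := compact_bounded cc.
exists (Num.max (B + 1) 1); first by rewrite le_max ler01 orbT.
move=> x; have [xM|xM] := boolP (- M <= x <= M).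
  apply: HB; first by rewrite lt_max ltrDl ltr01.
  by exists x => //=; rewrite in_itv.
rewrite f0 ?normr0 ?le_max ?ler01 ?orbT//.
rewrite leNgt; apply: contra xM => xM.
by rewrite -ler_norml ltW.
Qed.

Lemma fourierE phi (x : R) :
  fourier phi x = cintegral (fun y => (phi y)%:C * cis (- (y * x))).
Proof. by apply: eq_cintegral => y; rewrite /cis cosN sinN. Qed.

Lemma cmeas_cis_mul (x : R) : cmeas (fun y : R => cis (- (y * x))).
Proof.
apply: (@cmeas_comp _ _ _ _ R cis (fun y : R => - (y * x)) (@cmeas_cis R)).
by apply: measurable_funN; exact: mulrr_measurable.
Qed.

Lemma cint_fourier phi (x : R) : rint phi ->
  cint (fun y => (phi y)%:C * cis (- (y * x))).
Proof.
move=> iphi; apply: (@cint_bounded _ _ _ 1).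
- exact: cint_real.
- exact: cmeas_cis_mul.
- by move=> y; rewrite normc_cis.
Qed.

Lemma ccvg_fourier phi (u : nat -> R) (x : R) : rint phi -> u @ \oo --> x ->
  ccvg (fun n => fourier phi (u n)) (fourier phi x).
Proof.
move=> iphi ux; rewrite fourierE; under [X in ccvg X]eq_fun do rewrite fourierE.
apply: (cDCT _ _ _ (rint_norm iphi)).
- by move=> n; apply: cint_cmeas; exact: cint_fourier.
- by apply: cint_cmeas; exact: cint_fourier.
- apply: aeW => y; apply: ccvgM; first exact: ccvg_cst.
  have uN : (fun n => - (y * u n)) @ \oo --> - (y * x) by apply: cvgN; exact: cvgMr.
  split; apply: (cvg_comp _ _ uN); [exact: continuous_cos|exact: continuous_sin].
- by move=> n y; rewrite normcM normc_cis mulr1 normc_real.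
Qed.

(** Lets dominated convergence, a statement on sequences, prove the continuity of integrals that
    depend on a parameter. *)
Lemma sequential_continuous (f : R -> R) (p : R) :
  (forall u : nat -> R, u @ \oo --> p -> (fun n => f (u n)) @ \oo --> f p) ->
  {for p, continuous f}.
Proof.
move=> fu; apply/cvgrPdist_le => e e0; apply: contrapT => nf.
have ex (n : nat) : exists y, `|p - y| <= n.+1%:R^-1 /\ e < `|f p - f y|.
  apply: contrapT => nex; apply: nf.
  have n0 : 0 < n.+1%:R^-1 :> R by rewrite invr_gt0.
  apply/nbhs_ballP; exists (n.+1%:R^-1) => //= y py.
  rewrite leNgt; apply/negP => ey; apply: nex; exists y; split => //.
  by move: py; rewrite /ball/= => /ltW.
have [u uP] := choice ex.
have up : u @ \oo --> p.
  apply: (@cvg_dist_squeeze _ _ (fun n => n.+1%:R^-1)); last exact: cvg_harmonic.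
  by move=> n; rewrite distrC; case: (uP n).
have /cvgrPdist_lt/(_ _ e0)[N _ /(_ N (leqnn _))] := fu u up.
by rewrite ltNge ltW//; case: (uP N).
Qed.

Lemma cmeas_fourier phi : rint phi -> cmeas (fourier phi).
Proof.
move=> iphi; split; apply: continuous_measurable_fun => x;
  apply: sequential_continuous => u ux.
- by case: (ccvg_fourier iphi ux).
- by case: (ccvg_fourier iphi ux).
Qed.

Lemma normc_fourier_le phi (x : R) : rint phi ->
  normc (fourier phi x) <= 2 * \int[mu]_y `|phi y|.
Proof.
move=> iphi; rewrite fourierE (le_trans (normc_cintegral_le (cint_fourier x iphi)))//.
rewrite ler_wpM2l// le_eqVlt; apply/orP; left; apply/eqP.
by apply: eq_Rintegral => y _; rewrite normcM normc_cis mulr1 normc_real.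
Qed.

(** Integration by parts against the cosine and the sine, without boundary terms since [phi] has
    compact support. Its use is to give [fourier phi] decay. *)
Lemma fourier_deriv A phi (x : R) : test_function A phi ->
  fourier phi^`()%classic x = 'i * x%:C * fourier phi x.
Proof.
move=> tphi; have [iphi iphi'] := test_function_rint tphi.
have [M [M0 s s' d c]] := test_function_facts tphi.
have lim0 (g : R -> R) : (forall y, M <= `|y| -> g y = 0) ->
    g n%:R @[n --> \oo] --> (0 : R) /\ g (- n%:R) @[n --> \oo] --> (0 : R).
  move=> g0; split; apply: cvg_near_cst; near=> n; apply: g0; rewrite ?normrN ger0_norm//.
    by near: n; exact: nbhs_infty_ger.
  by near: n; exact: nbhs_infty_ger.
have dx (y : R) : is_derive y 1 (fun y => y * x) x.
  have := is_derive_fctM (is_derive_id y 1) (is_derive_cst x y 1).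
  by rewrite mulr0 mulr1 add0r.
have dc (y : R) : is_derive y 1 (fun y => cos (y * x)) (- sin (y * x) * x).
  exact: (is_derive_fct_comp (is_derive_cos _) (dx y)).
have ds (y : R) : is_derive y 1 (fun y => sin (y * x)) (cos (y * x) * x).
  exact: (is_derive_fct_comp (is_derive_sin _) (dx y)).
have cc := is_derive_continuous dc; have cs := is_derive_continuous ds.
have cphi := is_derive_continuous d.
have icos (f : R -> R) : rint f -> rint (fun y => f y * cos (y * x)).
  move=> /(cint_fourier x)[r _]; move: r; congr rint.
  by apply/funext => y /=; rewrite cosN mul0r subr0.
have isin (f : R -> R) : rint f -> rint (fun y => f y * sin (y * x)).
  move=> /(cint_fourier x)[_ /rintN]; congr rint.
  by apply/funext => y /=; rewrite sinN mul0r addr0 mulrN opprK.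
have IBP (T T' : R -> R) : (forall y : R, is_derive y 1 T (T' y)) ->
    continuous T' -> rint (fun y => phi y * T' y) ->
    rint (fun y => phi^`()%classic y * T y) ->
    \int[mu]_y (phi^`()%classic y * T y) = - \int[mu]_y (phi y * T' y).
  move=> dT cT' i1 i2; have cT := is_derive_continuous dT.
  have [l1 l2] : (fun y => phi y * T y) n%:R @[n --> \oo] --> (0 : R) /\
      (fun y => phi y * T y) (- n%:R) @[n --> \oo] --> (0 : R).
    by apply: (lim0 (fun y => phi y * T y)) => y My; rewrite s// mul0r.
  have i2' : rint (fun y => T y * phi^`()%classic y).
    by under [X in rint X]eq_fun do rewrite mulrC.
  have := @FTC2_line R (fun y => phi y * T y) _ 0 0
    (fun y => is_derive_fctM (d y) (dT y)) _ (rintD i1 i2') l1 l2.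
  rewrite subrr RintegralD// => H.
  under eq_Rintegral do rewrite mulrC.
  by apply/eqP; rewrite -addr_eq0 addrC H// => y; apply: cvgD; apply: cvgM;
    [exact: cphi|exact: cT'|exact: cT|exact: c].
have E1 : \int[mu]_y (phi^`()%classic y * cos (y * x)) = x * \int[mu]_y (phi y * sin (y * x)).
  have E y : phi y * (- sin (y * x) * x) = - x * (phi y * sin (y * x)) by ring.
  rewrite (IBP _ _ dc).
  - under eq_Rintegral do rewrite E.
    by rewrite RintegralZl ?mulNr ?opprK//; exact: isin.
  - by move=> y; apply: cvgMl; apply: cvgN; exact: cs.
  - by under [X in rint X]eq_fun do rewrite E; apply: rintZ; exact: isin.
  - exact: icos.
have E2 : \int[mu]_y (phi^`()%classic y * sin (y * x)) = - (x * \int[mu]_y (phi y * cos (y * x))).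
  have E y : phi y * (cos (y * x) * x) = x * (phi y * cos (y * x)) by ring.
  rewrite (IBP _ _ ds).
  - under eq_Rintegral do rewrite E.
    by rewrite RintegralZl//; exact: icos.
  - by move=> y; apply: cvgMl; exact: cc.
  - by under [X in rint X]eq_fun do rewrite E; apply: rintZ; exact: icos.
  - exact: isin.
have F (f : R -> R) : rint f -> fourier f x =
    (\int[mu]_y (f y * cos (y * x))) +i* (- \int[mu]_y (f y * sin (y * x))).
  move=> fi; apply: complex_eq.
    by apply: eq_Rintegral => y _ /=; rewrite mul0r subr0.
  rewrite -[RHS]mulN1r -RintegralZl//; last exact: isin.
  by apply: eq_Rintegral => y _ /=; rewrite mul0r addr0 mulN1r mulrN.
rewrite !F// E1 E2; apply: complex_eq; rewrite !cReImE /=; ring.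
Unshelve. all: by end_near. Qed.

(** Both [fourier phi x] and [x * fourier phi x] are bounded, the latter as the transform of the
    derivative, so the squared modulus is at most a constant over [1 + x^2]. *)
Lemma L2_fourier A phi : test_function A phi -> L2 (fourier phi).
Proof.
move=> tphi; have [iphi iphi'] := test_function_rint tphi.
pose B1 := 2 * \int[mu]_y `|phi y|.
pose B2 := 2 * \int[mu]_y `|phi^`()%classic y|.
apply/L2P; split; first exact: cmeas_fourier.
apply: (@rint_le _ _ (fun x => (B1 ^+ 2 + B2 ^+ 2) * (1 + x ^+ 2)^-1)).
- by apply: measurable_funX; apply: cmeas_normc; exact: cmeas_fourier.
- by apply: rintZ; exact: rint_oneDsqr.
move=> x; rewrite ger0_norm ?sqr_ge0// ler_pdivlMr ?oneDsqr_gt0// mulrDr mulr1.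
have b1 := normc_fourier_le x iphi; have b2 := normc_fourier_le x iphi'.
have N0 := normc_ge0 (fourier phi x).
rewrite (fourier_deriv _ tphi) !normcM normc_real in b2.
have i1 : normc ('i : C) = 1 by rewrite /= expr0n/= add0r expr1n sqrtr1.
rewrite i1 mul1r in b2; apply: lerD.
  by rewrite ler_sqr// nnegrE (le_trans _ b1).
rewrite -(real_normK (num_real x)) mulrC -exprMn ler_sqr// nnegrE ?mulr_ge0//.
by apply: Rintegral_ge0 => y _.
Qed.

Lemma fourier_shift phi (y x : R) : rint phi ->
  fourier (fun t => phi (t + y)) x = cis (y * x) * fourier phi x.
Proof.
move=> iphi; rewrite !fourierE -cintegralZ; last exact: cint_fourier.
have := cint_fourier x iphi => /(cintZ (cis (y * x)))/(cint_shift y)[_ <-].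
apply: eq_cintegral => t; rewrite mulrCA; congr (_ * _).
by rewrite -cisD; congr cis; ring.
Qed.

Lemma test_function_shift phi (y : R) : 0 <= y ->
  test_function (~` `[0, +oo[) phi ->
  test_function (~` `[0, +oo[) (fun t => phi (t + y)).
Proof.
move=> y0 [d c s].
have dn n : ((fun t => phi (t + y))^`(n))%classic = (fun t => (phi^`(n))%classic (t + y)).
  elim: n => [//|n IHn]; rewrite !derive1nS IHn; apply/funext => x.
  rewrite !derive1E.
  have dfn : is_derive (x + y) 1 (phi^`(n))%classic ('D_1 (phi^`(n))%classic (x + y)).
    by apply: derivableP; exact: d.
  have dsh : is_derive x 1 (fun t => t + y) 1.
    have := is_derive_fctD (is_derive_id x 1) (is_derive_cst y x 1).
    by rewrite addr0.
  have := @is_derive_fct_comp R _ (fun t => t + y) x _ _ dfn dsh; rewrite mulr1 => dd.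
  exact: derive_val.
have cont : continuous (fun t : R => t + y).
  by move=> t; apply: cvgD; [exact: cvg_id|exact: cvg_cst].
have clo : closure [set x | phi (x + y) != 0] `<=`
    (fun t => t + y) @^-1` closure [set x | phi x != 0].
  rewrite closureE; apply: smallest_sub.
    by apply: closed_comp; [move=> t _; exact: cont|exact: closed_closure].
  by move=> t /= phit; apply: subset_closure.
split.
- move=> n x; rewrite dn.
  have dsh : is_derive x 1 (fun t => t + y) 1.
    have := is_derive_fctD (is_derive_id x 1) (is_derive_cst y x 1).
    by rewrite addr0.
  have dfn : is_derive (x + y) 1 (phi^`(n))%classic ('D_1 (phi^`(n))%classic (x + y)).
    by apply: derivableP; exact: d.
  have := @is_derive_fct_comp R _ (fun t => t + y) x _ _ dfn dsh => dd.
  exact: ex_derive.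
- have : compact ((fun t => t - y) @` closure [set x | phi x != 0]).
    apply: continuous_compact => //; apply: continuous_subspaceT => t.
    by apply: cvgB; [exact: cvg_id|exact: cvg_cst].
  move=> cc; apply: (subclosed_compact _ cc); first exact: closed_closure.
  by move=> t /clo /= ct; exists (t + y) => //; rewrite addrK.
- move=> t /clo /= /s /=; rewrite !in_itv/= !andbT => ty t0; apply: ty.
  by rewrite addr_ge0.
Qed.

End TestFunctions.

(** * Equivalence of the kernel description with the Fourier support condition *)

Section HardyCharacterization.
Context {R : realType}.
Local Notation C := R[i].
Local Notation Re := (@complex.Re R).
Local Notation Im := (@complex.Im R).
Local Notation mu := (@lebesgue_measure R).
Implicit Types (f g h : R -> C) (s t x y : R) (r phi : R -> R).

(** Lebesgue differentiation: almost everywhere [r] is the derivative of its integral from [c],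
    which is constantly 0 on the interval. *)
Lemma ae_eq0_itv r (c d : R) : rint (r \_ `]c, d[) ->
  (forall x, c < x < d -> \int[mu]_y (r \_ `]c, x[) y = 0) ->
  {ae mu, forall x, c < x < d -> r x = 0}.
Proof.
move=> ir r0; pose q := r \_ `]c, d[.
have locq : locally_integrable setT q.
  by apply: open_integrable_locally => //; exact: openT.
have iq y : mu.-integrable `]-oo, y] (EFin \o q).
  by apply: (integrableS _ _ _ ir).
have := FTC1Ny iq locq.
apply: ae_imp => x [_ dF] /andP[cx xd].
have <- : q x = r x by rewrite /q patch_in//= in_itv/= cx.
rewrite -dF derive1E.
rewrite (_ : 'D_1 _ x = 'D_1 (fun=> 0 : R) x); first exact: derive_val.
apply: near_eq_derive; near=> z.
have cz : c < z by near: z; exact: lt_nbhsr.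
have zd : z < d by near: z; exact: lt_nbhsl.
rewrite -(Rintegral_itv_bndo_bndc (r := z)); last first.
  by apply: (integrableS _ _ _ ir).
rewrite -(r0 z) ?cz// -Rintegral_patch; apply: eq_Rintegral => y _.
rewrite /q; have [yz|yz] := ltP y z; last first.
  rewrite patch_out/= ?in_itv/= ?ltNge ?yz//.
  by rewrite patch_out//= in_itv/= (ltNge y) yz andbF.
rewrite patch_in/= ?in_itv//=.
have [cy|cy] := ltP c y.
  by rewrite !patch_in//= in_itv/= cy// (lt_trans yz).
by rewrite !patch_out//= in_itv/= ltNge cy.
Unshelve. all: by end_near. Qed.

Lemma normc_Ntimes_ker n x : normc (n.+1%:R%:C * ker n.+1%:R x) <= 1.
Proof.
have n0 : 0 < n.+1%:R :> R by rewrite ltr0n.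
rewrite normcM normc_real ger0_norm ?ler0n//.
rewrite (le_trans (ler_wpM2l _ (normc_ker_le x _))) ?ler0n ?gt_eqF//.
by rewrite ger0_norm ?ler0n// divff// gt_eqF.
Qed.

Lemma ccvg_Ntimes_ker x : ccvg (fun n => n.+1%:R%:C * ker n.+1%:R x) 1.
Proof.
have E n : n.+1%:R%:C * ker n.+1%:R x = ker 1 (x * n.+1%:R^-1).
  have n0 : n.+1%:R != 0 :> R by rewrite pnatr_eq0.
  apply: (mulIf (ker_neq0 x n0)); rewrite -mulrA ker_mulV// mulr1.
  have -> : (n.+1%:R -i* x : C) = n.+1%:R%:C * (1 -i* (x * n.+1%:R^-1)).
    apply: complex_eq; rewrite !cReImE /=; first by ring.
    by move: n0; move: (n.+1%:R) => N N0; field.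
  by rewrite mulrCA ker_mulV ?mulr1// oner_neq0.
under [X in ccvg X]eq_fun do rewrite E.
have u0 : (fun n => x * n.+1%:R^-1) @ \oo --> (0 : R).
  by rewrite -(mulr0 x); apply: cvgMr; exact: cvg_harmonic.
have d : (fun n => (1 ^+ 2 + (x * n.+1%:R^-1) ^+ 2)^-1) @ \oo --> ((1 ^+ 2 + 0 ^+ 2)^-1 : R).
  apply: cvgV; first by rewrite gt_eqF// ker_den_gt0// oner_neq0.
  apply: cvgD; first exact: cvg_cst.
  by rewrite expr2; under eq_cvg do rewrite expr2; exact: cvgM.
split.
  rewrite -[X in _ --> X]/(1 : R).
  under eq_cvg do rewrite Re_ker mul1r.
  by move: d; rewrite expr1n expr0n/= addr0 invr1.
have -> : Im (1 : C) = 0 * (1 ^+ 2 + 0 ^+ 2)^-1 by rewrite mul0r.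
by under eq_cvg do rewrite Im_ker; exact: cvgM.
Qed.

(** [n ker n] tends to 1 and has modulus at most 1. So a factor [ker t] may be inserted to turn a
    square-integrable factor into an integrable one, as Fubini requires, and removed at the end. *)
Lemma ker_removal g : cint g ->
  (forall t, 0 < t -> cintegral (fun x => g x * ker t x) = 0) -> cintegral g = 0.
Proof.
move=> ig g0.
have lim : ccvg (fun n => cintegral (fun x => g x * (n.+1%:R%:C * ker n.+1%:R x)))
                (cintegral (fun x => g x * 1)).
  apply: (cDCT _ _ _ (cint_normc ig)).
  - move=> n; apply: cmeasM; first exact: cint_cmeas.
    by apply: cmeasZ; apply: cmeas_ker; rewrite pnatr_eq0.
  - by apply: cmeasM; [exact: cint_cmeas|exact: cmeas_cst].
  - apply: aeW => x; apply: ccvgM; first exact: ccvg_cst.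
    exact: ccvg_Ntimes_ker.
  - by move=> n x; rewrite normcM ler_piMr ?normc_ge0 ?normc_Ntimes_ker.
have -> : cintegral g = cintegral (fun x => g x * 1).
  by apply: eq_cintegral => x; rewrite mulr1.
apply: (ccvg_unique lim).
rewrite (_ : (fun _ => _) = (fun=> 0)); first exact: ccvg_cst.
apply/funext => n; under eq_cintegral do rewrite mulrCA.
have n0 : 0 < n.+1%:R :> R by rewrite ltr0n.
rewrite cintegralZ ?g0 ?mulr0//.
apply: (@cint_bounded _ _ _ (`|n.+1%:R|^-1)) => //.
  by apply: cmeas_ker; rewrite gt_eqF.
by move=> x; apply: normc_ker_le; rewrite gt_eqF.
Qed.

Lemma cmeas_prod_cis : cmeas (fun z : R * R => cis (- (z.2 * z.1)) : C).
Proof.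
apply: (@cmeas_comp _ _ _ _ R cis (fun z : R * R => - (z.2 * z.1)) (@cmeas_cis R)).
by apply: measurable_funN; exact: measurable_funM.
Qed.

(** After insertion of [ker t], Fubini turns the pairing into an integral of [phi y] times the
    integral of [f ker t] against the character of frequency [- y]. Where [phi y] is nonzero, [y] is
    negative and [hardy_cis] applies. *)
Lemma hardy_L2p f : hardy f -> L2p f.
Proof.
move=> hf; have [lf _] := hf; split => // phi tphi.
have [iphi _] := test_function_rint tphi.
have lphi := L2_fourier tphi.
apply: ker_removal; first exact: L2_mul.
move=> t t0; have t_neq0 : t != 0 by rewrite gt_eqF.
transitivity (cintegral (fun x => (f x * ker t x) *
    cintegral (fun y => (phi y)%:C * cis (- (y * x))))).
  by apply: eq_cintegral => x; rewrite fourierE; ring.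
rewrite (@cFubini _ _ _ (fun z : R * R => cis (- (z.2 * z.1))) 1).
- rewrite -[RHS]cintegral0; apply: eq_cintegral => y /=.
  have [->|phiy] := eqVneq (phi y) 0; first by rewrite mul0r.
  case: tphi => _ _ /(_ y); have /(_ y phiy) /[swap] /[apply] := @subset_closure _ [set x | phi x != 0].
  rewrite /= in_itv/= andbT => /negP; rewrite -ltNge => y0.
  have := @hardy_cis _ f t (- y) t0 _ hf.
  under eq_cintegral do rewrite mulNr.
  by move=> ->; rewrite ?mulr0// oppr_ge0 ltW.
- exact: cint_L2_ker.
- exact: cint_real.
- exact: cmeas_prod_cis.
- by move=> z; rewrite normc_cis.
Qed.

(** [ker t] is a superposition of characters of frequencies [y >= 0]. Multiplying [fourier phi] by
    such a character translates [phi] to the left by [y], so the support remains in the negative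
    half-line and the hypothesis on [f] applies for each [y]. *)
Lemma fourier_supp_ker f t phi : L2p f -> 0 < t ->
  test_function (~` `[0, +oo[) phi ->
  cintegral (fun x => f x * ker t x * fourier phi x) = 0.
Proof.
move=> [lf sf] t0 tphi; have [iphi _] := test_function_rint tphi.
have lphi := L2_fourier tphi.
transitivity (cintegral (fun x => (f x * fourier phi x) *
    cintegral (fun y => (half_exp t y)%:C * cis (y * x)))).
  by apply: eq_cintegral => x; rewrite laplace_cis//; ring.
rewrite (@cFubini _ _ _ (fun z : R * R => cis (z.2 * z.1)) 1).
- rewrite -[RHS]cintegral0; apply: eq_cintegral => y /=.
  have [y0|y0] := ltP y 0.
    by rewrite /half_exp patch_out ?mul0r//= in_itv/= andbT leNgt y0.
  rewrite (_ : cintegral _ = fourier_pairing f (fun t => phi (t + y))).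
    by rewrite sf ?mulr0//; exact: test_function_shift.
  by apply: eq_cintegral => x; rewrite fourier_shift//; ring.
- exact: L2_mul.
- by apply: cint_real; exact: rint_half_exp.
- apply: (@cmeas_comp _ _ _ _ R cis (fun z : R * R => z.2 * z.1) (@cmeas_cis R)).
  exact: measurable_funM.
- by move=> z; rewrite normc_cis.
Qed.

Definition ftransform g y : C := cintegral (fun x => g x * cis (- (y * x))).

Lemma cint_ftransform g y : cint g -> cint (fun x => g x * cis (- (y * x))).
Proof.
move=> ig; apply: (@cint_bounded _ _ _ 1) => //.
  apply: (@cmeas_comp _ _ _ _ R cis (fun x : R => - (y * x)) (@cmeas_cis R)).
  by apply: measurable_funN; exact: mulrl_measurable.
by move=> x; rewrite normc_cis.
Qed.

Lemma cmeas_ftransform g : cint g -> cmeas (ftransform g).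
Proof.
move=> ig.
have cv (u : nat -> R) y : u @ \oo --> y ->
    ccvg (fun n => ftransform g (u n)) (ftransform g y).
  move=> uy; apply: (cDCT _ _ _ (cint_normc ig)).
  - by move=> n; apply: cint_cmeas; exact: cint_ftransform.
  - by apply: cint_cmeas; exact: cint_ftransform.
  - apply: aeW => x; apply: ccvgM; first exact: ccvg_cst.
    have uN : (fun n => - (u n * x)) @ \oo --> - (y * x) by apply: cvgN; exact: cvgMl.
    split; apply: (cvg_comp _ _ uN); [exact: continuous_cos|exact: continuous_sin].
  - by move=> n x; rewrite normcM normc_cis mulr1.
split; apply: continuous_measurable_fun => x; apply: sequential_continuous => u ux.
- by case: (cv u x ux).
- by case: (cv u x ux).
Qed.

Lemma normc_ftransform_le g y : cint g ->
  normc (ftransform g y) <= 2 * \int[mu]_x normc (g x).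
Proof.
move=> ig; rewrite (le_trans (normc_cintegral_le (cint_ftransform y ig)))//.
rewrite ler_wpM2l// le_eqVlt; apply/orP; left; apply/eqP.
by apply: eq_Rintegral => x _; rewrite normcM normc_cis mulr1.
Qed.

Lemma patch_indic r (D : set R) : r \_ D = (fun y => \1_D y * r y).
Proof.
apply/funext => y; rewrite indicE; have [yD|yD] := boolP (y \in D).
  by rewrite patch_in ?mul1r//; rewrite inE in yD.
by rewrite patch_out ?mul0r//; rewrite notin_setE in yD.
Qed.

(** Bumps on []c, x[] tend to its indicator under a fixed dominating function, so all integrals of
    [h] from [c] vanish. *)
Lemma ae_eq0_bump h (c d : R) : cmeas h -> cint (fun y => (\1_`]c, d[ y)%:C * h y) ->
  (forall x n, c < x < d -> cintegral (fun y => (bump c x n y)%:C * h y) = 0) ->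
  {ae mu, forall x, c < x < d -> h x = 0}.
Proof.
move=> mh ih h0.
have indic0 x : c < x < d -> cintegral (fun y => (\1_`]c, x[ y)%:C * h y) = 0.
  move=> cxd; have /andP[cx xd] := cxd.
  have lim : ccvg (fun n => cintegral (fun y => (bump c x n y)%:C * h y))
      (cintegral (fun y => (\1_`]c, x[ y)%:C * h y)).
    apply: (cDCT _ _ _ (cint_normc ih)).
    - move=> n; apply: cmeasM => //; apply: cmeas_real.
      by apply: continuous_measurable_fun; apply: smooth_continuous; exact: smooth_bump.
    - by apply: cmeasM => //; apply: cmeas_real; exact: measurable_indic.
    - apply: aeW => y; apply: ccvgM; last exact: ccvg_cst.
      by apply: ccvg_real; exact: cvg_bump.
    - move=> n y; rewrite !normcM ler_wpM2r ?normc_ge0// !normc_real.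
      rewrite ger0_norm ?bump_ge0// ger0_norm; last by rewrite indicE ler0n.
      have [/bump_supp/andP[ay yb]|] := boolP (bump c x n y != 0); last first.
        by rewrite negbK => /eqP ->; rewrite indicE ler0n.
      by rewrite indicE mem_set/= ?bump_le1// in_itv/= ay (lt_trans yb).
  apply: (ccvg_unique lim).
  by under [X in ccvg X]eq_fun do rewrite h0//; exact: ccvg_cst.
(* [P] is the real or the imaginary part; the argument is made once for both. *)
have main (P : C -> R) : (forall (x : R) z, P (x%:C * z) = x * P z) ->
    (forall h, P (cintegral h) = \int[mu]_x P (h x)) ->
    rint (P \o (fun y => (\1_`]c, d[ y)%:C * h y)) ->
    {ae mu, forall y, c < y < d -> P (h y) = 0}.
  move=> PZ Pint iP; apply: (@ae_eq0_itv (P \o h)).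
    by rewrite patch_indic; move: iP; congr rint; apply/funext => y /=; rewrite PZ.
  move=> x /indic0/(congr1 P); rewrite Pint patch_indic => H.
  transitivity (\int[mu]_y P ((\1_`]c, x[ y)%:C * h y)).
    by apply: eq_Rintegral => y _; rewrite PZ.
  by rewrite H -[0]/(0%:C) -[0%:C]mulr1 PZ mul0r.
have aeRe : {ae mu, forall y, c < y < d -> Re (h y) = 0}.
  apply: main => //; last by case: ih.
  by move=> x z; rewrite cReM /= mul0r subr0.
have aeIm : {ae mu, forall y, c < y < d -> Im (h y) = 0}.
  apply: main => //; last by case: ih.
  by move=> x z; rewrite cImM /= mul0r addr0.
apply: (ae_imp2 _ aeRe aeIm) => y h1 h2 y0.
by apply: complex_eq; [exact: h1|exact: h2].
Qed.

Lemma ltr_Ntruncn x : - (Num.truncn `|x|).+1%:R < x < (Num.truncn `|x|).+1%:R.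
Proof. by rewrite -ltr_norml truncnS_gt. Qed.

(** Fubini identifies the integral of the transform against a bump with the pairing in
    [fourier_supp_ker], zero when the bump lives on the negative half-line. *)
Lemma L2p_ftransform_eq0 f t : L2p f -> 0 < t ->
  {ae mu, forall y, y < 0 -> ftransform (fun x => f x * ker t x) y = 0}.
Proof.
move=> pf t0; have t_neq0 : t != 0 by rewrite gt_eqF.
have [lf _] := pf.
set g := fun x => f x * ker t x; have ig : cint g by exact: cint_L2_ker.
have mH := cmeas_ftransform ig.
pose B := 2 * \int[mu]_x normc (g x).
have HB y : normc (ftransform g y) <= B by exact: normc_ftransform_le.
have bump0 (a b : R) n : b < 0 -> cintegral (fun y => (bump a b n y)%:C * ftransform g y) = 0.
  move=> b0; have tb : test_function (~` `[0, +oo[) (bump a b n).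
    apply: bump_test_function => x /=; rewrite !in_itv/= andbT => /andP[_ xb].
    by apply/negP; rewrite -ltNge (le_lt_trans xb).
  have [ib _] := test_function_rint tb.
  rewrite -(@cFubini _ g (fun y => (bump a b n y)%:C) (fun z : R * R => cis (- (z.2 * z.1))) 1)//.
  + rewrite -(fourier_supp_ker pf t0 tb); apply: eq_cintegral => x.
    by rewrite fourierE.
  + exact: cint_real.
  + exact: cmeas_prod_cis.
  + by move=> z; rewrite normc_cis.
have aen (n : nat) : {ae mu, forall y, - n%:R < y < 0 -> ftransform g y = 0}.
  apply: ae_eq0_bump => //.
    apply: (@cint_bounded _ _ _ B) => //; apply: cint_real.
    exact: integrable_indic_itv.
  by move=> x m /andP[_ x0]; exact: bump0.
have := ae_foralln aen; apply: ae_imp => y Hy y0.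
by apply: (Hy (Num.truncn `|y|).+1); have /andP[-> _] := ltr_Ntruncn y.
Qed.

(** Expanding [ker s] as a Laplace transform gives the integral of [e^{-s y}] times the transform of
    [f ker t] at [- y], over [y >= 0], where the transform vanishes almost everywhere. *)
Lemma L2p_hardy f : L2p f -> hardy f.
Proof.
move=> pf; have [lf _] := pf; split=> // s s0; have s_neq0 : s != 0 by rewrite gt_eqF.
apply: ker_removal; first exact: cint_L2_ker.
move=> t t0; have t_neq0 : t != 0 by rewrite gt_eqF.
have ig := cint_L2_ker lf t_neq0.
transitivity (cintegral (fun x => f x * ker t x *
    cintegral (fun y => (half_exp s y)%:C * cis (y * x)))).
  by apply: eq_cintegral => x; rewrite laplace_cis//; ring.
rewrite (@cFubini _ _ _ (fun z : R * R => cis (z.2 * z.1)) 1)//; last 3 first.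
- by apply: cint_real; exact: rint_half_exp.
- apply: (@cmeas_comp _ _ _ _ R cis (fun z : R * R => z.2 * z.1) (@cmeas_cis R)).
  exact: measurable_funM.
- by move=> z; rewrite normc_cis.
set G := fun y => _.
have mG : cmeas (fun y => (half_exp s (- y))%:C * ftransform (fun x => f x * ker t x) y).
  apply: cmeasM; last exact: cmeas_ftransform.
  apply: cmeas_real; apply: (measurableT_comp (rint_measurable (rint_half_exp s0))).
  exact: oppr_measurable.
have GE y : G (- y) = (half_exp s (- y))%:C * ftransform (fun x => f x * ker t x) y.
  congr (_ * _); apply: eq_cintegral => x.
  by rewrite /= mulNr.
have iG : cint G.
  have GE' : G = (fun y => (half_exp s y)%:C * ftransform (fun x => f x * ker t x) (- y)).
    by apply/funext => y; have := GE (- y); rewrite opprK.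
  rewrite GE'; apply: (@cint_bounded _ _ _ (2 * \int[mu]_x normc (f x * ker t x))).
  - by apply: cint_real; exact: rint_half_exp.
  - apply: (@cmeas_comp _ _ _ _ R _ (fun y : R => - y) (cmeas_ftransform ig)).
    exact: oppr_measurable.
  - by move=> y; exact: normc_ftransform_le.
have [_ <-] := cint_opp iG; rewrite -[RHS]cintegral0.
under eq_cintegral do rewrite GE.
apply: cintegral_ae => //; first exact: cmeas_cst.
(* At the endpoint 0 the exponential factor is 1 and nothing is known of the transform. *)
have ne0 : {ae mu, forall y, y != 0}.
  exists [set 0]; split => //; first exact: lebesgue_measure_set1.
  by move=> y /= /negP; rewrite negbK => /eqP.
apply: (ae_imp2 _ (L2p_ftransform_eq0 pf t0) ne0) => y Hy y0 _.
have [y1|y1] := ltP y 0; first by rewrite Hy ?mulr0.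
have y2 : 0 < y by rewrite lt_neqAle eq_sym y0.
by rewrite /half_exp patch_out ?mul0r//= in_itv/= andbT oppr_ge0 leNgt y2.
Qed.

End HardyCharacterization.

(** * Absolutely continuous functions, integration by parts and weak derivatives *)

Section AbsolutelyContinuous.
Context {R : realType}.
Local Notation C := R[i].
Local Notation Re := (@complex.Re R).
Local Notation Im := (@complex.Im R).
Local Notation mu := (@lebesgue_measure R).
Implicit Types (f g h F G : R -> C) (a b x y : R) (r phi : R -> R).

(** Half-open, so that the indicators of adjacent intervals add up exactly. *)
Definition oc a b x : R := \1_`]a, b] x.

Lemma ocE a b x : oc a b x = (a < x <= b)%R%:R.
Proof.
rewrite /oc indicE; congr (_%:R); congr nat_of_bool.
by apply/idP/idP; rewrite inE /= in_itv.
Qed.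

Lemma measurable_oc a b : measurable_fun setT (oc a b).
Proof. exact: measurable_indic. Qed.

Lemma rint_oc a b : rint (oc a b).
Proof. exact: integrable_indic_itv. Qed.

Lemma oc_ge0 a b x : 0 <= oc a b x.
Proof. by rewrite ocE ler0n. Qed.

Lemma oc_le1 a b x : oc a b x <= 1.
Proof. by rewrite ocE lern1 leq_b1. Qed.

Lemma Rintegral_indic01 (b b' : bool) :
  \int[mu]_x (\1_[set` Interval (BSide b 0) (BSide b' 1)] x : R) = 1.
Proof.
rewrite /Rintegral integral_indic// setIT.
have := @lebesgue_measure_itv R (Interval (BSide b 0) (BSide b' 1)).
by rewrite /= lte_fin ltr01 -EFinD subr0 => ->.
Qed.

Lemma normc_oc_le1 a b x : normc (oc a b x)%:C <= 1.
Proof. by rewrite normc_real ger0_norm ?oc_ge0 ?oc_le1. Qed.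

Lemma oc_cat a b c x : a <= b -> b <= c -> oc a c x = oc a b x + oc b c x.
Proof.
move=> ab bc; rewrite !ocE; have [xa|xa] := leP x a.
  by rewrite (ltNge b) (le_trans xa ab) /= addr0.
have [xb|xb] := leP x b; first by rewrite (le_trans xb bc) /= addr0.
by rewrite /= add0r.
Qed.

Definition locint g := forall a b, cint (fun x => (oc a b x)%:C * g x).

(** Local absolute continuity with density [g], phrased through integrals so that no pointwise
    derivative occurs. *)
Definition primitive F g := locint g /\ forall a b, a <= b ->
  F b = F a + cintegral (fun x => (oc a b x)%:C * g x).

Lemma cmeas_oc a b : cmeas (fun x => (oc a b x)%:C : C).
Proof. by apply: cmeas_real; exact: measurable_oc. Qed.

Lemma cint_locint g : cint g -> locint g.
Proof.
move=> ig a b; under [X in cint X]eq_fun do rewrite mulrC.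
apply: (@cint_bounded _ _ _ 1) => //; first exact: cmeas_oc.
by move=> x; exact: normc_oc_le1.
Qed.

Lemma L2_oc a b : L2 (fun x => (oc a b x)%:C : C).
Proof.
apply: (@L2_le _ _ (oc a b)); first exact: cmeas_oc.
  under [X in rint X]eq_fun do rewrite expr2 ocE -natrM mulnb andbb -ocE.
  exact: rint_oc.
by move=> x; rewrite normc_real ger0_norm ?oc_ge0.
Qed.

Lemma L2_locint g : L2 g -> locint g.
Proof. by move=> lg a b; apply: L2_mul => //; exact: L2_oc. Qed.

Lemma locintD g h : locint g -> locint h -> locint (fun x => g x + h x).
Proof.
by move=> lg lh a b; under [X in cint X]eq_fun do rewrite mulrDr; exact: cintD.
Qed.

Lemma primitive_dist F g a b x : primitive F g -> a <= x <= b ->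
  normc (F x - F a) <= 2 * \int[mu]_y normc ((oc a b y)%:C * g y).
Proof.
move=> [lg Fg] /andP[ax xb]; rewrite (Fg _ _ ax) addrC addKr.
rewrite (le_trans (normc_cintegral_le (lg _ _)))// ler_wpM2l//.
apply: le_Rintegral => //; [exact: cint_normc|exact: cint_normc|].
move=> y _; rewrite !normcM ler_wpM2r ?normc_ge0// !normc_real !ger0_norm ?oc_ge0//.
by rewrite (oc_cat _ ax xb) lerDl oc_ge0.
Qed.

Lemma primitive_locbounded F g a b : primitive F g ->
  exists2 B, 0 <= B & forall x, a <= x <= b -> normc (F x) <= B.
Proof.
move=> pF; exists (normc (F a) + 2 * \int[mu]_y normc ((oc a b y)%:C * g y)).
  rewrite addr_ge0 ?normc_ge0// mulr_ge0//; apply: Rintegral_ge0 => y _.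
  exact: normc_ge0.
move=> x xab; have := primitive_dist pF xab.
have := ler_normcD (F x - F a) (F a); rewrite subrK => h1 h2.
by rewrite (le_trans h1)// addrC lerD2l.
Qed.

Lemma primitive_ccvg F g (u : nat -> R) x : primitive F g -> u @ \oo --> x ->
  ccvg (fun n => F (u n)) (F x).
Proof.
move=> [lg Fg] ux.
have [M [_ uM]] : bounded_fun u by apply: cvg_seq_bounded; apply/cvg_ex; exists x.
(* All points of the sequence and its limit lie in [[-N, N]], so every value of [F] is an integral
   from the common base point [- N], dominated by [g] on that interval. *)
pose N := Num.max (M + 1) (`|x| + 1).
have uN n : `|u n| <= N.
  by rewrite le_max; apply/orP; left; apply: uM; rewrite ?ltrDl.
have xN : `|x| <= N by rewrite le_max lerDl ler01 orbT.
have E y : `|y| <= N -> F y = F (- N) + cintegral (fun t => (oc (- N) y t)%:C * g t).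
  by rewrite ler_norml => /andP[Ny _]; exact: Fg.
rewrite (E x xN); under [X in ccvg X]eq_fun do rewrite E//.
apply: ccvgD; first exact: ccvg_cst.
apply: (cDCT _ _ _ (cint_normc (lg (- N) N))).
- by move=> n; exact: cint_cmeas.
- exact: cint_cmeas.
- have ne : {ae mu, forall y, y != x}.
    exists [set x]; split => //; first exact: lebesgue_measure_set1.
    by move=> y /= /negP; rewrite negbK => /eqP.
  apply: (ae_imp _ ne) => y yx; apply: ccvgM; last exact: ccvg_cst.
  apply: ccvg_real; apply: cvg_near_cst.
  have [yx1|xy1] := ltP y x.
    near=> n; rewrite !ocE (ltW yx1) ltW//; near: n.
    exact: (cvgr_gt x ux).
  have xy : x < y by rewrite lt_neqAle eq_sym yx.
  near=> n; have un : u n < y by near: n; exact: (cvgr_lt x ux).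
  by rewrite !ocE !(leNgt y) xy un /= !andbF.
- move=> n y; rewrite !normcM ler_wpM2r ?normc_ge0// !normc_real !ger0_norm ?oc_ge0//.
  have := uN n; rewrite ler_norml => /andP[u1 u2].
  by rewrite (oc_cat _ u1 u2) lerDl oc_ge0.
Unshelve. all: by end_near. Qed.

Lemma primitive_cmeas F g : primitive F g -> cmeas F.
Proof.
move=> pF; split; apply: continuous_measurable_fun => x;
  apply: sequential_continuous => u ux.
- by case: (primitive_ccvg pF ux).
- by case: (primitive_ccvg pF ux).
Qed.

Lemma locint_mul_primitive F g h : primitive F g -> locint h ->
  cmeas h -> locint (fun x => F x * h x).
Proof.
move=> pF lh mh a b; have [B B0 FB] := primitive_locbounded a b pF.
apply: (@cint_le _ _ (fun x => B * normc ((oc a b x)%:C * h x))).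
- apply: cmeasM; first exact: cmeas_oc.
  by apply: cmeasM => //; exact: primitive_cmeas pF.
- by apply: rintZ; exact: cint_normc.
move=> x; rewrite mulrCA normcM.
have [xab|xab] := boolP (a < x <= b).
  by rewrite ler_wpM2r ?normc_ge0// FB//; case/andP: xab => /ltW -> ->.
by rewrite ocE (negbTE xab) mul0r normc0 !mulr0.
Qed.

(** Fubini on the triangle [a < y <= x <= b] for [f(x) g(y)]: one order of integration gives the
    integral of [f (G - G a)], the other that of [(F b - F) g]. *)
Lemma primitiveM F f G g : primitive F f -> primitive G g -> cmeas f -> cmeas g ->
  primitive (fun x => F x * G x) (fun x => G x * f x + F x * g x).
Proof.
move=> pF pG mf mg; have [lf Ff] := pF; have [lg Gg] := pG.
have lGf := locint_mul_primitive pG lf mf.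
have lFg := locint_mul_primitive pF lg mg.
split; first exact: locintD.
move=> a b ab.
pose phi x := (oc a b x)%:C * f x; pose psi x := (oc a b x)%:C * g x.
pose K (z : R * R) : C := (\1_`[0, +oo[ (z.1 - z.2) : R)%:C.
have KE x y : K (x, y) = ((y <= x)%R%:R : R)%:C.
  rewrite /K indicE; congr (_%:C); congr (_%:R); congr nat_of_bool.
  by apply/idP/idP; rewrite inE /= in_itv/= andbT subr_ge0.
have iphi : cint phi by exact: lf.
have ipsi : cint psi by exact: lg.
have mK : cmeas K.
  apply: cmeas_real; apply: (measurableT_comp (measurable_indic _)) => //.
  exact: measurable_funB.
have K1 z : normc (K z) <= 1.
  by case: z => x y; rewrite KE normc_real ger0_norm ?ler0n// lern1 leq_b1.
have FE x : phi x * cintegral (fun y => psi y * K (x, y)) = phi x * G x - G a * phi x.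
  rewrite /phi ocE; have [/andP[ax xb]|_] := boolP (a < x <= b); last by rewrite !mul0r mulr0 subrr.
  rewrite (Gg _ _ (ltW ax)) mulrDr mulrC [_ * G a]mulrC addrC addKr mulrC.
  congr (_ * _); apply: eq_cintegral => y; rewrite KE /psi !ocE mulrAC -rmorphM/= -natrM mulnb.
  congr ((_%:R)%:C * _); congr nat_of_bool.
  have [yx|] := boolP (y <= x); rewrite ?andbF ?andbT//.
  by rewrite (le_trans yx xb) andbT.
have GE y : psi y * cintegral (fun x => phi x * K (x, y)) = F b * psi y - psi y * F y.
  rewrite /psi ocE; have [/andP[ay yb]|_] := boolP (a < y <= b); last by rewrite !mul0r mulr0 subrr.
  rewrite (Ff _ _ yb) mulrDl mulrC [F y * _]mulrC addrC addKr mulrC [RHS]mulrC.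
  congr (_ * _); apply: cintegral_ae.
  - apply: cmeasM; first exact: cint_cmeas.
    apply: (@cmeas_comp _ _ _ _ R K (fun x => (x, y))) => //.
  - exact: cint_cmeas (lf _ _).
  (* The diagonal is discarded as a null set: [K] contains it, while [oc y b] starts strictly after
     [y]. *)
  have ne : {ae mu, forall x, x != y}.
    exists [set y]; split => //; first exact: lebesgue_measure_set1.
    by move=> x /= /negP; rewrite negbK => /eqP.
  apply: (ae_imp _ ne) => x xy _; rewrite KE /phi !ocE mulrAC -rmorphM/= -natrM mulnb.
  congr ((_%:R)%:C * _); congr nat_of_bool.
  rewrite (le_eqVlt y x) (eq_sym y) (negbTE xy) /=.
  have [yx|] := boolP (y < x); rewrite ?andbF ?andbT//.
  by rewrite (lt_trans ay yx).
have D := cFubini iphi ipsi mK K1.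
have i1 : cint (fun x => phi x * G x).
  by have := lGf a b; congr cint; apply/funext => x; rewrite /phi; ring.
have i2 : cint (fun x => psi x * F x).
  by have := lFg a b; congr cint; apply/funext => x; rewrite /psi; ring.
move: D; under eq_cintegral do rewrite FE.
under [in RHS]eq_cintegral do rewrite GE.
rewrite !cintegralB ?cintegralZ//; try exact: cintZ.
have -> : cintegral phi = F b - F a by rewrite (Ff _ _ ab) addrC addKr.
have -> : cintegral psi = G b - G a by rewrite (Gg _ _ ab) addrC addKr.
have -> : cintegral (fun x => (oc a b x)%:C * (G x * f x + F x * g x)) =
    cintegral (fun x => phi x * G x) + cintegral (fun x => psi x * F x).
  rewrite -cintegralD//; apply: eq_cintegral => x; rewrite /phi /psi; ring.
move: (cintegral _) (cintegral _) => I1 I2 e.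
have -> : I2 = F b * (G b - G a) - I1 + G a * (F b - F a) by rewrite -e subrK.
ring.
Qed.

Lemma primitiveB F f G g : primitive F f -> primitive G g ->
  primitive (fun x => F x - G x) (fun x => f x - g x).
Proof.
move=> [lf Ff] [lg Gg]; have E a b x : (oc a b x)%:C * (f x - g x) =
    (oc a b x)%:C * f x - (oc a b x)%:C * g x by rewrite mulrBr.
split.
  by move=> a b; under [X in cint X]eq_fun do rewrite E; exact: cintB.
move=> a b ab; under eq_cintegral do rewrite E.
by rewrite cintegralB// (Ff _ _ ab) (Gg _ _ ab); ring.
Qed.

Lemma primitive_cst (c : C) : primitive (fun=> c) (fun=> 0).
Proof.
split=> [a b|a b ab]; first by under [X in cint X]eq_fun do rewrite mulr0; exact: cint0.
by under eq_cintegral do rewrite mulr0; rewrite cintegral0 addr0.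
Qed.

Lemma primitiveJ F f : primitive F f -> primitive (fun x => (F x)^*) (fun x => (f x)^*).
Proof.
move=> [lf Ff]; have E a b x : (oc a b x)%:C * (f x)^* = ((oc a b x)%:C * f x)^*.
  by rewrite rmorphM/= oppr0.
split=> [a b|a b ab]; first by under [X in cint X]eq_fun do rewrite E; exact: cintJ.
by under eq_cintegral do rewrite E; rewrite cintegralJ// (Ff _ _ ab) rmorphD.
Qed.

Lemma patch_oc (a b : R) r : r \_ `]a, b] = (fun y => oc a b y * r y).
Proof. exact: patch_indic. Qed.

Lemma rint_oc_continuous (a b : R) r : continuous r -> rint (fun y => oc a b y * r y).
Proof.
move=> cr; rewrite -patch_oc.
have i : mu.-integrable `[a, b] (EFin \o r).
  apply: continuous_compact_integrable; first exact: segment_compact.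
  exact: continuous_subspaceT.
have : mu.-integrable `]a, b] (EFin \o r).
  by apply: (integrableS _ _ _ i) => //; apply: subset_itvr; rewrite bnd_simp.
by rewrite integrable_mkcond// restrict_EFin.
Qed.

Lemma primitive_C1 F f :
  (forall x : R, is_derive x 1 (fun x => Re (F x)) (Re (f x))) ->
  (forall x : R, is_derive x 1 (fun x => Im (F x)) (Im (f x))) ->
  continuous (fun x => Re (f x)) -> continuous (fun x => Im (f x)) ->
  primitive F f.
Proof.
move=> dr di cr ci.
have key (r q : R -> R) a b : a <= b -> (forall x : R, is_derive x 1 q (r x)) -> continuous r ->
    q b = q a + \int[mu]_x (oc a b x * r x).
  move=> ab dq cont; rewrite -patch_oc Rintegral_patch.
  have i : mu.-integrable `]a, b] (EFin \o r).
    have := rint_oc_continuous a b cont.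
    by rewrite -patch_oc /rint -restrict_EFin -integrable_mkcond.
  by rewrite Rintegral_itv_obnd_cbnd// (FTC2 ab dq cont) addrC subrK.
have RE a b x : Re ((oc a b x)%:C * f x) = oc a b x * Re (f x).
  by rewrite cReM /= mul0r subr0.
have IE a b x : Im ((oc a b x)%:C * f x) = oc a b x * Im (f x).
  by rewrite cImM /= mul0r addr0.
split.
  move=> a b; split.
    rewrite (_ : _ \o _ = (fun x => oc a b x * Re (f x))); first exact: rint_oc_continuous.
    by apply/funext => x; exact: RE.
  rewrite (_ : _ \o _ = (fun x => oc a b x * Im (f x))); first exact: rint_oc_continuous.
  by apply/funext => x; exact: IE.
move=> a b ab; apply: complex_eq; rewrite ?cReD ?cImD.
  rewrite (key _ _ _ _ ab dr cr); congr (_ + _).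
  by apply: eq_Rintegral => x _; rewrite RE.
rewrite (key _ _ _ _ ab di ci); congr (_ + _).
by apply: eq_Rintegral => x _; rewrite IE.
Qed.

Lemma primitive_bounded F f : primitive F f -> cint f ->
  exists2 B, 0 <= B & forall x, normc (F x) <= B.
Proof.
move=> pF iF; pose I := 2 * \int[mu]_y normc (f y).
have I0 : 0 <= I.
  by rewrite mulr_ge0//; apply: Rintegral_ge0 => y _; exact: normc_ge0.
exists (normc (F 0) + I); first by rewrite addr_ge0 ?normc_ge0.
have ocI a b : 2 * \int[mu]_y normc ((oc a b y)%:C * f y) <= I.
  rewrite ler_wpM2l//; apply: le_Rintegral => //.
  - by apply: cint_normc; apply: cint_locint.
  - exact: cint_normc.
  - by move=> y _; rewrite normcM ler_piMl ?normc_ge0 ?normc_oc_le1.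
move=> x; have [x0|/ltW x0] := leP 0 x.
  have := @primitive_dist F f 0 x x pF; rewrite x0 lexx => /(_ isT)/le_trans/(_ (ocI _ _)).
  have := ler_normcD (F x - F 0) (F 0); rewrite subrK => h1 h2.
  by rewrite (le_trans h1)// addrC lerD2l.
have := @primitive_dist F f x 0 0 pF; rewrite x0 lexx => /(_ isT)/le_trans/(_ (ocI _ _)).
have := ler_normcD (- (F 0 - F x)) (F 0); rewrite opprB subrK -opprB normcN => h1 h2.
by rewrite (le_trans h1)// addrC lerD2l.
Qed.

(* A vanishing average of [F (x + n) - F (x - n)] over the unit interval. *)
Lemma cintegral_deriv_eq0 F f : primitive F f -> cint F -> cint f -> cintegral f = 0.
Proof.
move=> pF iF iff; have [B B0 FB] := primitive_bounded pF iff.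
have [lf Ff] := pF.
have mF := cint_cmeas iF.
pose D n x := F (x + n%:R) - F (x - n%:R).
have mD n : cmeas (D n).
  by apply: cmeasB; [have [] := cint_shift n%:R iF|have [] := cint_shift (- n%:R) iF] => /cint_cmeas.
have lim1 : ccvg (fun n => cintegral (fun x => (oc 0 1 x)%:C * D n x))
    (cintegral (fun x => (oc 0 1 x)%:C * cintegral f)).
  apply: (@cDCT _ _ _ (fun x => oc 0 1 x * (B + B))).
  - by move=> n; apply: cmeasM => //; exact: cmeas_oc.
  - by apply: cmeasM; [exact: cmeas_oc|exact: cmeas_cst].
  - apply: aeW => x; apply: ccvgM; first exact: ccvg_cst.
    have DE n : D n x = cintegral (fun y => (oc (x - n%:R) (x + n%:R) y)%:C * f y).
      have le : x - n%:R <= x + n%:R by rewrite lerD2l (le_trans _ (ler0n _ n))// oppr_le0.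
      by rewrite /D (Ff _ _ le) [LHS]addrC addKr.
    under [X in ccvg X]eq_fun do rewrite DE.
    rewrite (_ : cintegral f = cintegral (fun y => 1 * f y)); last first.
      by apply: eq_cintegral => y; rewrite mul1r.
    apply: (cDCT _ _ _ (cint_normc iff)).
    + by move=> n; exact: cint_cmeas.
    + by apply: cmeasM; [exact: cmeas_cst|exact: cint_cmeas].
    + apply: aeW => y; apply: ccvgM; last exact: ccvg_cst.
      apply: (@ccvg_real _ _ 1); apply: cvg_near_cst; near=> n.
      have : `|y - x| < n%:R by near: n; exact: nbhs_infty_gtr.
      by rewrite ltr_distl ocE => /andP[-> /ltW ->].
    + by move=> n y; rewrite normcM ler_piMl ?normc_ge0 ?normc_oc_le1.
  - by under [X in rint X]eq_fun do rewrite mulrC; apply: rintZ; exact: rint_oc.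
  - move=> n x; rewrite normcM normc_real ger0_norm ?oc_ge0// ler_wpM2l ?oc_ge0//.
    by rewrite (le_trans (ler_normcB _ _))// lerD.
have shiftE (c : R) : cintegral (fun x => (oc 0 1 x)%:C * F (x + c)) =
    cintegral (fun x => (oc c (1 + c) x)%:C * F x).
  have [_ <-] := cint_shift c (cint_locint iF c (1 + c)).
  by apply: eq_cintegral => x; rewrite !ocE ltrDr lerD2r.
(* The integral of an integrable function over a unit interval that escapes to infinity tends to
   0. *)
have lim0 (c : nat -> R) : (forall x, \forall n \near \oo, oc (c n) (1 + c n) x = 0) ->
    ccvg (fun n => cintegral (fun x => (oc (c n) (1 + c n) x)%:C * F x)) 0.
  move=> cn; rewrite [X in ccvg _ X](_ : _ = cintegral (fun x => 0 * F x)); last first.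
    by under [RHS]eq_cintegral do rewrite mul0r; rewrite cintegral0.
  apply: (cDCT _ _ _ (cint_normc iF)).
  + by move=> n; apply: cmeasM => //; exact: cmeas_oc.
  + by apply: cmeasM => //; exact: cmeas_cst.
  + apply: aeW => y; apply: ccvgM; last exact: ccvg_cst.
    by apply: (@ccvg_real _ _ 0); apply: cvg_near_cst.
  + by move=> n y; rewrite normcM ler_piMl ?normc_ge0 ?normc_oc_le1.
have lim2 : ccvg (fun n => cintegral (fun x => (oc 0 1 x)%:C * D n x)) (0 - 0).
  have E n : cintegral (fun x => (oc 0 1 x)%:C * D n x) =
      cintegral (fun x => (oc n%:R (1 + n%:R) x)%:C * F x) +
      - cintegral (fun x => (oc (- n%:R) (1 + - n%:R) x)%:C * F x).
    rewrite -!shiftE -cintegralB; last 2 first.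
    - under [X in cint X]eq_fun do rewrite mulrC.
      apply: (@cint_bounded _ _ _ 1); [by have [] := cint_shift n%:R iF|exact: cmeas_oc|].
      by move=> x; exact: normc_oc_le1.
    - under [X in cint X]eq_fun do rewrite mulrC.
      apply: (@cint_bounded _ _ _ 1); [by have [] := cint_shift (- n%:R) iF|exact: cmeas_oc|].
      by move=> x; exact: normc_oc_le1.
    by apply: eq_cintegral => x; rewrite mulrBr.
  under [X in ccvg X]eq_fun do rewrite E.
  apply: ccvgD; last apply: ccvgN; apply: lim0 => x; near=> n.
  - have xn : x < n%:R by near: n; exact: nbhs_infty_gtr.
    by rewrite ocE ltNge (ltW xn).
  - have xn : 1 - x < n%:R by near: n; exact: nbhs_infty_gtr.
    by rewrite ocE (leNgt x) ltrBlDr -ltrBlDl xn andbF.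
have := ccvg_unique lim1 lim2; rewrite subr0.
under eq_cintegral do rewrite mulrC.
rewrite cintegralZ; last by apply: cint_real; exact: rint_oc.
suff -> : cintegral (fun x => (oc 0 1 x)%:C : C) = 1 by rewrite mulr1.
rewrite cintegral_real; congr (_%:C).
exact: Rintegral_indic01.
Unshelve. all: by end_near. Qed.

Lemma oc_out a b x : b <= a -> oc a b x = 0.
Proof. by move=> ba; rewrite ocE; have [//|ax] := leP x a; rewrite leNgt (le_lt_trans ba ax). Qed.

(** The signed integral from 0 to [x]: one of the two terms is zero, according to the sign of
    [x]. *)
Definition antideriv g x : C := cintegral (fun y => (oc 0 x y)%:C * g y) -
                                cintegral (fun y => (oc x 0 y)%:C * g y).

Lemma antideriv_primitive g : locint g -> primitive (antideriv g) g.
Proof.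
move=> lg; split=> // a b ab; rewrite /antideriv -!cintegralB// -cintegralD//; last exact: cintB.
apply: eq_cintegral => x; rewrite -!mulrBl -mulrDl -!rmorphB -rmorphD /=; congr (_%:C * _).
have [a0|/ltW a0] := leP 0 a.
  by rewrite (oc_cat _ a0 ab) (oc_out _ a0) (oc_out _ (le_trans a0 ab)); ring.
have [b0|/ltW b0] := leP b 0.
  by rewrite (oc_cat _ ab b0) (oc_out _ a0) (oc_out _ b0); ring.
by rewrite (oc_cat _ a0 b0) (oc_out _ a0) (oc_out _ b0); ring.
Qed.

Lemma primitive_locint F g : primitive F g -> locint F.
Proof.
move=> pF; have l1 : locint (fun=> 1 : C).
  by move=> a b; under [X in cint X]eq_fun do rewrite mulr1; apply: cint_real; exact: rint_oc.
have := locint_mul_primitive pF l1 (cmeas_cst _ _).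
by under [X in locint X]eq_fun do rewrite mulr1.
Qed.

Lemma locintB g h : locint g -> locint h -> locint (fun x => g x - h x).
Proof.
by move=> lg lh a b; under [X in cint X]eq_fun do rewrite mulrBr; exact: cintB.
Qed.

Lemma cint_locint_compact h phi (M : R) : locint h -> continuous phi ->
  (forall x, M <= `|x| -> phi x = 0) -> cint (fun x => h x * (phi x)%:C).
Proof.
move=> lh cphi s; have [B B0 phiB] := bounded_continuous_compact cphi s.
have -> : (fun x => h x * (phi x)%:C) = (fun x => (oc (- M) M x)%:C * h x * (phi x)%:C).
  apply/funext => x; have [/s ->|xM] := leP M `|x|; first by rewrite !mulr0.
  by move: xM; rewrite ltr_norml ocE => /andP[-> /ltW ->]; rewrite mul1r.
apply: (@cint_bounded _ _ _ B) => //.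
  by apply: cmeas_real; exact: continuous_measurable_fun.
by move=> x; rewrite normc_real.
Qed.

Lemma cint_locint_test h phi : locint h -> test_function setT phi ->
  cint (fun x => h x * (phi x)%:C) /\ cint (fun x => h x * (phi^`()%classic x)%:C).
Proof.
move=> lh /test_function_facts[M [M0 s s' d c]].
by split; [apply: (@cint_locint_compact _ _ M) => //; exact: is_derive_continuous d
          |exact: (@cint_locint_compact _ _ M)].
Qed.

Lemma primitive_test G g phi : primitive G g -> cmeas g -> test_function setT phi ->
  cintegral (fun x => G x * (phi^`()%classic x)%:C) = - cintegral (fun x => g x * (phi x)%:C).
Proof.
move=> pG mg tphi; have [M [M0 s s' d c]] := test_function_facts tphi.
have cphi := is_derive_continuous d.
have pphi : primitive (fun x => (phi x)%:C) (fun x => (phi^`()%classic x)%:C).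
  by apply: primitive_C1 => //=; [move=> x; exact: is_derive_cst|move=> x; exact: cvg_cst].
have [lg _] := pG; have [i1 _] := cint_locint_test lg tphi.
have [i2 i3] := cint_locint_test (primitive_locint pG) tphi.
have mphi' : cmeas (fun x => (phi^`()%classic x)%:C : C).
  by apply: cmeas_real; exact: continuous_measurable_fun.
have E x : (phi x)%:C * g x + G x * (phi^`()%classic x)%:C =
   g x * (phi x)%:C + G x * (phi^`()%classic x)%:C by rewrite mulrC.
have := cintegral_deriv_eq0 (primitiveM pG pphi mg mphi') i2.
under [X in cint X -> _]eq_fun do rewrite E.
under eq_cintegral do rewrite E.
move=> /(_ (cintD i1 i3)); rewrite cintegralD// => /eqP.
by rewrite addr_eq0 => /eqP ->; rewrite opprK.
Qed.

(** Otherwise the limit, the length of []0, 1[], would be 0. Such a bump is the reference function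
    that corrects the mean of a test function. *)
Lemma Rintegral_bump_neq0 : exists n, \int[mu]_x bump (0 : R) 1 n x != 0.
Proof.
apply: contrapT => /forallNP n0.
have lim : (fun n => \int[mu]_x bump (0 : R) 1 n x) @ \oo --> \int[mu]_x (\1_`]0, 1[ x : R).
  apply: (@rDCT _ _ _ (\1_`[0, 1])).
  - by move=> n; apply: continuous_measurable_fun; apply: smooth_continuous; exact: smooth_bump.
  - exact: measurable_indic.
  - by apply: aeW => x; exact: cvg_bump.
  - exact: integrable_indic_itv.
  - move=> n x; rewrite ger0_norm ?bump_ge0//.
    have [/bump_supp/andP[ay yb]|] := boolP (bump 0 1 n x != 0); last first.
      by rewrite negbK => /eqP ->; rewrite indicE ler0n.
    by rewrite indicE mem_set/= ?bump_le1// in_itv/= !ltW.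
have : \int[mu]_x (\1_`]0, 1[ x : R) = 0.
  apply: (cvg_seq_unique lim).
  have E n : \int[mu]_x bump (0 : R) 1 n x = 0.
    by apply/eqP; rewrite -[_ == _]negbK; apply/negP; exact: n0.
  by under eq_cvg do rewrite E; exact: cvg_cst.
by rewrite Rintegral_indic01 => /eqP; rewrite oner_eq0.
Qed.

(** The integral from [-oo] vanishes to the left of [a] by the support condition and to the right of
    [b] by the zero mean, hence has compact support. *)
Lemma smooth_mean0_primitive phi a b : smooth phi ->
  (forall x, phi x != 0 -> a <= x <= b) -> \int[mu]_x phi x = 0 ->
  exists2 Phi, test_function setT Phi & Phi^`()%classic = phi.
Proof.
move=> sphi supp phi0; have cphi := smooth_continuous sphi.
have iphi : rint phi.
  apply: (@rint_continuous_compact _ _ (`|a| + `|b| + 1)) => // x xM.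
  apply/eqP; rewrite -[_ == _]negbK; apply/negP => /supp/andP[ax xb].
  move: xM; rewrite leNgt => /negP; apply; rewrite ltr_norml; apply/andP; split.
    by have := ler_norm (- a); rewrite normrN => ha; have := normr_ge0 b => hb; lra.
  by have := ler_norm b => ha; have := normr_ge0 a => hb; lra.
pose Phi x := \int[mu]_(t in `]-oo, x]) phi t.
have dPhi (x : R) : is_derive x 1 Phi (phi x).
  have [d e] : derivable Phi x 1 /\ Phi^`()%classic x = phi x.
    apply: (@continuous_FTC1 _ phi -oo%O x (x + 1)); rewrite ?ltrDl//.
      by apply: (integrableS _ _ _ iphi).
    exact: ltNyr.
    exact: cphi.
  by split; [exact: d|rewrite -derive1E e].
exists Phi; last by apply/funext => x; rewrite derive1E; exact: derive_val.
have PhiE x : Phi x = \int[mu]_t (phi \_ `]-oo, x]) t by rewrite Rintegral_patch.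
apply: (@smooth_test_function _ _ _ a b) => //; first exact: smooth_primitive dPhi.
move=> x; rewrite PhiE; apply: contraR; rewrite negb_and -!ltNge => /orP[xa|bx].
  rewrite -[X in _ == X]Rintegral0; apply/eqP; apply: eq_Rintegral => t _.
  rewrite patchE; case: ifPn => // /set_mem; rewrite /= in_itv/= => tx.
  apply/eqP; rewrite -[_ == _]negbK; apply/negP => /supp/andP[].
  by rewrite leNgt (le_lt_trans tx xa).
rewrite -[X in _ == X]phi0; apply/eqP; apply: eq_Rintegral => t _.
rewrite patchE; case: ifPn => // /negP tx.
apply/esym/eqP; rewrite -[_ == _]negbK; apply/negP => /supp/andP[_ tb]; apply: tx.
by apply: mem_set; rewrite /= in_itv/= (le_trans tb) ?ltW.
Qed.

(* The lemma of du Bois-Reymond. *)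
Lemma weak_derivative_primitive f g : L2 f -> L2 g -> weak_derivative f g ->
  exists2 F, primitive F g & f = F %[ae mu].
Proof.
move=> lf lg wfg; have llg := L2_locint lg.
pose G := antideriv g; have pG : primitive G g by exact: antideriv_primitive.
(* [r] has weak derivative 0; it remains to see that it is constant almost everywhere. *)
pose r x := f x - G x.
have lr : locint r by apply: locintB; [exact: L2_locint|exact: primitive_locint pG].
have mr : cmeas r by apply: cmeasB; [exact: L2_cmeas|exact: primitive_cmeas pG].
have r0 phi : test_function setT phi -> cintegral (fun x => r x * (phi^`()%classic x)%:C) = 0.
  move=> tphi; have [_ i1] := cint_locint_test (L2_locint lf) tphi.
  have [_ i2] := cint_locint_test (primitive_locint pG) tphi.
  under eq_cintegral do rewrite mulrBl.
  by rewrite cintegralB// wfg// (primitive_test pG)// ?subrr//; exact: L2_cmeas.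
have [n0 I0] := Rintegral_bump_neq0.
pose rho := bump (0 : R) 1 n0; pose I := \int[mu]_x rho x.
have trho a b n : test_function setT (bump (a : R) b n) by exact: bump_test_function.
(* The constant sought: the average of [r] weighted by [rho]. *)
pose k := cintegral (fun x => r x * (rho x)%:C) / I%:C.
have rk (a b : R) n : cintegral (fun x => r x * (bump a b n x)%:C) =
    k * (\int[mu]_x bump a b n x)%:C.
  (* With this [al] the function [psi - al * rho] has mean 0, so it is the derivative of a test
     function and [r] integrates to 0 against it. *)
  pose psi := bump a b n; pose al := (\int[mu]_x psi x) / I.
  have [ipsi _] := test_function_rint (trho a b n).
  have [irho _] := test_function_rint (trho 0 1 n0).
  have [irpsi _] := cint_locint_test lr (trho a b n).
  have [irrho _] := cint_locint_test lr (trho 0 1 n0).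
  have [||| Phi tPhi dPhi] := @smooth_mean0_primitive (fun x => psi x + (- al) * rho x)
     (Num.min a 0) (Num.max b 1).
  - apply: smoothD; first exact: smooth_bump.
    by apply: smoothM; [exact: smooth_cst|exact: smooth_bump].
  - move=> x; have [/eqP|/bump_supp/andP[ax xb _]] := eqVneq (psi x) 0; last first.
      by rewrite ge_min le_max (ltW ax) (ltW xb).
    move=> /eqP ->; rewrite add0r mulf_eq0 negb_or => /andP[_ /bump_supp/andP[ax xb]].
    by rewrite ge_min le_max (ltW ax) (ltW xb) !orbT.
  - rewrite RintegralD//; last exact: rintZ.
    by rewrite RintegralZl// -/I /al mulNr mulfVK ?subrr.
  have := r0 _ tPhi; rewrite dPhi.
  have E x : r x * (psi x + - al * rho x)%:C =
      r x * (psi x)%:C + (- al)%:C * (r x * (rho x)%:C).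
    by rewrite (rmorphD _ (psi x)) (rmorphM _ (- al)) mulrDr mulrCA.
  under eq_cintegral do rewrite E.
  rewrite cintegralD//; last exact: cintZ.
  rewrite cintegralZ// => /eqP; rewrite addr_eq0 => /eqP ->.
  rewrite /k /al rmorphN rmorphM /= fmorphV; ring.
pose h x := r x - k.
have mh : cmeas h by apply: cmeasB => //; exact: cmeas_cst.
have lh : locint h by apply: locintB => //; exact: primitive_locint (primitive_cst k).
have aen (n : nat) : {ae mu, forall x, - n%:R < x < n%:R -> h x = 0}.
  apply: ae_eq0_bump => //.
    have -> : (fun y => (\1_(`](- n%:R), n%:R[%classic) y)%:C * h y) =
        (fun y => (oc (- n%:R) n%:R y)%:C * h y * (\1_(`](- n%:R), n%:R[%classic) y)%:C).
      apply/funext => y; rewrite indicE; have [|_] := boolP (y \in _); last by rewrite mul0r mulr0.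
      by move=> /set_mem; rewrite /= in_itv/= ocE => /andP[-> /ltW ->]; rewrite mulr1.
    apply: (@cint_bounded _ _ _ 1) => //; first by apply: cmeas_real; exact: measurable_indic.
    by move=> y; rewrite indicE normc_real normr_nat lern1 leq_b1.
  move=> x m _; have [i _] := cint_locint_test lr (trho (- n%:R) x m).
  have [ib _] := test_function_rint (trho (- n%:R) x m).
  under eq_cintegral do rewrite mulrC mulrBl.
  rewrite cintegralB//; last by apply: cintZ; exact: cint_real.
  by rewrite rk cintegralZ ?cintegral_real ?subrr//; exact: cint_real.
exists (fun x => G x - (- k)).
  have := primitiveB pG (primitive_cst (- k)).
  by under [X in primitive _ X]eq_fun do rewrite subr0.
have := ae_foralln aen; apply: ae_imp => x Hx _.
have := Hx _ (ltr_Ntruncn x); rewrite /h /r => /eqP; rewrite subr_eq0 => /eqP <-.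
by rewrite opprK addrC subrK.
Qed.

End AbsolutelyContinuous.

(** * Poisson integrals, and products in the Hardy space *)

Section HardyProducts.
Context {R : realType}.
Local Notation C := R[i].
Local Notation Re := (@complex.Re R).
Local Notation Im := (@complex.Im R).
Local Notation mu := (@lebesgue_measure R).
Implicit Types (f g h F G w : R -> C) (a b c s x y : R).

Lemma primitive_ker y : y != 0 -> primitive (ker y) (fun x => 'i * ker y x ^+ 2).
Proof.
move=> y0; have d0 x : y ^+ 2 + x ^+ 2 != 0 by rewrite gt_eqF// ker_den_gt0.
have dV (x : R) : is_derive x 1 (fun x => (y ^+ 2 + x ^+ 2)^-1)
    (- (y ^+ 2 + x ^+ 2)^-1 ^+ 2 * (x * 1 + x * 1)).
  have dsq : is_derive x 1 (fun x => x ^+ 2) (x * 1 + x * 1) :=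
    is_derive_fctM (is_derive_id x 1) (is_derive_id x 1).
  have dsum : is_derive x 1 (fun x => y ^+ 2 + x ^+ 2) (x * 1 + x * 1).
    by rewrite -[X in is_derive _ _ _ X]add0r; exact: is_derive_fctD.
  exact: (@is_derive_fct_comp _ (fun z => z^-1) (fun x => y ^+ 2 + x ^+ 2) _ _ _
    (is_derive_fctV (d0 x)) dsum).
have dr (x : R) : is_derive x 1 (fun x => Re (ker y x)) (Re ('i * ker y x ^+ 2)).
  under [X in is_derive _ _ X]eq_fun do rewrite Re_ker.
  have := is_derive_fctZ y (dV x); congr (is_derive _ _ _ _).
  rewrite expr2 !cReImE Re_ker Im_ker /=; move: (d0 x) => ?; field.
  by [].
have di (x : R) : is_derive x 1 (fun x => Im (ker y x)) (Im ('i * ker y x ^+ 2)).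
  under [X in is_derive _ _ X]eq_fun do rewrite Im_ker.
  have := is_derive_fctM (is_derive_id x 1) (dV x); congr (is_derive _ _ _ _).
  rewrite expr2 !cReImE Re_ker Im_ker /=; move: (d0 x) => ?; field.
  by [].
have cr := is_derive_continuous dr; have ci := is_derive_continuous di.
apply: primitive_C1 => // x.
- rewrite (_ : (fun _ => _) = (fun x => - (2 * (Re (ker y x) * Im (ker y x))))); last first.
    by apply/funext => z; rewrite expr2 !cReImE /=; ring.
  by apply: cvgN; apply: cvgM; [exact: cvg_cst|apply: cvgM; [exact: cr|exact: ci]].
- rewrite (_ : (fun _ => _) =
    (fun x => Re (ker y x) * Re (ker y x) - Im (ker y x) * Im (ker y x))); last first.
    by apply/funext => z; rewrite expr2 !cReImE /=; ring.
  by apply: cvgB; apply: cvgM; first [exact: cr|exact: ci].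
Qed.

Definition seq_continuous F := forall (u : nat -> R) x, u @ \oo --> x ->
  ccvg (fun n => F (u n)) (F x).

Lemma seq_continuous_cmeas F : seq_continuous F -> cmeas F.
Proof.
move=> cF; split; apply: continuous_measurable_fun => x;
  apply: sequential_continuous => u ux.
- by case: (cF _ _ ux).
- by case: (cF _ _ ux).
Qed.

Lemma seq_continuousM F G : seq_continuous F -> seq_continuous G ->
  seq_continuous (fun x => F x * G x).
Proof. by move=> cF cG u x ux; apply: ccvgM; [exact: cF|exact: cG]. Qed.

(** Moving the pole parallel to the real line multiplies each character in the Laplace expansion by
    a constant of modulus 1, so [hardy_cis] still annihilates every term. *)
Lemma hardy_ker_shift f a s z : 0 < a -> 0 < s -> hardy f ->
  cintegral (fun x => f x * ker a x * ker s (x - z)) = 0.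
Proof.
move=> a0 s0 hf; have [lf _] := hf; have a_neq0 : a != 0 by rewrite gt_eqF.
have ig := cint_L2_ker lf a_neq0.
transitivity (cintegral (fun x => f x * ker a x *
    cintegral (fun y => (half_exp s y)%:C * cis (y * (x - z))))).
  by apply: eq_cintegral => x; rewrite laplace_cis.
rewrite (@cFubini _ _ _ (fun p : R * R => cis (p.2 * (p.1 - z))) 1)//; last 3 first.
- by apply: cint_real; exact: rint_half_exp.
- apply: (@cmeas_comp _ _ _ _ R cis (fun p : R * R => p.2 * (p.1 - z)) (@cmeas_cis R)).
  by apply: measurable_funM => //; exact: measurable_funB.
- by move=> p; rewrite normc_cis.
rewrite -[RHS]cintegral0; apply: eq_cintegral => y.
have [y0|y0] := leP 0 y; last first.
  by rewrite /half_exp patch_out ?mul0r//= in_itv/= andbT leNgt y0.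
under eq_cintegral => x do rewrite /= mulrBr cisD mulrA [_ * cis (- _)]mulrC.
rewrite cintegralZ ?hardy_cis ?mulr0//.
apply: (@cint_bounded _ _ _ 1) => //; last by move=> x; rewrite normc_cis.
apply: (@cmeas_comp _ _ _ _ R cis (fun x => y * x) (@cmeas_cis R)).
exact: measurable_funM.
Qed.

Lemma ker_sym s x : s != 0 -> ker s x + ker s (- x) = (2 * s / (s ^+ 2 + x ^+ 2))%:C.
Proof.
move=> s0; apply: complex_eq; rewrite cReImE ?Re_ker ?Im_ker sqrrN /=; first by ring.
by rewrite mulNr subrr.
Qed.

Lemma normc_ker_gt0 s x : 0 < s -> normc (ker s x) <= s^-1.
Proof. by move=> s0; rewrite -{2}(ger0_norm (ltW s0)) normc_ker_le// gt_eqF. Qed.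

(** The substitution [z = s v + x] moves the dependence on [s] from the kernel into [F], so that for
    bounded [F] a fixed multiple of [1/(1 + v^2)] dominates as [s] tends to 0. *)
Lemma poisson_scaling F s x : cint F -> 0 < s ->
  cintegral (fun z => F z * (2 * s / (s ^+ 2 + (z - x) ^+ 2))%:C) =
  cintegral (fun v => F (s * v + x) * (2 / (1 + v ^+ 2))%:C).
Proof.
move=> iF s0; have s_neq0 : s != 0 by rewrite gt_eqF.
have mP : cmeas (fun z : R => (2 * s / (s ^+ 2 + (z - x) ^+ 2))%:C : C).
  rewrite (_ : (fun _ => _) = (fun z => ker s (z - x) + ker s (- (z - x)))).
    apply: cmeasD.
      apply: (@cmeas_comp _ _ _ _ R _ (fun z : R => z - x) (cmeas_ker s_neq0)).
      exact: measurable_funB.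
    apply: (@cmeas_comp _ _ _ _ R _ (fun z : R => - (z - x)) (cmeas_ker s_neq0)).
    by apply: measurable_funN; exact: measurable_funB.
  by apply/funext => z; rewrite ker_sym.
have iP : cint (fun z => F z * (2 * s / (s ^+ 2 + (z - x) ^+ 2))%:C).
  apply: (@cint_bounded _ _ _ (s^-1 + s^-1)) => // z.
  rewrite -ker_sym// (le_trans (ler_normcD _ _))//.
  by rewrite lerD ?normc_ker_gt0.
have [_ e] := cint_affine x s0 iP.
have sC : s%:C != 0 :> C by rewrite eq_complex /= eqxx andbT.
have : s%:C * (s^-1%:C * cintegral (fun z => F z * (2 * s / (s ^+ 2 + (z - x) ^+ 2))%:C)) =
  cintegral (fun z => F z * (2 * s / (s ^+ 2 + (z - x) ^+ 2))%:C).
  by rewrite fmorphV mulVKf.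
move=> <-; rewrite -e -cintegralZ; last by have [] := cint_affine x s0 iP.
apply: eq_cintegral => v; rewrite addrK mulrCA -rmorphM /=.
congr (_ * _%:C); have v0 : 1 + v ^+ 2 != 0 by rewrite gt_eqF// oneDsqr_gt0.
have e2 : s ^+ 2 + (s * v) ^+ 2 = s ^+ 2 * (1 + v ^+ 2) by ring.
rewrite e2; field.
by rewrite v0 s_neq0.
Qed.

(** The factor [2 pi] is the total mass of [2 / (1 + v^2)]; the arguments of [F] tend to [x] for
    each [v]. *)
Lemma poisson_limit F B : seq_continuous F -> 0 <= B -> (forall x, normc (F x) <= B) ->
  forall x, ccvg (fun n => cintegral (fun v => F (n.+1%:R^-1 * v + x) * (2 / (1 + v ^+ 2))%:C))
    ((2 * pi)%:C * F x).
Proof.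
move=> cF B0 FB x.
have mF := seq_continuous_cmeas cF.
have mP : measurable_fun setT (fun v : R => 2 / (1 + v ^+ 2)).
  by apply: measurable_funM => //; exact: rint_measurable rint_oneDsqr.
have iP : rint (fun v : R => 2 / (1 + v ^+ 2)) by apply: rintZ; exact: rint_oneDsqr.
have -> : (2 * pi)%:C * F x = cintegral (fun v => F x * (2 / (1 + v ^+ 2))%:C).
  rewrite cintegralZ; last exact: cint_real.
  by rewrite cintegral_real RintegralZl//; [rewrite Rintegral_oneDsqr mulrC|exact: rint_oneDsqr].
apply: (@cDCT _ _ _ (fun v => B * (2 / (1 + v ^+ 2)))).
- move=> n; apply: cmeasM; last exact: cmeas_real.
  apply: (@cmeas_comp _ _ _ _ R F (fun v : R => n.+1%:R^-1 * v + x)) => //.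
  by apply: measurable_funD => //; exact: measurable_funM.
- by apply: cmeasM; [exact: cmeas_cst|exact: cmeas_real].
- apply: aeW => v; apply: ccvgM; last exact: ccvg_cst.
  apply: cF; rewrite -[X in _ --> X]add0r; apply: cvgD; last exact: cvg_cst.
  rewrite -[X in _ --> X](mul0r v); apply: cvgM; last exact: cvg_cst.
  exact: cvg_harmonic.
- exact: rintZ.
- move=> n v; rewrite normcM normc_real ger0_norm; last first.
    by rewrite mulr_ge0// invr_ge0 ltW// oneDsqr_gt0.
  by rewrite ler_wpM2r// mulr_ge0// invr_ge0 ltW// oneDsqr_gt0.
Qed.

(* [ker s (z - x) + ker s (x - z)] is a Poisson kernel: testing [f] against the
   first summand and [w] against the second gives 0. *)
Lemma hardy_mul_ker f w B a b : hardy f -> hardy w -> seq_continuous f ->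
  0 <= B -> (forall x, normc (f x) <= B) -> 0 < a -> 0 < b ->
  cintegral (fun x => f x * ker a x * (w x * ker b x)) = 0.
Proof.
move=> hf hw cf B0 fB a0 b0; have [lf _] := hf; have [lw _] := hw.
have a_neq0 : a != 0 by rewrite gt_eqF.
have b_neq0 : b != 0 by rewrite gt_eqF.
pose p x := f x * ker a x; pose q x := w x * ker b x.
have ip : cint p by exact: cint_L2_ker.
have iq : cint q by exact: cint_L2_ker.
have cp : seq_continuous p.
  by apply: seq_continuousM => // u x; exact: primitive_ccvg (primitive_ker a_neq0).
pose Bp := B * a^-1.
have Bp0 : 0 <= Bp by rewrite mulr_ge0// invr_ge0 ltW.
have pB x : normc (p x) <= Bp.
  by rewrite normcM ler_pM ?normc_ge0 ?normc_ker_gt0.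
have zero s : 0 < s ->
    cintegral (fun x => q x * cintegral (fun v => p (s * v + x) * (2 / (1 + v ^+ 2))%:C)) = 0.
  move=> s0; have s_neq0 : s != 0 by rewrite gt_eqF.
  have mk (r : R -> R) : measurable_fun setT r -> cmeas (fun z => ker s (r z)).
    by move=> mr; apply: (@cmeas_comp _ _ _ _ R _ r (cmeas_ker s_neq0)).
  transitivity (cintegral (fun x => q x * cintegral (fun z => p z * ker s (x - z)))).
    apply: eq_cintegral => x; congr (_ * _); rewrite -poisson_scaling//.
    under eq_cintegral do rewrite -ker_sym// mulrDr opprB.
    rewrite cintegralD; first by rewrite hardy_ker_shift// add0r.
    - apply: (@cint_bounded _ _ _ s^-1) => //; last by move=> z; exact: normc_ker_gt0.
      by apply: mk; exact: measurable_funB.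
    - apply: (@cint_bounded _ _ _ s^-1) => //; last by move=> z; exact: normc_ker_gt0.
      by apply: mk; exact: measurable_funB.
  rewrite (@cFubini _ _ _ (fun z : R * R => ker s (z.1 - z.2)) s^-1)//.
  - rewrite -[RHS]cintegral0; apply: eq_cintegral => z /=.
    by rewrite hardy_ker_shift ?mulr0.
  - apply: (@cmeas_comp _ _ _ _ R _ (fun z : R * R => z.1 - z.2) (cmeas_ker s_neq0)).
    exact: measurable_funB.
  - by move=> z; exact: normc_ker_gt0.
have mP : measurable_fun setT (fun v : R => 2 / (1 + v ^+ 2)).
  by apply: measurable_funM => //; exact: rint_measurable rint_oneDsqr.
have iP : rint (fun v : R => 2 / (1 + v ^+ 2)) by apply: rintZ; exact: rint_oneDsqr.
have P0 v : 0 <= 2 / (1 + v ^+ 2) :> R by rewrite mulr_ge0// invr_ge0 ltW// oneDsqr_gt0.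
(* [2 pi] times the Poisson integral of [p] at height [1/(n+1)]. It is bounded uniformly in [n] and
   tends to [2 pi * p], so the zero integrals against [q] pass to the limit. *)
pose A n x := cintegral (fun v => p (n.+1%:R^-1 * v + x) * (2 / (1 + v ^+ 2))%:C).
have mp n x : cmeas (fun v : R => p (n.+1%:R^-1 * v + x) * (2 / (1 + v ^+ 2))%:C).
  apply: cmeasM; last exact: cmeas_real.
  apply: (@cmeas_comp _ _ _ _ R p (fun v : R => n.+1%:R^-1 * v + x)).
    exact: seq_continuous_cmeas.
  by apply: measurable_funD => //; exact: measurable_funM.
have bp n x v : normc (p (n.+1%:R^-1 * v + x) * (2 / (1 + v ^+ 2))%:C) <=
    Bp * (2 / (1 + v ^+ 2)).
  by rewrite normcM normc_real ger0_norm// ler_wpM2r.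
have mA n : cmeas (A n).
  apply: seq_continuous_cmeas => u x ux.
  apply: (@cDCT _ _ _ (fun v => Bp * (2 / (1 + v ^+ 2)))) => //; last exact: rintZ.
  apply: aeW => v; apply: ccvgM; last exact: ccvg_cst.
  by apply: cp; apply: cvgD => //; exact: cvg_cst.
pose M := 2 * \int[mu]_v (Bp * (2 / (1 + v ^+ 2))).
have AM n x : normc (A n x) <= M.
  have i1 : cint (fun v : R => p (n.+1%:R^-1 * v + x) * (2 / (1 + v ^+ 2))%:C).
    by apply: cint_le (bp n x) => //; exact: rintZ.
  rewrite (le_trans (normc_cintegral_le i1))// ler_wpM2l//.
  by apply: le_Rintegral => //; [exact: cint_normc|exact: rintZ].
have lim : ccvg (fun n => cintegral (fun x => q x * A n x))
    (cintegral (fun x => q x * ((2 * pi)%:C * p x))).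
  apply: (@cDCT _ _ _ (fun x => M * normc (q x))).
  - by move=> n; apply: cmeasM => //; exact: cint_cmeas.
  - by apply: cmeasM; [|apply: cmeasZ]; exact: cint_cmeas.
  - apply: aeW => x; apply: ccvgM; first exact: ccvg_cst.
    exact: (poisson_limit cp Bp0 pB).
  - by apply: rintZ; exact: cint_normc.
  - by move=> n x; rewrite normcM mulrC ler_wpM2r ?normc_ge0.
have : cintegral (fun x => q x * ((2 * pi)%:C * p x)) = 0.
  apply: (ccvg_unique lim).
  have E n : cintegral (fun x => q x * A n x) = 0 by apply: zero; rewrite invr_gt0 ltr0n.
  by under [X in ccvg X]eq_fun do rewrite E; exact: ccvg_cst.
under eq_cintegral do rewrite mulrCA.
rewrite cintegralZ; last by apply: (@cint_bounded _ _ _ Bp) => //; exact: cint_cmeas.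
move/eqP; rewrite mulf_eq0 => /orP[|/eqP].
  by rewrite eq_complex /= eqxx andbT mulf_eq0 pnatr_eq0 /= gt_eqF// pi_gt0.
by under eq_cintegral do rewrite mulrC.
Qed.

Lemma hardyM f w B : hardy f -> hardy w -> seq_continuous f ->
  0 <= B -> (forall x, normc (f x) <= B) -> hardy (fun x => f x * w x).
Proof.
move=> hf hw cf B0 fB; have [lf _] := hf; have [lw _] := hw.
have lfw : L2 (fun x => f x * w x).
  under [X in L2 X]eq_fun do rewrite mulrC.
  by apply: (@L2_bounded _ _ _ B) => //; exact: L2_cmeas.
split=> // s s0; have s_neq0 : s != 0 by rewrite gt_eqF.
apply: ker_removal; first exact: cint_L2_ker.
move=> t t0; rewrite -(hardy_mul_ker hf hw cf B0 fB t0 s0).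
by apply: eq_cintegral => x; ring.
Qed.

End HardyProducts.

(** * The eigenvalue equation, its symmetry and the norm identity *)

Section Eigenpairs.
Context {R : realType}.
Local Notation C := R[i].
Local Notation Re := (@complex.Re R).
Local Notation Im := (@complex.Im R).
Local Notation mu := (@lebesgue_measure R).
Implicit Types (f g h F G U u w df psi : R -> C) (lam : C) (x y : R).

Lemma conjc_i : ('i : C)^*%C = - 'i.
Proof. by apply: complex_eq; rewrite ?cReImE /= ?oppr0. Qed.

Lemma conjcM (z z' : C) : (z * z')^*%C = z^*%C * z'^*%C.
Proof. exact: rmorphM. Qed.

Lemma conjcD (z z' : C) : (z + z')^*%C = z^*%C + z'^*%C.
Proof. exact: rmorphD. Qed.

Lemma conjcB (z z' : C) : (z - z')^*%C = z^*%C - z'^*%C.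
Proof. exact: rmorphB. Qed.

Lemma mulcii : 'i * 'i = -1 :> C.
Proof. by apply: complex_eq; rewrite !cReImE /=; ring. Qed.

Lemma hardy_ae f g : hardy f -> cmeas g -> f = g %[ae mu] -> hardy g.
Proof.
move=> [lf fs] mg fg; have lg := L2_ae lf mg fg; split=> // s s0.
have s_neq0 : s != 0 by rewrite gt_eqF.
rewrite -(fs s s0); apply: cintegral_ae.
- by apply: cmeasM => //; exact: cmeas_ker.
- by apply: cmeasM; [exact: L2_cmeas|exact: cmeas_ker].
- by apply: (ae_imp _ fg) => x /(_ I) /= ->.
Qed.

Lemma hardyB f g : hardy f -> hardy g -> hardy (fun x => f x - g x).
Proof.
move=> hf hg; under [X in hardy X]eq_fun do rewrite -mulN1r.
by apply: hardyD => //; exact: hardyZ.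
Qed.

(** [|F|^2] is absolutely continuous with integrable density, hence bounded: the embedding of [H^1]
    into the bounded functions. *)
Lemma primitive_L2_bounded F f : primitive F f -> L2 F -> L2 f ->
  exists2 B, 0 <= B & forall x, normc (F x) <= B.
Proof.
move=> pF lF lf; have mf := L2_cmeas lf.
have [|B B0 FB] := primitive_bounded (primitiveM pF (primitiveJ pF) mf (cmeasJ mf)).
  by apply: cintD; apply: L2_mul => //; exact: L2J.
(* [B] bounds the square of the modulus, and [t^2 <= B] implies [t <= 1 + B]. *)
exists (1 + B) => [|x]; first by rewrite addr_ge0.
have := FB x; rewrite normcM normcJ; have := normc_ge0 (F x).
by move: (normc _) => t t0 tB; nra.
Qed.

Lemma L2p_primitive f g : L2p f -> L2 g -> weak_derivative f g ->
  exists F, [/\ primitive F g, hardy F & f = F %[ae mu]].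
Proof.
move=> pf lg wfg; have hf := L2p_hardy pf; have [lf _] := hf.
have [F pF fF] := weak_derivative_primitive lf lg wfg; exists F; split=> //.
by apply: (hardy_ae hf) => //; exact: primitive_cmeas pF.
Qed.

Lemma inner_eq0 f : L2 f -> inner f f = 0 -> f = (fun=> 0) %[ae mu].
Proof. by move=> lf; rewrite inner_self => -[f0]; exact: L2norm_eq0. Qed.

(** The difference of [f'] and the projection lies in the Hardy space and is orthogonal to it, in
    particular to itself. *)
Lemma hardy_proj_id f f' g : hardy_proj f g -> f = f' %[ae mu] -> hardy f' ->
  g = f' %[ae mu].
Proof.
move=> [lf pg orth] ff' hf'; have hg := L2p_hardy pg.
have [lg _] := hg; have [lf' _] := hf'; have hd := hardyB hf' hg; have [ld _] := hd.
have : inner (fun x => f' x - g x) (fun x => f' x - g x) = 0.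
  rewrite -(orth _ (hardy_L2p hd)); apply: inner_ae => //; first exact: L2B.
    by apply: (ae_imp _ ff') => x /(_ I) /= ->.
  exact: aeW.
move/(inner_eq0 ld); apply: ae_imp => x /(_ I)/eqP; rewrite subr_eq0 => /eqP ->.
by [].
Qed.

(* As [U * w] already lies in the Hardy space, the equation
   [- i F' - T_U T_{\bar U} F = lam F] reads as below. *)
Definition eigenpair U lam F w df :=
  [/\ hardy F, primitive F df, L2 df, hardy w &
      df = (fun x => 'i * (lam * F x + U x * w x)) %[ae mu]] /\
  forall h, hardy h -> inner (fun x => (U x)^*%C * F x - w x) h = 0.

(** Passes from the almost-everywhere data of [lax] to representatives on which calculus is
    possible. The outer Toeplitz projection disappears because [hardyM] places [U w] in the Hardy
    space. *)
Lemma lax_eigenpair u U B lam psi : u = U %[ae mu] ->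
  hardy U -> seq_continuous U -> 0 <= B -> (forall x, normc (U x) <= B) ->
  lax_eigenspace u lam psi ->
  exists F w df, eigenpair U lam F w df /\ psi = F %[ae mu].
Proof.
move=> uU hU cU B0 UB [Df [w [q [[_ [df [ldf wdf Dfdf]]] [ppsi proj1] [_ proj2] eqn]]]].
have [F [pF hF psiF]] := L2p_primitive ppsi ldf wdf.
have [lF _] := hF; have [lpsi _] := ppsi.
have [lupsi pw orth] := proj1; have hw := L2p_hardy pw; have [lw _] := hw.
have hUw := hardyM hU hw cU B0 UB.
have qUw : q = (fun x => U x * w x) %[ae mu].
  by apply: (hardy_proj_id proj2) => //; apply: (ae_imp _ uU) => x /(_ I) /= ->.
exists F, w, df; split=> //; split.
  split=> //; apply: (ae_imp2 _ (ae_imp2 _ Dfdf psiF) (ae_imp2 _ qUw eqn)); last 2 first.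
  - by move=> x a b; exact: (conj a b).
  - by move=> x a b; exact: (conj a b).
  move=> x [/(_ I) e1 /(_ I) e2] [/(_ I) e3 /(_ I) e4] _.
  move: e4; rewrite -e2 e1 e3 => ->.
  by rewrite subrK mulNr mulrN mulrA mulcii mulN1r opprK.
move=> h hh; rewrite -(orth _ (hardy_L2p hh)); have [lh _] := hh.
have lUF : L2 (fun x => (U x)^*%C * F x).
  under [X in L2 X]eq_fun do rewrite mulrC.
  apply: (@L2_bounded _ _ _ B) => //; first by apply: cmeasJ; exact: seq_continuous_cmeas.
  by move=> x; rewrite normcJ.
apply: inner_ae => //; try exact: L2B.
  by apply: (ae_imp2 _ uU psiF) => x /(_ I) /= -> /(_ I) /= ->.
exact: aeW.
Qed.

(** Integrability is bundled in so that linear combinations stay in the class. *)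
Definition null f := cint f /\ cintegral f = 0.

Lemma nullD f g : null f -> null g -> null (fun x => f x + g x).
Proof. by move=> [jf f0] [jg g0]; split; [exact: cintD|rewrite cintegralD// f0 g0 addr0]. Qed.

Lemma nullB f g : null f -> null g -> null (fun x => f x - g x).
Proof. by move=> [jf f0] [jg g0]; split; [exact: cintB|rewrite cintegralB// f0 g0 subr0]. Qed.

Lemma nullZ (c : C) f : null f -> null (fun x => c * f x).
Proof. by move=> [jf f0]; split; [exact: cintZ|rewrite cintegralZ// f0 mulr0]. Qed.

Lemma nullJ f : null f -> null (fun x => (f x)^*%C).
Proof. by move=> [jf f0]; split; [exact: cintJ|rewrite cintegralJ// f0 conjc0]. Qed.

Lemma null_ker h y : 0 < y -> hardy h -> null (fun x => h x * ker y x).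
Proof. by move=> y0 [lh h0]; split; [apply: cint_L2_ker => //; rewrite gt_eqF|exact: h0]. Qed.

Lemma null_conj_ker h y : 0 < y -> hardy h -> null (fun x => (h x)^*%C * ker (- y) x).
Proof.
move=> y0 hh; have := nullZ (-1) (nullJ (null_ker y0 hh)); congr null.
by apply/funext => x; rewrite conjcM kerJ mulrN mulN1r opprK.
Qed.

(** The derivative of [F \bar{F'}] has integral 0, which is the symmetry of [D]. The two remaining
    pairings, of [U w] with [F'] and of [F] with [U w'], both equal [inner w w'] by the
    orthogonality relations. Applied to a pair and itself it shows that the eigenvalue is real. *)
Lemma eigenpair_symmetric U B lam lam' F F' w w' df df' :
  cmeas U -> (forall x, normc (U x) <= B) ->
  eigenpair U lam F w df -> eigenpair U lam' F' w' df' ->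
  (lam - lam'^*%C) * inner F F' = 0.
Proof.
move=> mU UB [[hF pF ldf hw edf] orth] [[hF' pF' ldf' hw' edf'] orth'].
have [lF _] := hF; have [lF' _] := hF'; have [lw _] := hw; have [lw' _] := hw'.
have lU G : L2 G -> L2 (fun x => (U x)^*%C * G x).
  move=> lG; under [X in L2 X]eq_fun do rewrite mulrC.
  by apply: (@L2_bounded _ _ _ B) => // [|x]; [exact: cmeasJ|rewrite normcJ].
have n1 : null (fun x => ((U x)^*%C * F x - w x) * (w' x)^*%C).
  by split; [apply: cint_inner => //; apply: L2B => //; exact: lU|exact: orth].
have n2 : null (fun x => (((U x)^*%C * F' x - w' x) * (w x)^*%C)^*%C).
  by apply: nullJ; split; [apply: cint_inner => //; apply: L2B => //; exact: lU|exact: orth'].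
have n3 : null (fun x => (F' x)^*%C * df x + F x * (df' x)^*%C).
  have i : cint (fun x => (F' x)^*%C * df x + F x * (df' x)^*%C).
    by apply: cintD; apply: L2_mul => //; exact: L2J.
  split=> //; apply: (cintegral_deriv_eq0 (F := fun x => F x * (F' x)^*%C) _ _ i); last exact: cint_inner.
  by apply: (primitiveM pF (primitiveJ pF')); [exact: L2_cmeas|apply: cmeasJ; exact: L2_cmeas].
have [i4 n4] := nullB (nullZ (- 'i) n3) (nullB n2 n1).
rewrite -n4 -cintegralZ; last exact: cint_inner.
apply: cintegral_ae => //.
- by apply: cmeasZ; apply: cint_cmeas; exact: cint_inner.
- exact: cint_cmeas.
apply: (ae_imp2 _ edf edf') => x /(_ I) /= -> /(_ I) /= -> _.
rewrite !(conjcM, conjcB, conjcD) !conjcK conjc_i.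
(* A variable [j] stands for ['i] in the ring identity; [i^2 = -1] enters only afterwards. *)
have E (j a b z z' : C) : - j * (a * (j * z) + b * (- j * z')) = - (j * j) * (a * z - b * z').
  by ring.
rewrite E mulcii; ring.
Qed.

(** Put [r = \bar U F - w], which is orthogonal to the Hardy space. The derivative of [phi \bar F]
    is then [i (|F|^2 k^2 + w(iy) \bar r k)] plus terms of integral 0: conjugates of Hardy functions
    against [k] in [nA], [nD], [nE], and pairings of [r] with Hardy functions in [nG], [nK]. The two
    terms [|w|^2 k] cancel. Cauchy's formula for [w(iy)] supplies the [2 pi] and one of the two
    integrals. *)
Lemma eigenpair_identity U B lam F w df y : 0 < y ->
  hardy U -> seq_continuous U -> 0 <= B -> (forall x, normc (U x) <= B) ->
  lam^*%C = lam -> eigenpair U lam F w df ->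
  (2 * pi)%:C * cintegral (fun x => F x * (F x)^*%C * ker (- y) x ^+ 2) =
  cintegral (fun x => U x * (F x)^*%C * ker (- y) x) *
  cintegral (fun x => (U x)^*%C * F x * ker (- y) x).
Proof.
move=> y0 hU cU B0 UB lamR [[hF pF ldf hw edf] orth].
have [lF _] := hF; have [lw _] := hw; have [lU _] := hU.
have mU := seq_continuous_cmeas cU.
have Ny0 : - y != 0 by rewrite oppr_eq0 gt_eqF.
have kB x : normc (ker (- y) x) <= y^-1.
  by have := normc_ker_le x Ny0; rewrite normrN gtr0_norm.
have mk := cmeas_ker Ny0.
have ik G H : L2 G -> L2 H -> cint (fun x => G x * H x * ker (- y) x).
  by move=> lG lH; apply: (@cint_bounded _ _ _ y^-1) => //; exact: L2_mul.
have hUw := hardyM hU hw cU B0 UB; have [lUw _] := hUw.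
have lUF : L2 (fun x => (U x)^*%C * F x).
  under [X in L2 X]eq_fun do rewrite mulrC.
  by apply: (@L2_bounded _ _ _ B) => // [|x]; [exact: cmeasJ|rewrite normcJ].
pose r x := (U x)^*%C * F x - w x; have lr : L2 r by exact: L2B.
pose k := ker (- y).
pose c := cauchy_value F y; pose phi x := (F x - c) * k x.
(* [w * k] need not be in the Hardy space, since [k] has its pole at [i y]. Subtracting the value
   there repairs this, and the subtracted part is the one that survives integration. *)
pose cw := cauchy_value w y; pose hw' x := (w x - cw) * k x.
have hphi : hardy phi by exact: hardy_resolvent.
have hhw' : hardy hw' by exact: hardy_resolvent.
have [lphi _] := hphi; have [lhw' _] := hhw'.
have null_r h : hardy h -> null (fun x => (r x)^*%C * h x).
  move=> hh; have [lh _] := hh.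
  have n : null (fun x => r x * (h x)^*%C) by split; [exact: cint_inner|exact: orth].
  have := nullJ n; congr null; apply/funext => x.
  by rewrite conjcM conjcK.
have nA : null (fun x => (F x)^*%C * k x) by exact: null_conj_ker.
have nD : null (fun x => (F x)^*%C * k x ^+ 2).
  have := nullZ (-1) (null_conj_ker y0 (hardy_ker_mul y0 hF)); congr null.
  by apply/funext => x; rewrite conjcM kerJ /k; ring.
have nE : null (fun x => (U x * w x)^*%C * k x) by exact: null_conj_ker.
have nG : null (fun x => (r x)^*%C * hw' x) by exact: null_r.
have nK : null (fun x => r x * (w x)^*%C * k x).
  have := nullZ (-1) (nullJ (null_r _ (hardy_ker_mul y0 hw))); congr null.
  by apply/funext => x; rewrite !conjcM conjcK kerJ /k; ring.
have nr : null (fun x => r x * k x).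
  have := nullZ (-1) (nullJ (null_r _ (hardy_ker y0))); congr null.
  by apply/funext => x; rewrite !conjcM conjcK kerJ /k; ring.
have nw : null (fun x => (w x)^*%C * k x) by exact: null_conj_ker.
have iB : cint (fun x => F x * (F x)^*%C * k x ^+ 2).
  under [X in cint X]eq_fun do rewrite expr2 mulrA.
  apply: (@cint_bounded _ _ _ y^-1) => //; apply: ik => //; exact: L2J.
have iH : cint (fun x => (r x)^*%C * k x) by apply: L2_mul; [exact: L2J|exact: L2_ker].
pose k' x := 'i * k x ^+ 2.
have pphi : primitive phi (fun x => k x * (df x - 0) + (F x - c) * k' x).
  apply: (primitiveM (primitiveB pF (primitive_cst c)) (primitive_ker Ny0)).
    by apply: cmeasB; [exact: L2_cmeas|exact: cmeas_cst].
  by apply: cmeasZ; apply: cmeasX.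
have dphiE : (fun x => k x * (df x - 0) + (F x - c) * k' x) = (fun x => df x * k x + 'i * (phi x * k x)).
  by apply/funext => x; rewrite /k' /phi; ring.
rewrite dphiE in pphi.
have ldphi : L2 (fun x => df x * k x + 'i * (phi x * k x)).
  by apply: L2D; [exact: L2_mul_ker|apply: L2Z; exact: L2_mul_ker].
pose dv x := (F x)^*%C * (df x * k x + 'i * (phi x * k x)) + phi x * (df x)^*%C.
have ndv : null dv.
  have i : cint dv by apply: cintD; apply: L2_mul => //; exact: L2J.
  split=> //; apply: (cintegral_deriv_eq0 (F := fun x => phi x * (F x)^*%C) _ _ i); last exact: cint_inner.
  apply: (primitiveM pphi (primitiveJ pF)); first exact: L2_cmeas.
  by apply: cmeasJ; exact: L2_cmeas.
(* The coefficients are those with which the null terms occur in [dv] divided by ['i], once [df] is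
   replaced by its equation. *)
have nT := nullB (nullD (nullB (nullD (nullZ (lam * c) nA) (nullZ c nE)) (nullZ c nD)) nG) nK.
have [iT T0] := nT; have [idv dv0] := ndv.
have E : 'i * (cintegral (fun x => F x * (F x)^*%C * k x ^+ 2) +
    cw * cintegral (fun x => (r x)^*%C * k x)) = 0.
  rewrite -dv0 -[cintegral (fun x => F x * _ * _)]add0r -T0 -cintegralZ//.
  rewrite -!cintegralD//; [|exact: cintD|exact: cintZ].
  rewrite -cintegralZ; last by apply: cintD; [exact: cintD|exact: cintZ].
  apply: cintegral_ae.
  - apply: cint_cmeas; apply: cintZ; apply: cintD; [exact: cintD|exact: cintZ].
  - exact: cint_cmeas.
  apply: (ae_imp _ edf) => x /(_ I) /= e _; rewrite /dv e.
  rewrite /r /hw' /phi !(conjcM, conjcB, conjcD) !conjcK conjc_i lamR.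
  ring.
have {}E : cintegral (fun x => F x * (F x)^*%C * k x ^+ 2) = - cw * cintegral (fun x => (r x)^*%C * k x).
  move/eqP: E; rewrite mulf_eq0 => /orP[/eqP/(congr1 Im)/=/eqP|].
    by rewrite oner_eq0.
  by rewrite addr_eq0 mulNr => /eqP.
have eH : cintegral (fun x => (r x)^*%C * k x) = cintegral (fun x => U x * (F x)^*%C * k x).
  have [iw w0] := nw; rewrite -[LHS]addr0 -w0 -cintegralD//.
  by apply: eq_cintegral => x; rewrite /r conjcB conjcM conjcK; ring.
have ew : cintegral (fun x => w x * k x) = cintegral (fun x => (U x)^*%C * F x * k x).
  have [ir r0] := nr; rewrite -[LHS]addr0 -r0 -cintegralD//; last exact: cint_L2_ker.
  by apply: eq_cintegral => x; rewrite /r; ring.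
rewrite E eH /cw /cauchy_value ew.
have q0 : (2 * pi)%:C != 0 :> C.
  by rewrite eq_complex /= eqxx andbT mulf_neq0 ?pnatr_eq0// gt_eqF// pi_gt0.
have -> : ((2 * pi)^-1)%:C = ((2 * pi)%:C)^-1 :> C by rewrite fmorphV.
move: (_%:C) q0 (cintegral _) (cintegral _) => q q0 I1 I2.
transitivity (q * q^-1 * (I1 * I2)); first by ring.
by rewrite mulfV// mul1r.
Qed.

(** The identity is taken at [y = n + 1], with one factor [y] for each kernel. The function
    [y ker (- y)] is minus the conjugate of the multiplier in [ccvg_Ntimes_ker], so it tends to -1
    inside the unit disc; it occurs twice on each side, and the signs disappear. *)
Lemma eigenpair_norm U B lam F w df :
  hardy U -> seq_continuous U -> 0 <= B -> (forall x, normc (U x) <= B) ->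
  lam^*%C = lam -> eigenpair U lam F w df ->
  inner U F * (inner U F)^*%C = (2 * pi * L2norm F ^+ 2)%:C.
Proof.
move=> hU cU B0 UB lamR ep; have [[[lF _] _ _ _ _] _] := ep; have [lU _] := hU.
pose k n x := n.+1%:R%:C * ker n.+1%:R x : C.
have kN n x : n.+1%:R%:C * ker (- n.+1%:R) x = - (k n x)^*%C.
  by rewrite /k conjcM conjc_real kerJ mulrN opprK.
have mk n : cmeas (fun x => - (k n x)^*%C).
  by apply: cmeasN; apply: cmeasJ; apply: cmeasZ; apply: cmeas_ker; rewrite pnatr_eq0.
have k1 n x : normc (- (k n x)^*%C) <= 1 by rewrite normcN normcJ normc_Ntimes_ker.
have ck x : ccvg (fun n => - (k n x)^*%C) (- 1).
  apply: ccvgN; apply/ccvg_normcP; have /ccvg_normcP := @ccvg_Ntimes_ker R x.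
  apply: cvg_trans; apply: near_eq_cvg; apply: nearW => n.
  by rewrite -[RHS]normcJ conjcB conjc1 conjcK.
have lim G j : cint G -> ccvg (fun n => cintegral (fun x => G x * (- (k n x)^*%C) ^+ j))
    (cintegral (fun x => G x * (-1) ^+ j)).
  move=> iG; apply: (cDCT _ _ _ (cint_normc iG)).
  - by move=> n; apply: cmeasM; [exact: cint_cmeas|exact: cmeasX].
  - by apply: cmeasM; [exact: cint_cmeas|exact: cmeas_cst].
  - apply: aeW => x; apply: ccvgM; first exact: ccvg_cst.
    elim: j => [|j IHj]; first exact: ccvg_cst.
    by under [X in ccvg X]eq_fun do rewrite exprS; rewrite exprS; exact: ccvgM.
  - by move=> n x; rewrite normcM normcX ler_piMr ?normc_ge0// exprn_ile1 ?normc_ge0.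
have iFF : cint (fun x => F x * (F x)^*%C) by exact: cint_inner.
have iUF : cint (fun x => U x * (F x)^*%C) by exact: cint_inner.
have iFU : cint (fun x => (U x)^*%C * F x) by apply: L2_mul => //; exact: L2J.
have E n : (2 * pi)%:C * cintegral (fun x => F x * (F x)^*%C * (- (k n x)^*%C) ^+ 2) =
    cintegral (fun x => U x * (F x)^*%C * (- (k n x)^*%C) ^+ 1) *
    cintegral (fun x => (U x)^*%C * F x * (- (k n x)^*%C) ^+ 1).
  have n0 : 0 < n.+1%:R :> R by rewrite ltr0n.
  have Nn0 : - n.+1%:R != 0 :> R by rewrite oppr_eq0 gt_eqF.
  have mkN := cmeas_ker Nn0.
  have kB x : normc (ker (- n.+1%:R) x) <= `|- n.+1%:R|^-1 by exact: normc_ker_le.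
  under eq_cintegral do rewrite -kN exprMn mulrCA.
  under [X in _ = X * _]eq_cintegral do rewrite expr1 -kN mulrCA.
  under [X in _ = _ * X]eq_cintegral do rewrite expr1 -kN mulrCA.
  rewrite !cintegralZ; try by apply: (@cint_bounded _ _ _ `|- n.+1%:R|^-1).
    by rewrite mulrCA (eigenpair_identity n0 hU cU B0 UB lamR ep); ring.
  apply: (@cint_bounded _ _ _ (`|- n.+1%:R|^-1 ^+ 2)) => //; first exact: cmeasX.
  by move=> x; rewrite normcX lerXn2r ?nnegrE ?normc_ge0.
have := ccvgM (lim _ 1%N iUF) (lim _ 1%N iFU).
under [X in ccvg X]eq_fun do rewrite -E.
move=> lim1; have := ccvg_unique lim1 (ccvgM (ccvg_cst _) (lim _ 2%N iFF)).
have -> : cintegral (fun x => U x * (F x)^*%C * (-1) ^+ 1) = - inner U F.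
  by rewrite /inner -cintegralN//; apply: eq_cintegral => x; rewrite expr1 mulrN1.
have -> : cintegral (fun x => (U x)^*%C * F x * (-1) ^+ 1) = - (inner U F)^*%C.
  rewrite /inner -cintegralJ// -cintegralN; last exact: cintJ.
  by apply: eq_cintegral => x; rewrite expr1 mulrN1 conjcM conjcK.
have -> : cintegral (fun x => F x * (F x)^*%C * (-1) ^+ 2) = inner F F.
  by apply: eq_cintegral => x; rewrite sqrrN expr1n mulr1.
by rewrite mulrNN inner_self -rmorphM.
Qed.

End Eigenpairs.

(** * Bessel's inequality and the count of eigenvalues *)

Section Spectrum.
Context {R : realType}.
Local Notation C := R[i].
Local Notation mu := (@lebesgue_measure R).
Implicit Types (f g h F G U u w df psi v : R -> C) (lam : C).

Lemma primitiveZ (c : C) F f : primitive F f -> primitive (fun x => c * F x) (fun x => c * f x).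
Proof.
move=> [lf Ff]; split=> [a b|a b ab].
  by under [X in cint X]eq_fun do rewrite mulrCA; exact: cintZ.
by under eq_cintegral do rewrite mulrCA; rewrite cintegralZ// (Ff _ _ ab) mulrDr.
Qed.

Lemma eigenpair_comb U B lam F F' w w' df df' (c : C) :
  cmeas U -> (forall x, normc (U x) <= B) ->
  eigenpair U lam F w df -> eigenpair U lam F' w' df' ->
  eigenpair U lam (fun x => F' x - c * F x) (fun x => w' x - c * w x)
    (fun x => df' x - c * df x).
Proof.
move=> mU UB [[hF pF ldf hw edf] orth] [[hF' pF' ldf' hw' edf'] orth'].
have lT G H : hardy G -> hardy H -> L2 (fun x => (U x)^*%C * G x - H x).
  move=> [lG _] [lH _]; apply: L2B => //.
  under [X in L2 X]eq_fun do rewrite mulrC.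
  by apply: (@L2_bounded _ _ _ B) => // [|x]; [exact: cmeasJ|rewrite normcJ].
split.
  split.
  - by apply: hardyB => //; exact: hardyZ.
  - by apply: primitiveB => //; exact: primitiveZ.
  - by apply: L2B => //; exact: L2Z.
  - by apply: hardyB => //; exact: hardyZ.
  - by apply: (ae_imp2 _ edf edf') => x /(_ I) /= -> /(_ I) /= -> _; ring.
move=> h hh; have [lh _] := hh; have lT1 := lT _ _ hF hw; have lT2 := lT _ _ hF' hw'.
rewrite -(subrr 0) -{1}(orth' _ hh) -(mulr0 c) -(orth _ hh) -innerZl// -innerBl//; last exact: L2Z.
by congr inner; apply/funext => x; ring.
Qed.

Lemma inner_norm_gt0 f : L2 f -> ~ (f = (fun=> 0) %[ae mu]) -> 0 < L2norm f ^+ 2.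
Proof.
move=> lf f0; rewrite lt_neqAle sqr_ge0 andbT eq_sym; apply/eqP => n0.
by apply: f0; exact: L2norm_eq0.
Qed.

Lemma L2norm_ae f g : L2 f -> L2 g -> f = g %[ae mu] -> L2norm f ^+ 2 = L2norm g ^+ 2.
Proof.
move=> lf lg fg; have := inner_ae lf lg lf lg fg fg.
by rewrite !inner_self => -[].
Qed.

(** Every normalised coefficient has the same square [a]. Induction subtracts from [v] its
    projection on the last vector: this lowers the squared norm by exactly [a] and leaves the other
    coefficients unchanged. *)
Lemma bessel n v (psi : nat -> R -> C) (a : R) : L2 v ->
  (forall i, (i < n)%N -> L2 (psi i)) ->
  (forall i, (i < n)%N -> 0 < L2norm (psi i) ^+ 2) ->
  (forall i, (i < n)%N -> normc (inner v (psi i)) ^+ 2 = a * L2norm (psi i) ^+ 2) ->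
  (forall i j, (i < n)%N -> (j < n)%N -> i != j -> inner (psi i) (psi j) = 0) ->
  n%:R * a <= L2norm v ^+ 2.
Proof.
elim: n v => [|n IHn] v lv lpsi psi0 vpsi orth; first by rewrite mul0r sqr_ge0.
have ln := lpsi n (ltnSn n); have n0 := psi0 n (ltnSn n).
set N := L2norm (psi n) ^+ 2 in n0 *; set z := inner v (psi n).
pose c : C := z / N%:C.
have NC : N%:C != 0 :> C by rewrite eq_complex /= eqxx andbT gt_eqF.
have cN : c * N%:C = z by rewrite mulfVK.
have lcn := L2Z c ln.
pose v' x := v x - c * psi n x; have lv' : L2 v' by exact: L2B.
have v'n : inner v' (psi n) = 0.
  by rewrite innerBl// innerZl// inner_self -/N cN subrr.
have vn' : inner v' v' = (L2norm v ^+ 2 - a)%:C.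
  transitivity (inner v' v - inner v' (fun x => c * psi n x)); first by rewrite -innerBr.
  rewrite innerZr// v'n mulr0 subr0 innerBl// innerZl// (innerC lv ln) inner_self.
  rewrite rmorphB; congr (_ - _); rewrite /c mulrAC mulcJ_normc vpsi//.
  by rewrite rmorphM /= mulfK.
have : n%:R * a <= L2norm v' ^+ 2.
  apply: IHn => // [i lt|i lt|i lt|i j li lj].
  - by apply: lpsi; exact: ltnW.
  - by apply: psi0; exact: ltnW.
  - have li := ltnW lt; rewrite -(vpsi i li); congr (normc _ ^+ 2).
    have li' := lpsi i li.
    rewrite innerBl// innerZl// orth ?mulr0 ?subr0// neq_ltn.
    by rewrite lt orbT.
  - by apply: orth; exact: ltnW.
move: vn'; rewrite inner_self => -[->]; rewrite lerBrDr -natr1 mulrDl mul1r.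
by [].
Qed.

Lemma eigenvector_eigenpair u U B lam psi : u = U %[ae mu] ->
  hardy U -> seq_continuous U -> 0 <= B -> (forall x, normc (U x) <= B) ->
  lax_eigenvector u lam psi ->
  exists F w df, [/\ eigenpair U lam F w df, psi = F %[ae mu], 0 < L2norm F ^+ 2,
    lam^*%C = lam & normc (inner U F) ^+ 2 = 2 * pi * L2norm F ^+ 2].
Proof.
move=> uU hU cU B0 UB [eig psi0].
have [F [w [df [ep psiF]]]] := lax_eigenpair uU hU cU B0 UB eig.
have [[[lF _] _ _ _ _] _] := ep.
have F0 : 0 < L2norm F ^+ 2.
  apply: inner_norm_gt0 => // F0; apply: psi0.
  by apply: (ae_imp2 _ psiF F0) => x /(_ I) /= -> /(_ I).
(* Elements of the point spectrum are complex a priori; symmetry of the pair with itself makes them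
   real, as the norm identity requires. *)
have lamR : lam^*%C = lam.
  have := eigenpair_symmetric (seq_continuous_cmeas cU) UB ep ep.
  move=> /eqP; rewrite mulf_eq0 subr_eq0 => /orP[/eqP <-//|].
  by rewrite inner_self eq_complex /= eqxx andbT gt_eqF.
exists F, w, df; split=> //.
by have := eigenpair_norm hU cU B0 UB lamR ep; rewrite mulcJ_normc => -[].
Qed.

(** Bessel's inequality with [a = 2 pi]. The bound concerns any finite list of distinct eigenvalues,
    so that it can itself prove that the point spectrum is finite. *)
Lemma eigenvalues_bound u U B n (e : nat -> C) : u = U %[ae mu] ->
  hardy U -> seq_continuous U -> 0 <= B -> (forall x, normc (U x) <= B) ->
  (forall i, (i < n)%N -> point_spectrum u (e i)) ->
  (forall i j, (i < n)%N -> (j < n)%N -> e i = e j -> i = j) ->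
  n%:R * (2 * pi) <= L2norm U ^+ 2.
Proof.
move=> uU hU cU B0 UB eP einj; have [lU _] := hU.
have /choice[F FP] : forall i, exists F, (i < n)%N ->
    exists w df, [/\ eigenpair U (e i) F w df, 0 < L2norm F ^+ 2,
      (e i)^*%C = e i & normc (inner U F) ^+ 2 = 2 * pi * L2norm F ^+ 2].
  move=> i; have [lt|] := boolP (i < n)%N; last by exists (fun=> 0).
  have [psi eig] := eP i lt.
  have [F [w [df [ep _ F0 eR FN]]]] := eigenvector_eigenpair uU hU cU B0 UB eig.
  by exists F => _; exists w, df.
apply: (bessel (psi := F)) => // [i lt|i lt|i lt|i j li lj ij].
- by have [w [df [[[[lF _] _ _ _ _] _] _ _ _]]] := FP i lt.
- by have [w [df []]] := FP i lt.
- by have [w [df []]] := FP i lt.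
have [w [df [ep _ eR _]]] := FP i li; have [w' [df' [ep' _ eR' _]]] := FP j lj.
have := eigenpair_symmetric (seq_continuous_cmeas cU) UB ep ep'.
rewrite eR' => /eqP; rewrite mulf_eq0 subr_eq0 => /orP[/eqP/(einj _ _ li lj)/eqP|/eqP//].
by rewrite (negbTE ij).
Qed.

End Spectrum.

Theorem proposition5p1 (R : realType) (u : R -> R[i]) (hu : H1p u) :
  [/\ forall (psi : R -> R[i]) (lam : R),
        H1p psi -> lax u psi (fun x => lam%:C * psi x) ->
        `|inner u psi| ^+ 2 = (2 * pi * L2norm psi ^+ 2)%:C,
      forall lam : R[i], point_spectrum u lam -> simple_eigenvalue u lam,
      exists N : nat, (point_spectrum u #= `I_N)%card /\
        N%:R <= L2norm u ^+ 2 / (2 * pi)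
    & L2norm u ^+ 2 < 2 * pi -> point_spectrum u = set0].
Proof.
have [[lu [du ldu wdu]] pu] := hu.
have [U [pU hU uU]] := L2p_primitive pu ldu wdu; have [lU _] := hU.
have [B B0 UB] := primitive_L2_bounded pU lU ldu.
have cU : seq_continuous U by move=> s x; exact: primitive_ccvg pU.
have mU := seq_continuous_cmeas cU.
have pi2 : 0 < 2 * pi :> R by rewrite mulr_gt0// pi_gt0.
have bound n (e : nat -> R[i]) : (forall i, (i < n)%N -> point_spectrum u (e i)) ->
    (forall i j, (i < n)%N -> (j < n)%N -> e i = e j -> i = j) ->
    n%:R <= L2norm u ^+ 2 / (2 * pi).
  move=> eP einj; rewrite ler_pdivlMr// (L2norm_ae lu lU uU).
  exact: (eigenvalues_bound uU hU cU B0 UB eP einj).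
split.
- move=> psi lam [[lpsi _] _] eig.
  have [F [w [df [ep psiF]]]] := lax_eigenpair uU hU cU B0 UB eig.
  have [[[lF _] _ _ _ _] _] := ep.
  rewrite normcE_norm (inner_ae lu lU lpsi lF uU psiF) (L2norm_ae lpsi lF psiF).
  transitivity (normc (inner U F) ^+ 2)%:C; first by rewrite rmorphXn.
  rewrite -mulcJ_normc.
  exact: (eigenpair_norm hU cU B0 UB (conjc_real _) ep).
- move=> lam [psi eig]; exists psi => // f eigf.
  have [F [w [df [ep psiF F0 lamR FN]]]] := eigenvector_eigenpair uU hU cU B0 UB eig.
  have [F' [w' [df' [ep' fF']]]] := lax_eigenpair uU hU cU B0 UB eigf.
  have [[[lF _] _ _ _ _] _] := ep; have [[[lF' _] _ _ _ _] _] := ep'.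
  have UF0 : inner U F != 0.
    rewrite -normc_eq0 -sqrf_eq0 FN mulf_neq0 ?gt_eqF//.
  (* The conjugate compensates the antilinearity of [inner] in its second argument: [F' - c F]
     becomes orthogonal to [U], and the norm identity makes it 0. *)
  pose c := (inner U F' / inner U F)^*%C; exists c.
  have ep'' := eigenpair_comb c mU UB ep ep'.
  have := eigenpair_norm hU cU B0 UB lamR ep''.
  have lcF := L2Z c lF.
  rewrite innerBr// innerZr// -[X in _ - X * _]/(c^*%C) /c conjcK divfK// subrr mul0r => -[/esym/eqP].
  rewrite mulf_eq0 gt_eqF//= => /eqP n0.
  have := L2norm_eq0 (L2B lF' lcF) n0.
  apply: (ae_imp2 _ (ae_imp2 _ psiF fF')); last by move=> x a b; exact: (conj a b).
  by move=> x [/(_ I) e1 /(_ I) e2] /(_ I) e3 _; rewrite e1 e2; apply/eqP; rewrite -subr_eq0 e3.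
- have [[N AN]|inf] := pselect (finite_set (point_spectrum u)).
    exists N; split=> //; have /card_set_bijP[f [fA finj fsurj]] := AN.
    have /choice[e eP] : forall i, exists lam, (i < N)%N -> point_spectrum u lam /\ f lam = i.
      move=> i; have [lt|] := boolP (i < N)%N; last by exists 0.
      by have [lam lamA fl] := fsurj i lt; exists lam.
    apply: (bound N e) => [i /eP[]//|i j /eP[_ fi] /eP[_ fj] eij].
    by rewrite -fi -fj eij.
  (* An infinite point spectrum would contain [M + 1] distinct eigenvalues, more than the bound
     permits. *)
  pose M := Num.truncn (L2norm u ^+ 2 / (2 * pi)).
  have [X XA Xn] := infinite_set_fset M.+1 inf.
  exfalso; have := truncnS_gt (L2norm u ^+ 2 / (2 * pi)); rewrite ltNge => /negP; apply.
  apply: (bound M.+1 (nth 0 (finmap.enum_fset X))) => [i lt|i j li lj /eqP].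
    by apply: XA => /=; apply: mem_nth; exact: leq_trans Xn.
  rewrite nth_uniq ?finmap.fset_uniq//; first by move/eqP.
  - exact: leq_trans Xn.
  - exact: leq_trans Xn.
- move=> small; rewrite -subset0 => lam lamA.
  have : (1%:R : R) <= L2norm u ^+ 2 / (2 * pi).
    by apply: (bound 1%N (fun=> lam)) => // -[|i] [|j].
  by rewrite ler_pdivlMr// mul1r leNgt small.
Qed.
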